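(* The following statements hold for all $k\in\mathbb{N}$ with $k\ge 3$: (i) $\mathrm{RTT}_k(F)=0$ for any $k$-vertex graph $F$; (ii) $\mathrm{RTT}_{k-1}(K_k)\geq \tfrac{1}{k}$; (iii) $\mathrm{RTT}_{k-1}(F)\le \tfrac{1}{k}$ for all $k$-vertex graphs $F$; (iv) $\mathrm{RTT}_2(T)=0$ for any $k$-vertex tree $T$; (v) $\mathrm{RTT}_{2}(F)\geq \tfrac{\gamma(F)}{k}$ for any $k$-vertex graph $F$, where $\gamma(F)$ is defined as the minimum size of a subset $S\subset V(F)$ such that $F-S$ is acyclic; (vi) $\mathrm{RTT}_{2}(C_k)\leq \tfrac{1}{k}$ for the $k$-vertex cycle $C_k$.
   Context: Graphs are finite and simple; $\delta(G)$ is the minimum degree and $K_k$ the complete graph on $k$ vertices. For $r\in\mathbb{N}$, $\alpha_r(G)$ is the largest size of a set $U\subset V(G)$ such that $G[U]$ contains no copy of $K_r$. An $F$-tiling in $G$ is a collection of vertex-disjoint copies of $F$ in $G$ (not necessarily induced). For $\eta\in(0,1]$ and a $k$-vertex graph $F$, an $F$-tiling in $G$ is $\eta$-quasiperfect if it covers all but at most $\lfloor 1/\eta\rfloor (k-1)$ vertices of $G$. For a $k$-vertex graph $F$ and an integer $1\le r\le k$, the Ramsey--Turán tiling threshold $\mathrm{RTT}_r(F)$ is the largest $\eta_0\ge 0$ such that for all $0<\eta<\eta_0$ and $\alpha>0$, for all sufficiently large $n$ there exists an $n$-vertex graph $G$ with $\delta(G)\ge \eta n$ and $\alpha_r(G)\le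 \alpha n$ such that $G$ does not contain an $\eta$-quasiperfect $F$-tiling. *)

(* Defs.v *)
From HB Require Import structures.
From mathcomp Require Import all_boot all_order all_algebra.
From mathcomp Require Import boolp classical_sets reals.

Set Implicit Arguments.
Unset Strict Implicit.
Unset Printing Implicit Defensive.

Import Order.TTheory GRing.Theory Num.Theory.

Local Open Scope ring_scope.

Record sgraph := SGraph {
  vertex :> finType;
  adj : rel vertex;
  adj_sym : symmetric adj;
  adj_irrefl : irreflexive adj }.

Section Complete.
Variable r : nat.
Definition complete_adj : rel 'I_r := fun i j => i != j.
Lemma complete_adj_sym : symmetric complete_adj.
Proof. by move=> i j; rewrite /complete_adj eq_sym. Qed.
Lemma complete_adj_irrefl : irreflexive complete_adj.
Proof. by move=> i; rewrite /complete_adj eqxx. Qed.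
Definition complete_graph := SGraph complete_adj_sym complete_adj_irrefl.
End Complete.

(* [ordS] is the successor modulo [m]; the graph is a cycle only for [3 <= m],
   and [i != j] just excludes the loop when [m = 1]. *)
Section Cycle.
Variable m : nat.
Definition cycle_adj : rel 'I_m :=
  fun i j => (i != j) && ((j == ordS i) || (i == ordS j)).
Lemma cycle_adj_sym : symmetric cycle_adj.
Proof. by move=> i j; rewrite /cycle_adj eq_sym orbC. Qed.
Lemma cycle_adj_irrefl : irreflexive cycle_adj.
Proof. by move=> i; rewrite /cycle_adj eqxx. Qed.
Definition cycle_graph := SGraph cycle_adj_sym cycle_adj_irrefl.
End Cycle.

Section Induced.
Variables (G : sgraph) (U : {set G}).
Definition induced_adj : rel {x : G | x \in U} := fun x y => adj (val x) (val y).
Lemma induced_adj_sym : symmetric induced_adj.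
Proof. by move=> x y; rewrite /induced_adj adj_sym. Qed.
Lemma induced_adj_irrefl : irreflexive induced_adj.
Proof. by move=> x; rewrite /induced_adj adj_irrefl. Qed.
Definition induced := SGraph induced_adj_sym induced_adj_irrefl.
End Induced.

(* The copy of [F] in [G] given by [f] has vertex set [[set f x | x : F]]; it need not be
   induced. *)
Definition is_copy (F G : sgraph) (f : {ffun F -> G}) : bool :=
  injectiveb f && [forall x, forall y, adj x y ==> adj (f x) (f y)].

Definition has_copy (F G : sgraph) : bool := [exists f : {ffun F -> G}, is_copy f].

Definition degree (G : sgraph) (x : G) : nat := #|[pred y | adj x y]|.

(* All degrees are below [#|G|], so the default value only matters for the
   graph without vertices, where it gives 0. *)
Definition min_degree (G : sgraph) : nat := \big[minn/#|G|]_(x : G) degree x.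

Definition alphar (r : nat) (G : sgraph) : nat :=
  \max_(U : {set G} | ~~ has_copy (complete_graph r) (induced U)) #|U|.

Definition acyclic (G : sgraph) : Prop :=
  forall m, (3 <= m)%N -> ~~ has_copy (cycle_graph m) G.

Definition is_tree (T : sgraph) : Prop :=
  [/\ (0 < #|T|)%N, forall x y : T, connect (@adj T) x y & acyclic T].

(* [S := setT] always qualifies, so the default value [#|F|] is harmless. *)
Definition gamma (F : sgraph) : nat :=
  \big[minn/#|F|]_(S : {set F} | `[< acyclic (induced (~: S)) >]) #|S|.

(* A tiling is given by a set of embeddings; for nonempty [F] disjointness makes
   distinct embeddings have distinct copies. *)
Definition is_tiling (F G : sgraph) (T : {set {ffun F -> G}}) : Prop :=
  (forall f, f \in T -> is_copy f) /\
  (forall f g, f \in T -> g \in T -> f != g ->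
     [disjoint [set f x | x : F] & [set g x | x : F]]).

Definition covered (F G : sgraph) (T : {set {ffun F -> G}}) : {set G} :=
  \bigcup_(f in T) [set f x | x : F].

Definition quasiperfect (R : realType) (eta : R) (F G : sgraph)
    (T : {set {ffun F -> G}}) : Prop :=
  (#|~: covered T|%:Z <= Num.floor (1 / eta) * (#|F| - 1)%N%:Z)%R.

Definition has_quasiperfect_tiling (R : realType) (eta : R) (F G : sgraph) : Prop :=
  exists2 T : {set {ffun F -> G}}, is_tiling T & quasiperfect eta T.

Definition RTT_admissible (R : realType) (r : nat) (F : sgraph) (eta0 : R) : Prop :=
  0 <= eta0 /\
  forall eta alpha : R, 0 < eta -> eta < eta0 -> 0 < alpha ->
  exists N : nat, forall n : nat, (N <= n)%N ->
  exists G : sgraph,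
    [/\ #|G| = n,
        eta * n%:R <= (min_degree G)%:R,
        (alphar r G)%:R <= alpha * n%:R
      & ~ has_quasiperfect_tiling eta F G].

(* The supremum is a maximum: see [RTT_largest]. *)
Definition RTT (R : realType) (r : nat) (F : sgraph) : R :=
  sup (@RTT_admissible R r F : set R).

Lemma min_degree_le_card (G : sgraph) : (min_degree G <= #|G|)%N.
Proof.
by rewrite /min_degree; elim/big_rec: _ => // x m _ mG; rewrite geq_min mG orbT.
Qed.

Lemma RTT_admissible0 (R : realType) r F : @RTT_admissible R r F 0.
Proof. by split=> // e a e0 /(lt_trans e0); rewrite ltxx. Qed.

Lemma RTT_admissible_le1 (R : realType) r F (eta0 : R) :
  RTT_admissible r F eta0 -> eta0 <= 1.
Proof.
move=> [_ H]; rewrite leNgt; apply/negP => lt1.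
have [lt1m ltm] := midf_lt lt1.
have [N /(_ N.+1 (leqnSn _)) [G [cG dG _ _]]] :=
  H _ 1 (lt_trans ltr01 lt1m) ltm ltr01.
have : (min_degree G)%:R <= N.+1%:R :> R.
  by rewrite ler_nat -cG min_degree_le_card.
by move=> /(le_trans dG); rewrite leNgt ltr_pMl ?ltr0n ?lt1m.
Qed.

Lemma RTT_largest (R : realType) r F :
  RTT_admissible r F (RTT R r F) /\
  forall eta0 : R, RTT_admissible r F eta0 -> eta0 <= RTT R r F.
Proof.
have ub (e : R) : RTT_admissible r F e -> e <= RTT R r F.
  apply: (@ub_le_sup R (@RTT_admissible R r F)).
  by exists 1 => x; exact: RTT_admissible_le1.
split=> //; split; first exact/ub/RTT_admissible0.
move=> eta alpha eta0 /sup_gt[|e [_ He] ltee alpha0].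
  by exists 0; exact: RTT_admissible0.
exact: He.
Qed.

(* Main.v *)
(** Upper bounds use absorption.  Two vertices with linearly many common
    neighbours are exchangeable: since linear sets span [F] minus a vertex, many
    disjoint sets complete either of them to a copy of [F].  When every degree
    exceeds [n / (c + 1)], with [c = floor (1 / eta)], any [c + 1] vertices
    contain an exchangeable pair, so up to a few vertices the vertex set splits
    into at most [c] parts whose members are joined by short chains of
    exchangeable pairs.  Inside one part, gadgets arranged along Montgomery's
    sparse template turn a random-like reservoir into a flexible absorber.  An
    almost perfect tiling of the rest is found greedily or by exchanging one tile
    for two, its leftover is covered from the reservoir, and the surplus of the
    reservoir in the parts is lowered by a token game, which gets stuck with at
    most [k - 1] vertices per part on average.

    For the lower bounds, a clique on [eta n] vertices is joined completely to a
    graph with small independence number that is [K_k]-free, respectively without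
    short cycles.  Every copy of [F] then meets the clique in at least one,
    respectively [gamma F], vertices, so linearly many vertices stay uncovered.
    The sparse graph arises by repeatedly adding a [K_r] on pairwise distant
    vertices of small degree, chosen so as to hit a constant proportion of the
    large sets that are still [K_r]-free. *)

Require Import Defs.
From mathcomp Require Import all_boot all_order all_algebra zify lra.
From mathcomp Require Import boolp reals.

Set Implicit Arguments.
Unset Strict Implicit.
Unset Printing Implicit Defensive.

Import Order.TTheory GRing.Theory Num.Theory.

(** * Matchings and templates *)

(** The allowance [floor (1 / eta) * (k - 1)] is [c] parts times [k - 1] vertices, exactly what the
    token game may leave; hence the insistence on at most [c] parts. To bound the threshold by [b],
    one suitable [eta] arbitrarily close above [b] suffices, so [eta] can be chosen to make [c]
    convenient. When linear sets contain all of [F], each part lowers its own surplus and any [eta]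
    will do. When they contain only [F] minus a vertex, as in (iii) and (vi), a tile takes [k - 1]
    vertices from one part and the last one from a part with many edges to it; surpluses of
    different parts then interact, and the game is won for at most [k - 1] parts. This is why [eta]
    is taken just above [1 / k], where [c = k - 1]. A gadget absorbs one vertex out of a list and
    costs an amount proportional to the list; the template keeps the total length of the lists
    linear in the reservoir, although every admissible remainder of the reservoir can be distributed
    among the gadgets. Random choices are replaced by counting or by a decreasing potential, and
    inequalities are cleared of denominators, so most of the argument lives in natural numbers. *)

Section Hall.
Variables (X E : finType) (e0 : E).

(** Induction on [D]. A proper nonempty tight [P] is matched inside its own neighbourhood and
    [D :\: P] outside it. If there is none, any element may take any of its candidates, since every
    other set loses at most one. The point [e0] supplies a function when [D] is empty. *)
Lemma hall_in (Q : X -> {set E}) (D : {set X}) :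
    (forall P : {set X}, P \subset D -> #|P| <= #|\bigcup_(i in P) Q i|) ->
  exists h : X -> E, {in D &, injective h} /\ forall i, i \in D -> h i \in Q i.
Proof.
have [s] := ubnP #|D|; elim: s D Q => // s IH D Q leDs hallQ.
have [->|[x xD]] := set_0Vmem D.
  by exists (fun=> e0); split=> [i j|i]; rewrite inE.
have [/existsP[P /and4P[PD P0 Pproper tight]]|] := boolP [exists P : {set X},
    [&& P \subset D, P != set0, P != D & #|\bigcup_(i in P) Q i| <= #|P|]].
- have PltD : #|P| < #|D| by rewrite proper_card // properEneq Pproper.
  have [|P' sP'|h1 [inj1 h1Q]] := IH P Q; first exact: leq_trans PltD _.
    by apply: hallQ; apply: subset_trans PD.
  pose NP := \bigcup_(i in P) Q i.
  have cDP : #|D :\: P| < s.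
    have := cardsID P D; rewrite (setIidPr PD).
    have : 0 < #|P| by rewrite card_gt0.
    lia.
  have [//|P' sP'|h2 [inj2 h2Q]] := IH (D :\: P) (fun i => Q i :\: NP).
    have dP : [disjoint P & P'].
      rewrite disjoint_sym disjoints_subset; apply: subset_trans sP' _.
      by rewrite setDE subsetIr.
    have := hallQ (P :|: P').
    rewrite subUset PD (subset_trans sP' (subsetDl _ _)) => /(_ isT).
    rewrite cardsU disjoint_setI0 // cards0 subn0 bigcup_setU.
    have -> : NP :|: \bigcup_(i in P') Q i = NP :|: \bigcup_(i in P') (Q i :\: NP).
      apply/setP=> y; rewrite !inE; case yNP: (y \in NP) => //=.
      apply/bigcupP/bigcupP=> -[i iP' yi]; exists i => //; last first.
        by move: yi; rewrite inE yNP.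
      by rewrite inE yNP.
    rewrite cardsU -/NP in tight *.
    by move: tight => /=; lia.
  exists (fun i => if i \in P then h1 i else h2 i); split=> [i j iD jD|i iD].
    case: ifP => iP; case: ifP => jP.
    - exact: inj1.
    - have := h2Q j; rewrite !inE jP jD => /(_ isT)/andP[h2n _] eqh.
      case/negP: h2n; rewrite -eqh; apply/bigcupP; exists i => //; exact: h1Q.
    - have := h2Q i; rewrite !inE iP iD => /(_ isT)/andP[h2n _] eqh.
      case/negP: h2n; rewrite eqh; apply/bigcupP; exists j => //; exact: h1Q.
    - by apply: inj2; rewrite inE ?iP ?jP.
  case: ifP => iP; first exact: h1Q.
  by have := h2Q i; rewrite !inE iP iD => /(_ isT)/andP[].
rewrite negb_exists => /forallP strict.
have [y yQ] : exists y, y \in Q x.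
  have := hallQ [set x]; rewrite sub1set xD cards1 big_set1 => /(_ isT).
  by case/card_gt0P=> y yQ; exists y.
have cDx : #|D :\ x| < s by move: leDs; rewrite (cardsD1 x) xD.
have [//|P sP|h [injh hQ]] := IH (D :\ x) (fun i => Q i :\ y).
  have [->|P0] := eqVneq P set0; first by rewrite cards0.
  have := strict P; rewrite P0 (subset_trans sP (subsetDl _ _)) /=.
  have -> /= : P != D.
    by apply: contraTneq sP => ->; apply/subsetPn; exists x; rewrite ?inE ?eqxx.
  rewrite -ltnNge => lt.
  have -> : \bigcup_(i in P) (Q i :\ y) = (\bigcup_(i in P) Q i) :\ y.
    apply/setP=> z; rewrite !inE; apply/bigcupP/andP.
      by case=> i iP; rewrite !inE => /andP[zy zi]; split=> //; apply/bigcupP; exists i.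
    by case=> zy /bigcupP[i iP zi]; exists i; rewrite ?inE ?zy.
  have := cardsD1 y (\bigcup_(i in P) Q i).
  by case: (y \in _) => /= E1; rewrite E1 in lt *; lia.
exists (fun i => if i == x then y else h i); split=> [i j iD jD|i iD].
  case: eqP => [->|/eqP ix]; case: eqP => [->|/eqP jx] //.
  - have := hQ j; rewrite !inE jx jD => /(_ isT)/andP[/eqP hy _] yh.
    by case: hy.
  - by have := hQ i; rewrite !inE ix iD => /(_ isT)/andP[/eqP hy _] yh.
  - by apply: injh; rewrite !inE ?ix ?jx.
case: eqP => [->//|/eqP ix].
by have := hQ i; rewrite !inE ix iD => /(_ isT)/andP[].
Qed.

Lemma hall (Q : X -> {set E}) :
    (forall P : {set X}, #|P| <= #|\bigcup_(i in P) Q i|) ->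
  exists h : X -> E, injective h /\ forall i, h i \in Q i.
Proof.
move=> hallQ; have [//|h [injh hQ]] := @hall_in Q setT.
by exists h; split=> [i j|i]; [apply: injh|apply: hQ].
Qed.
End Hall.

Lemma card_bigcup_leq (I T : finType) (P : pred I) (F : I -> {set T}) :
  #|\bigcup_(i | P i) F i| <= \sum_(i | P i) #|F i|.
Proof.
elim/big_rec2: _ => [|i m B _ le]; first by rewrite cards0.
by rewrite (leq_trans (leq_card_setU _ _)) // leq_add2l.
Qed.

Lemma bin_leq_exp2 n m : 'C(n, m) <= 2 ^ n.
Proof.
elim: n m => [|n IH] [|m] //; first by rewrite bin0 expn_gt0.
by rewrite binS expnS mul2n -addnn leq_add.
Qed.

(** The product of [s + 1, ..., 2 * s] is at least [s ^ s]; it equals a central binomial coefficient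
    times the factorial of [s], and the coefficient is at most [4 ^ s]. *)
Lemma expnn_leq_fact s : s ^ s <= 4 ^ s * s`!.
Proof.
have ffle m : s ^ m <= (s + m) ^_ m.
  elim: m => [//|m IH]; rewrite addnS ffactSS expnS leq_mul //; lia.
apply: leq_trans (ffle s) _.
rewrite addnn -mul2n -bin_ffact leq_mul2r; apply/orP; right.
by rewrite -[4]/(2 ^ 2) -expnM bin_leq_exp2.
Qed.

(** A substitute for the usual bound of a binomial coefficient by [(e * n / s) ^ s], with 4 in place
    of Euler's number. *)
Lemma bin_mul_expnn n s : 'C(n, s) * s ^ s <= (4 * n) ^ s.
Proof.
apply: leq_trans (_ : 'C(n, s) * (4 ^ s * s`!) <= _).
  by rewrite leq_mul2l expnn_leq_fact orbT.
rewrite mulnCA bin_ffact expnMn leq_mul2l; apply/orP; right.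
elim: s n => [//|s IH] [//|n]; rewrite ffactSS expnS leq_mul2l /=.
by apply: leq_trans (IH n) _; case: s {IH} => // s; rewrite leq_exp2r.
Qed.

(** * Bipartite graphs with good expansion *)

Section Expander.
Variables (T1 T2 : finType) (A : {set T1}) (B : {set T2}) (q : nat).
Hypotheses (B0 : 0 < #|B|) (leA : #|A| <= 2 * #|B|) (leq3 : 3 * q <= 2 * #|B|).

Let dom : finType := (T1 * 'I_13)%type.
Let confined (Q : {set T1}) (T : {set T2}) : {set {ffun dom -> T2}} :=
  [set f | f \in family (fun u : dom => if u.1 \in Q then mem T else mem B)].

Let card_confined Q T :
  #|confined Q T| = #|T| ^ (13 * #|Q|) * #|B| ^ (13 * (#|T1| - #|Q|)).
Proof.
rewrite cardsE card_family foldrE big_map big_enum /=.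
rewrite (bigID (fun u : dom => u.1 \in Q)) /=; congr (_ * _).
  rewrite (eq_bigr (fun=> #|T|)) => [|u uQ]; last by rewrite uQ.
  rewrite prod_nat_const; congr (_ ^ _).
  rewrite -[13 in RHS]card_ord mulnC -cardsT -cardsX.
  by apply: eq_card => -[x i]; rewrite !inE andbT.
rewrite (eq_bigr (fun=> #|B|)) => [|u /negPf uQ]; last by rewrite uQ.
rewrite prod_nat_const; congr (_ ^ _).
have -> : #|T1| - #|Q| = #|~: Q| by rewrite [RHS]cardsCs setCK.
rewrite -[13 in RHS]card_ord mulnC -cardsT -cardsX.
by apply: eq_card => -[x i]; rewrite !inE andbT.
Qed.

(** The expected number of bad pairs of size [s] is at most [1 / 2 ^ s]. With [b = #|B|] there are
    at most [(32 * b ^ 2 / s ^ 2) ^ s] pairs, each has probability [(s / b) ^ (13 * s)], and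
    [s / b <= 2 / 3] leaves the base [32 * (2 / 3) ^ 11 < 1 / 2]. Degree 13 is the least for which
    this computation works. *)
Let confined_sum s : 0 < s -> s <= q -> s <= #|A| ->
  2 ^ s * ('C(#|A|, s) * 'C(#|B|, s) * (s ^ (13 * s) * #|B| ^ (13 * (#|T1| - s))))
    <= #|B| ^ (13 * #|T1|).
Proof.
move=> s0 sq sA.
have sT : s <= #|T1| by apply: leq_trans sA (max_card _).
have -> : 13 * #|T1| = 13 * s + 13 * (#|T1| - s) by lia.
rewrite expnD !mulnA leq_mul2r; apply/orP; right.
have -> : 13 * s = s + s + 11 * s by lia.
rewrite !(expnD _ (s + s)) !(expnD _ s s).
have := leq_mul (bin_mul_expnn #|A| s) (bin_mul_expnn #|B| s).
set x := 'C(_, _); set y := 'C(_, _) => le1.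
have -> : 2 ^ s * x * y * (s ^ s * s ^ s * s ^ (11 * s)) =
  (x * s ^ s * (y * s ^ s)) * (2 ^ s * s ^ (11 * s)) by lia.
apply: (leq_trans (leq_mul le1 (leqnn _))).
rewrite !(mulnC 11) !expnM -!expnM !(mulnC s) !expnM -!expnMn leq_exp2r //.
move: leA leq3; set b := #|B| => leAb leqb.
apply: leq_trans (_ : 8 * b * (4 * b) * (2 * s ^ 11) <= _).
  by rewrite leq_mul2r leq_mul ?orbT //; lia.
have le11 : 3 ^ 11 * s ^ 11 <= 2 ^ 11 * b ^ 11.
  by rewrite -!expnMn leq_exp2r //; apply: leq_trans leqb; rewrite leq_mul2l sq orbT.
have -> : 8 * b * (4 * b) * (2 * s ^ 11) = b * b * (64 * s ^ 11) by lia.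
rewrite leq_mul2l; apply/orP; right.
move: (s ^ 11) (b ^ 11) le11 => u v.
have -> : 3 ^ 11 = 243 * 729 by rewrite -[243]/(3 ^ 5) -[729]/(3 ^ 6) -expnD.
have -> : 2 ^ 11 = 32 * 64 by rewrite -[32]/(2 ^ 5) -[64]/(2 ^ 6) -expnD.
lia.
Qed.

(** Union bound over 13 random choices in [B] for each vertex: if [Q] expands badly, its
    neighbourhood extends to a set [T] of exactly [#|Q|] elements of [B], and all choices of [Q] are
    confined to [T]. *)
Lemma expander : exists f : {ffun dom -> T2}, (forall u, f u \in B) /\
  forall Q : {set T1}, Q \subset A -> #|Q| <= q ->
    #|Q| <= #|[set f u | u in setX Q setT]|.
Proof.
pose draws (T : finType) (U : {set T}) s := [set C : {set T} | C \subset U & #|C| == s].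
pose bad := \bigcup_(s < q) \bigcup_(QT in setX (draws _ A s.+1) (draws _ B s.+1))
  confined QT.1 QT.2.
have card_bad : #|bad| < #|B| ^ (13 * #|T1|).
  pose t s := 'C(#|A|, s) * 'C(#|B|, s) * (s ^ (13 * s) * #|B| ^ (13 * (#|T1| - s))).
  apply: leq_ltn_trans (_ : \sum_(s < q) t s.+1 < _).
    apply: leq_trans (card_bigcup_leq _ _) _; apply: leq_sum => s _.
    apply: leq_trans (card_bigcup_leq _ _) _.
    rewrite (eq_bigr (fun=> s.+1 ^ (13 * s.+1) * #|B| ^ (13 * (#|T1| - s.+1)))).
      by rewrite sum_nat_const cardsX !cards_draws.
    move=> [Q T]; rewrite !inE /= => /andP[/andP[_ /eqP cQ] /andP[_ /eqP cT]].
    by rewrite card_confined cQ cT.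
  set M := #|B| ^ _.
  have M0 : 0 < M by rewrite expn_gt0 B0.
  have: forall r, r <= q -> 2 ^ r * (\sum_(s < r) t s.+1) + M <= 2 ^ r * M.
    elim=> [_|r IH ltrq]; first by rewrite big_ord0 muln0 mul1n.
    rewrite big_ord_recr /= expnS.
    have := IH (ltnW ltrq).
    have : 2 * 2 ^ r * t r.+1 <= M.
      have [lerA|] := leqP r.+1 #|A|; first by rewrite -expnS; apply: confined_sum.
      by rewrite /t => /bin_small->; rewrite muln0.
    set S := \sum_(_ < _) _; move: (2 ^ r) (t r.+1) => p u; lia.
  move=> /(_ q (leqnn _)).
  set S := \sum_(_ < _) _ => le2; rewrite ltnNge; apply/negP => MS.
  by have := leq_mul (leqnn (2 ^ q)) MS; lia.
have [f fB fbad] : exists2 f : {ffun dom -> T2}, f \in ffun_on (mem B) & f \notin bad.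
  apply/exists_inP; apply: contraTT card_bad; rewrite negb_exists -leqNgt => /forallP sub.
  rewrite -[13 in leqLHS]card_ord mulnC -card_prod -card_ffun_on.
  apply/subset_leq_card/subsetP => f fB.
  by have := sub f; rewrite fB negbK.
have fBu u : f u \in B by move/ffun_onP: fB; apply.
exists f; split=> // Q QA leQq; rewrite leqNgt; apply: contra fbad => ltQ.
have Q0 : 0 < #|Q| by apply: leq_ltn_trans ltQ.
set I := [set f u | u in _] in ltQ.
have IB : I \subset B by apply/subsetP => _ /imsetP[u _ ->].
have [T /and3P[IT TB /eqP cT]] : exists T : {set T2},
    [&& I \subset T, T \subset B & #|T| == #|Q|].
  have : #|Q| <= #|B| by apply: leq_trans leQq _; lia.
  move: (#|Q|) ltQ => s lts lesB.
  have [T TBI cT] : exists2 T : {set T2}, T \subset B :\: I & #|T| == s - #|I|.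
    have : 0 < #|draws _ (B :\: I) (s - #|I|)|.
      by rewrite cards_draws bin_gt0 cardsDS // leq_sub2r.
    by case/card_gt0P=> T; rewrite inE => /andP[? ?]; exists T.
  exists (I :|: T); rewrite subsetUl subUset IB (subset_trans TBI (subsetDl _ _)) /=.
  rewrite cardsU (eqP cT); have -> : I :&: T = set0.
    apply/eqP; rewrite setI_eq0 disjoint_sym disjoints_subset.
    by apply: subset_trans TBI _; rewrite setDE subsetIr.
  by rewrite cards0 subn0 subnKC // ltnW.
have ltsq : #|Q|.-1 < q by rewrite prednK.
apply/bigcupP; exists (Ordinal ltsq) => //; apply/bigcupP; exists (Q, T).
  by rewrite !inE /= prednK // QA TB cT eqxx.
rewrite inE; apply/familyP => -[x i] /=; case: ifP => // xQ.
by apply: (subsetP IT); apply: imset_f; rewrite !inE xQ.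
Qed.
End Expander.

Lemma subset_of_card (T : finType) (A : {set T}) s :
  s <= #|A| -> exists2 B : {set T}, B \subset A & #|B| = s.
Proof.
move=> sA; have : 0 < #|[set B : {set T} | B \subset A & #|B| == s]|.
  by rewrite cards_draws bin_gt0.
by case/card_gt0P=> B; rewrite inE => /andP[? /eqP ?]; exists B.
Qed.

(* Montgomery's template: a union of two random bipartite graphs with good
   expansion, so that Hall's condition survives the deletion of any [l] elements
   of [Z]. *)
Lemma template (V : finType) (Y Z : {set V}) (m l : nat) :
    0 < m -> [disjoint Y & Z] -> #|Y| = 3 * m -> #|Z| = m + l -> l <= m ->
  exists Q : 'I_(4 * m) -> {set V},
    [/\ forall i, Q i \subset Y :|: Z, forall i, Q i != set0,
        \sum_i #|Q i| <= 117 * m &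
        forall Z' : {set V}, Z' \subset Z -> #|Z'| = m ->
          exists h : 'I_(4 * m) -> V, [/\ injective h, forall i, h i \in Q i &
            [set h i | i in setT] = Y :|: Z']].
Proof.
move=> m0 dYZ cY cZ lm.
have cE : #|Y :|: Z| = 4 * m + l by rewrite cardsU disjoint_setI0 // cards0 cY cZ; lia.
(* [f1] makes small sets of indices expand into [Y], from which nothing is deleted; [f2] makes small
   sets of vertices expand into the indices, which settles the large sets of indices by
   complementation. *)
have [||| f1 [f1Y f1exp]] := @expander _ V [set: 'I_(4 * m)] Y (2 * m).
- by rewrite cY; lia.
- by rewrite cardsT card_ord cY; lia.
- by rewrite cY; lia.
have [||| f2 [_ f2exp]] := @expander V _ (Y :|: Z) [set: 'I_(4 * m)] (2 * m).
- by rewrite cardsT card_ord; lia.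
- by rewrite cardsT card_ord cE; lia.
- by rewrite cardsT card_ord; lia.
pose Q1 i := [set f1 (i, j) | j in [set: 'I_13]].
pose Q2 i := [set v in Y :|: Z | [exists j : 'I_13, f2 (v, j) == i]].
have Q1f i j : f1 (i, j) \in Q1 i by apply/imsetP; exists j.
exists (fun i => Q1 i :|: Q2 i); split=> [i|i||Z' sZ' cZ'].
- rewrite subUset; apply/andP; split; last by apply/subsetP => v; rewrite inE => /andP[].
  by apply/subsetP => _ /imsetP[j _ ->]; rewrite inE f1Y.
- by apply/set0Pn; exists (f1 (i, ord0)); rewrite in_setU Q1f.
(* [f1] contributes [13 * (4 * m) = 52 * m] pairs and [f2] contributes
   [13 * (4 * m + l) <= 65 * m]. *)
- apply: leq_trans (_ : \sum_i (13 + #|Q2 i|) <= _).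
    apply: leq_sum => i _; apply: leq_trans (leq_card_setU _ _) _; rewrite leq_add2r.
    by apply: leq_trans (leq_imset_card _ _) _; rewrite cardsT card_ord.
  rewrite big_split /= sum_nat_const card_ord.
  have le2 : \sum_i #|Q2 i| <= 13 * #|Y :|: Z|.
    apply: leq_trans (_ : \sum_i \sum_(v in Y :|: Z) \sum_(j < 13) (f2 (v, j) == i) <= _).
      apply: leq_sum => i _; rewrite -sum1_card (eq_bigl _ _ (in_set _)) big_mkcondr /=.
      apply: leq_sum => v _; case: existsP => // -[j fj].
      by rewrite (bigD1 j) //= fj.
    rewrite exchange_big /= [leqRHS]mulnC -[leqRHS]sum_nat_const; apply: leq_sum => v _.
    rewrite exchange_big /= -[13 in leqRHS]card_ord -[leqRHS]sum1_card; apply: leq_sum => j _.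
    by rewrite (bigD1 (f2 (v, j))) //= eqxx big1 // => i /negPf; rewrite eq_sym => ->.
  by apply: leq_trans (leq_add (leqnn _) le2) _; rewrite cE; lia.
have dYZ' : [disjoint Y & Z'] by apply: disjointWr dYZ.
have cE' : #|Y :|: Z'| = 4 * m by rewrite cardsU disjoint_setI0 // cards0 cY cZ'; lia.
have [y0 _] : exists y, y \in Y by apply/card_gt0P; rewrite cY; lia.
pose Q' i := (Q1 i :|: Q2 i) :&: (Y :|: Z').
have [P|h [injh hQ]] := @hall _ _ y0 Q'.
  set N := \bigcup_(i in P) Q' i.
  have [leP|ltP] := leqP #|P| (2 * m).
    apply: leq_trans (f1exp P (subsetT _) leP) _; apply/subset_leq_card/subsetP => y.
    case/imsetP=> -[i j]; rewrite inE /= => /andP[iP _] ->.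
    by apply/bigcupP; exists i; rewrite // in_setI !in_setU Q1f f1Y.
  (* Vertices missed by [P] have all their [f2]-neighbours outside [P]. If Hall's condition failed,
     [4 * m - #|P| + 1] of them would expand into only [4 * m - #|P|] indices. *)
  rewrite leqNgt; apply/negP => ltN.
  have cP : #|P| <= 4 * m by rewrite (leq_trans (max_card _)) // card_ord.
  have NE : N \subset Y :|: Z' by apply/bigcupsP => i _; rewrite subsetIr.
  have [|C CE cC] := @subset_of_card _ ((Y :|: Z') :\: N) (4 * m - #|P|).+1.
    by rewrite cardsDS // cE'; lia.
  have : #|C| <= #|~: P|.
    apply: leq_trans (f2exp C _ _) _.
    - apply: subset_trans CE _; apply: subset_trans (subsetDl _ _) _.
      by rewrite setUS.
    - by rewrite cC; lia.
    apply/subset_leq_card/subsetP => i /imsetP[[v j]]; rewrite inE /= => /andP[vC _] ->.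
    rewrite inE; apply/negP => fP.
    have := subsetP CE _ vC; rewrite inE => /andP[/negP nN vE]; case: nN.
    apply/bigcupP; exists (f2 (v, j)) => //; rewrite 3!inE vE andbT; apply/orP; right.
    rewrite inE; apply/andP; split; last by apply/existsP; exists j.
    by have /subsetP/(_ v vE) := setUS Y sZ'; rewrite !inE.
  by rewrite cC [X in _ <= X]cardsCs setCK card_ord; lia.
exists h; split=> // [i|]; first by have := hQ i; rewrite inE => /andP[].
apply/eqP; rewrite eqEcard cE' card_imset // cardsT card_ord leqnn andbT.
by apply/subsetP => _ /imsetP[i _ ->]; have := hQ i; rewrite inE => /andP[].
Qed.

(** That is [(1 - 1 / y) ^ y <= 1 / 2], from Bernoulli's inequality. It measures the decay in both
    the sampling and the sparse graph construction. *)
Lemma double_pred_expnn y : 0 < y -> 2 * y.-1 ^ y <= y ^ y.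
Proof.
case: y => // x _ /=; have [->|x0] := posnP x; first by rewrite exp1n.
have bernoulli m : x ^ m * (x + m) <= x.+1 ^ m * x.
  elim: m => [|m IH]; first by rewrite addn0.
  rewrite !expnS; have := leq_mul (leqnn x.+1) IH; move: (x ^ m) (x.+1 ^ m) => u v; nia.
rewrite -(leq_pmul2r x0); apply: leq_trans (bernoulli x.+1).
by rewrite mulnAC mulnC leq_mul2l; apply/orP; right; lia.
Qed.

(** * Small samples meeting all sets of a dense family *)

Section Sampler.
Variables (V : finType) (U : {set V}) (F : {set {set V}}) (th t : nat).
Hypotheses (th0 : 0 < th) (t0 : 0 < t) (cF : #|F| < 2 ^ t).
Hypothesis dense : forall M, M \in F -> #|U| + th * (4 * th * t) <= th * #|M :&: U|.
Hypothesis roomy : 4 * th * t <= #|U|.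

(* For [#|Z| = s], a random new element of [U] multiplies this potential by at
   most [2 - 1 / th] on average. *)
Let pot s (Z : {set V}) := \sum_(M in F) 2 ^ (s - #|M :&: Z|).

Let sample s : s <= 4 * th * t -> exists Z : {set V},
  [/\ Z \subset U, #|Z| = s & th ^ s * pot s Z <= (2 * th).-1 ^ s * #|F|].
Proof.
elim: s => [_|s IH lts].
  exists set0; rewrite sub0set cards0; split=> //.
  by rewrite /pot (eq_bigr (fun=> 1)) ?sum_nat_const ?muln1 // => M _; rewrite sub0n.
have [Z [ZU cZ potZ]] := IH (ltnW lts).
set D := U :\: Z; set u := #|D|.
have cu : u = #|U| - s by rewrite /u cardsDS // cZ.
have potS r : r \in D ->
    pot s.+1 (r |: Z) = \sum_(M in F) 2 ^ (s - #|M :&: Z|) * (2 - (r \in M)).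
  rewrite inE => /andP[rZ _]; apply: eq_bigr => M _.
  have leM : #|M :&: Z| <= s by rewrite -cZ subset_leq_card // subsetIr.
  have -> : #|M :&: (r |: Z)| = (r \in M) + #|M :&: Z|.
    rewrite (cardsD1 r) !inE eqxx andbT; congr (_ + #|pred_of_set _|).
    apply/setP=> v; rewrite !inE; case: eqP => //= ->.
    by rewrite (negPf rZ) andbF.
  case: (r \in M); last by rewrite add0n subSn // expnS mulnC.
  by rewrite add1n subSS muln1.
have avg : \sum_(r in D) th * pot s.+1 (r |: Z) <= u * ((2 * th).-1 * pot s Z).
  rewrite (eq_bigr _ (fun r rD => congr1 (muln th) (potS r rD))) -big_distrr /=.
  rewrite exchange_big /= /pot !big_distrr /=; apply: leq_sum => M MF.
  rewrite -big_distrr /= mulnCA [leqRHS]mulnA [leqRHS]mulnC leq_mul2l.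
  apply/orP; right.
  have cMD : \sum_(r in D) (r \in M) = #|M :&: D|.
    rewrite -[RHS]sum1_card [RHS](eq_bigl (fun r => (r \in D) && (r \in M))).
      by rewrite [RHS]big_mkcondr; apply: eq_bigr => r _; case: (r \in M).
    by move=> r; rewrite inE andbC.
  have sumE : \sum_(r in D) (2 - (r \in M)) + #|M :&: D| = u * 2.
    rewrite -cMD -big_split -[RHS]sum_nat_const; apply: eq_bigr => r _ /=.
    by case: (r \in M).
  have leMD : #|M :&: U| <= #|M :&: D| + s.
    rewrite -cZ -(cardsID Z (M :&: U)) addnC leq_add //.
      by rewrite subset_leq_card // /D setIDA.
    by rewrite subset_leq_card // subsetIr.
  have := dense MF; have : th * #|M :&: U| <= th * (#|M :&: D| + s) by rewrite leq_mul2l leMD orbT.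
  have : th * s <= th * (4 * th * t) by rewrite leq_mul2l ltnW ?orbT.
  move: sumE; rewrite cu; set S := \sum_(_ in _) _; set x := #|M :&: D|.
  move: (4 * th * t) => w sumE; rewrite mulnDr => h1 h2 h3.
  have -> : S = u * 2 - x by rewrite cu -sumE addnK.
  rewrite cu in sumE *; rewrite mulnBr.
  have : #|U| - s <= th * x by lia.
  have := leq_mul (leqnn th) (leqnn ((#|U| - s) * 2)).
  nia.
have u0 : 0 < u by lia.
have [r rD lepot] : exists2 r, r \in D & th * pot s.+1 (r |: Z) <= (2 * th).-1 * pot s Z.
  apply/exists_inP; apply: contraTT avg; rewrite negb_exists_in => /forall_inP gt.
  rewrite -ltnNge; set x := _ * pot s Z in gt *.
  apply: leq_trans (_ : \sum_(r in D) x.+1 <= _); first by rewrite sum_nat_const -/u; nia.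
  by apply: leq_sum => r rD; rewrite ltnNge gt.
exists (r |: Z); split.
- by rewrite subUset ZU sub1set; move: rD; rewrite inE => /andP[_ ->].
- by rewrite cardsU1 cZ; move: rD; rewrite inE => /andP[-> _].
rewrite !expnS -[leqLHS]mulnA mulnCA.
apply: leq_trans (leq_mul (leqnn (th ^ s)) lepot) _.
by rewrite mulnCA -[leqRHS]mulnA leq_mul2l potZ orbT.
Qed.

(** Method of conditional expectations: the potential grows by at most [2 - 1 / th] per element,
    whereas a set met fewer than [t] times would alone contribute [2 ^ (s - t + 1)]. The slack
    [th * (4 * th * t)] in [dense] keeps the density at [1 / th] after the elements already drawn
    are removed. *)
Lemma sampler : exists Z : {set V},
  [/\ Z \subset U, #|Z| = 4 * th * t & forall M, M \in F -> t <= #|M :&: Z|].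
Proof.
have [Z [ZU cZ potZ]] := sample (leqnn _).
exists Z; split=> // M MF; rewrite leqNgt; apply/negP => ltM.
move: potZ; apply/negP; rewrite -ltnNge; set s := 4 * th * t in cZ *.
have le1 : 2 ^ (s - t).+1 <= pot s Z.
  apply: leq_trans (_ : 2 ^ (s - #|M :&: Z|) <= _); last by rewrite /pot (bigD1 M) ?leq_addr.
  rewrite leq_exp2l //; have : t <= s by rewrite /s; nia.
  lia.
(* The size [s = (2 * th) * (2 * t)] makes the potential lose a factor [2 ^ (2 * t)] against
   [2 ^ s]: one [2 ^ t] pays for [#|F|], the other contradicts the contribution of [M]. *)
have le2 : 2 ^ (2 * t) * (2 * th).-1 ^ s <= (2 * th) ^ s.
  have -> : s = (2 * th) * (2 * t) by rewrite /s; lia.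
  by rewrite !(expnM _ (2 * th)) -expnMn leq_exp2r ?double_pred_expnn; lia.
have ts : t <= s by rewrite /s; nia.
have p0 : 0 < (2 * th).-1 ^ s by rewrite expn_gt0; lia.
have e0 : 0 < 2 ^ t by rewrite expn_gt0.
apply: leq_trans (leq_mul (leqnn _) le1).
rewrite -(leq_pmul2r e0) expnS.
have -> : th ^ s * (2 * 2 ^ (s - t)) * 2 ^ t = 2 * (2 * th) ^ s.
  rewrite -mulnA -mulnA -expnD subnK // expnMn; lia.
apply: leq_trans (leq_mul (leqnn 2) le2).
have -> : 2 ^ (2 * t) = 2 ^ t * 2 ^ t by rewrite -expnD addnn mul2n.
move: (2 ^ t) (_ ^ s) e0 p0 cF => x y x0 y0 Fx.
have le3 : (y * #|F|).+1 <= y * x by rewrite ltn_pmul2l.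
apply: leq_trans (leq_mul le3 (leqnn x)) _.
have : 0 < y * x * x by rewrite !muln_gt0 x0 y0.
lia.
Qed.
End Sampler.

(** * The token game on the surpluses *)

Section Tokens.
Variables (b k : nat) (rho : rel 'I_b).
Hypotheses (k3 : 3 <= k) (rho_sym : symmetric rho).
Hypothesis rho_nbr : forall i, exists j, rho i j.

(* [r i] is the surplus of the reservoir in part [i]; a move uses one vertex of
   part [i] and [k - 1] vertices of part [j]. *)
Definition cost (i j l : 'I_b) : nat := (l == i) + (k - 1) * (l == j).

Inductive reduces (r : 'I_b -> nat) : ('I_b -> nat) -> Prop :=
| reduces_refl : reduces r r
| reduces_step i j r' : rho i j -> (forall l, cost i j l <= r l) ->
    reduces (fun l => r l - cost i j l) r' -> reduces r r'.

Lemma reduces_trans r1 r2 r3 : reduces r1 r2 -> reduces r2 r3 -> reduces r1 r3.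
Proof.
by elim=> // r i j r' rij le _ IH /IH; apply: reduces_step le.
Qed.

Let good (tau : {ffun 'I_b -> 'I_b}) :=
  [forall i, (tau (tau i) == i) && ((tau i == i) || rho i (tau i))].

(** A maximum matching of [rho], encoded as an involution whose fixed points are the unmatched
    parts. *)
Let matching : exists tau : 'I_b -> 'I_b,
  [/\ forall i, tau (tau i) = i, forall i, tau i != i -> rho i (tau i) &
      forall i j, tau i = i -> tau j = j -> i != j -> ~~ rho i j].
Proof.
have good1 : good [ffun i => i].
  by apply/forallP => i; rewrite !ffunE eqxx.
case: (arg_maxnP (fun t : {ffun 'I_b -> 'I_b} => #|[set i | t i != i]|) good1).
move=> tau /forallP gtau maxtau; have tauK i : tau (tau i) = i.
  by case/andP: (gtau i) => /eqP.
exists tau; split=> // [i ti|i j ti tj ij].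
  by case/andP: (gtau i) => _; rewrite (negPf ti).
apply/negP => rij.
pose tau' := [ffun l => if l == i then j else if l == j then i else tau l].
have tau_nij l : l != i -> l != j -> (tau l != i) && (tau l != j).
  move=> li lj; apply/andP; split.
    by apply: contra li => /eqP tl; rewrite -(tauK l) tl ti.
  by apply: contra lj => /eqP tl; rewrite -(tauK l) tl tj.
have /maxtau : good tau'.
  apply/forallP => l; rewrite !ffunE.
  have [->|li] := eqVneq l i; first by rewrite eqxx [j == i]eq_sym (negPf ij) eqxx /= rij.
  have [->|lj] := eqVneq l j; first by rewrite eqxx rho_sym rij orbT eqxx.
  by case/andP: (tau_nij l li lj) => /negPf-> /negPf->; exact: gtau.
rewrite /geq /= leqNgt => /negP; apply; apply: proper_card; apply/properP; split.
  apply/subsetP => l; rewrite !inE !ffunE => tl.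
  have [->|li] := eqVneq l i; first by rewrite eq_sym.
  by have [->|lj] := eqVneq l j.
by exists i; rewrite !inE ?ffunE ?eqxx ?ti ?eqxx // eq_sym.
Qed.

(** Unmatched parts without a loop, the leaves, are lowered first at the expense of a matched
    neighbour; then every matched pair and every loop lowers itself. If [b <= k - 1], at most
    [k - 3] leaves compete for a pair, and since [(k - 1) * e <= l] makes the surpluses nearly
    equal, the pair can afford all of them. *)
Lemma tokens l e (r : 'I_b -> nat) :
    (forall i, rho i i) \/ b <= k - 1 -> (k - 1) * e <= l ->
    (forall i, l - e <= r i <= l) ->
  exists2 r', reduces r r' & \sum_i r' i <= b * (k - 1).
Proof.
have [tau [tauK tau_rho taumax]] := matching.
pose fixd i := tau i == i; pose leaf i := fixd i && ~~ rho i i.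
have [sg rho_sg] : {sg : 'I_b -> 'I_b | forall i, rho i (sg i)}.
  exists (fun i => odflt i [pick j | rho i j]) => i; case: pickP => //= no.
  by case: (rho_nbr i) => j; rewrite no.
have sgNfix i : leaf i -> ~~ fixd (sg i).
  case/andP => /eqP fi nrii; apply/negP => /eqP fsi.
  case: (eqVneq i (sg i)) => [ei|ne]; first by case/negP: nrii; rewrite {2}ei.
  by have := taumax _ _ fi fsi ne; rewrite rho_sg.
have fixtau i : fixd (tau i) = fixd i.
  by rewrite /fixd tauK eq_sym.
(* Equivalently, the partner and the attached leaves of [i] together hold at most [r i] full batches
   of [k - 1], and removing a batch costs [i] one token. *)
pose inv1 r := forall i, ~~ fixd i ->
  r (tau i) + \sum_(j | leaf j && (sg j == i)) r j <= (k - 1) * r i + (k - 2).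
pose inv2 r := (forall i, leaf i -> r i <= k - 2) /\
  forall i, ~~ fixd i -> r (tau i) <= (k - 1) * r i + (k - 2).
have phase1 s (r1 : 'I_b -> nat) : \sum_i r1 i <= s -> inv1 r1 ->
    exists2 r', reduces r1 r' & inv2 r'.
  elim: s r1 => [|s IH] r1 les inv.
    exists r1; first exact: reduces_refl.
    have r0 i : r1 i = 0 by apply/eqP; rewrite -leqn0 (leq_trans _ les) // (bigD1 i) ?leq_addr.
    by split=> i _; rewrite r0.
  have [/existsP[i /andP[lfi gti]]|] := boolP [exists i, leaf i && (k - 1 <= r1 i)]; last first.
    rewrite negb_exists => /forallP small; exists r1; first exact: reduces_refl.
    split=> i ni; first by have := small i; rewrite ni /=; lia.
    by apply: leq_trans (inv i ni); rewrite leq_addr.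
  have nsi := sgNfix i lfi; have fi : fixd i by case/andP: lfi.
  have isi : i != sg i by apply: contra nsi => /eqP <-.
  have r1si : 0 < r1 (sg i).
    have := inv _ nsi; rewrite (bigD1 i) /= ?lfi ?eqxx // lt0n.
    by case: eqP => // ->; rewrite muln0; lia.
  have costle j : cost (sg i) i j <= r1 j.
    rewrite /cost; have [->|] := eqVneq j (sg i).
      by rewrite eq_sym (negPf isi); lia.
    by have [->|] := eqVneq j i; lia.
  pose r2 j := r1 j - cost (sg i) i j.
  have [||r' red inv'] := IH r2.
  - have lt : \sum_j r2 j < \sum_j r1 j.
      rewrite (bigD1 (sg i)) //= [ltnRHS](bigD1 (sg i)) //= -addSn leq_add //.
        by rewrite /r2 /cost eqxx eq_sym (negPf isi); lia.
      by apply: leq_sum => j _; rewrite leq_subr.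
    by rewrite -ltnS (leq_trans lt).
  - move=> j nj.
    have r2tau : r2 (tau j) <= r1 (tau j) by rewrite leq_subr.
    have ji : j != i by apply: contraNneq nj => ->.
    (* At [sg i] both sides of the invariant drop by [k - 1]. *)
    have [jsi|jsi] := eqVneq j (sg i).
      have sumD (f : 'I_b -> nat) : \sum_(l0 | leaf l0 && (sg l0 == sg i)) f l0 =
          f i + \sum_(l0 | leaf l0 && (sg l0 == sg i) && (l0 != i)) f l0.
        by rewrite (bigD1 i) // lfi eqxx.
      have := inv j nj; rewrite jsi !sumD.
      have le : \sum_(l0 | leaf l0 && (sg l0 == sg i) && (l0 != i)) r2 l0 <=
             \sum_(l0 | leaf l0 && (sg l0 == sg i) && (l0 != i)) r1 l0.
        by apply: leq_sum => l0 _; rewrite leq_subr.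
      have : r2 i = r1 i - (k - 1) by rewrite /r2 /cost eqxx (negPf isi) muln1.
      have : r2 (sg i) = r1 (sg i) - 1.
        by rewrite /r2 /cost eqxx [sg i == i]eq_sym (negPf isi) muln0.
      rewrite jsi in r2tau.
      move: (\sum_(_ | _) _) (\sum_(_ | _) _) le => x y le e1 e2.
      have -> : (k - 1) * r2 (sg i) = (k - 1) * r1 (sg i) - (k - 1).
        by rewrite e1 mulnBr muln1.
      have : k - 1 <= (k - 1) * r1 (sg i) by rewrite leq_pmulr.
      lia.
    have -> : r2 j = r1 j by rewrite /r2 /cost (negPf ji) (negPf jsi) muln0 subn0.
    apply: leq_trans (inv j nj); rewrite leq_add //.
    by apply: leq_sum => l0 _; rewrite leq_subr.
  exists r' => //; apply: reduces_step costle red.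
  by rewrite rho_sym.
have phase2 s (r1 : 'I_b -> nat) : \sum_i r1 i <= s -> inv2 r1 ->
    exists2 r', reduces r1 r' & forall i, r' i <= k - 1.
  elim: s r1 => [|s IH] r1 les [inv_leaf inv].
    exists r1; first exact: reduces_refl.
    by move=> i; rewrite (leq_trans _ (leq_trans les _)) // (bigD1 i) ?leq_addr.
  have stp i j : rho i j -> (forall l0, cost i j l0 <= r1 l0) ->
      inv2 (fun l0 => r1 l0 - cost i j l0) ->
      exists2 r', reduces r1 r' & forall i, r' i <= k - 1.
    move=> rij lec inv'; have [|r' red small] := IH _ _ inv'.
      have lt : \sum_l0 (r1 l0 - cost i j l0) < \sum_l0 r1 l0.
        rewrite (bigD1 i) //= [ltnRHS](bigD1 i) //= -addSn leq_add //.
          by have := lec i; rewrite /cost eqxx; lia.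
        by apply: leq_sum => l0 _; rewrite leq_subr.
      by rewrite -ltnS (leq_trans lt).
    by exists r' => //; apply: reduces_step red.
  (* The larger member of a pair gives [k - 1] and the smaller gives 1, which it has by the
     invariant; taking the batch from the larger one preserves the invariant at both. *)
  have [/existsP[i /and3P[ni gti lei]]|] :=
      boolP [exists i, [&& ~~ fixd i, k - 1 <= r1 i & r1 (tau i) <= r1 i]].
    have ti : i != tau i by rewrite eq_sym.
    have rt0 : 0 < r1 (tau i).
      have := inv (tau i); rewrite fixtau tauK => /(_ ni); rewrite lt0n.
      by case: eqP => // ->; rewrite muln0; lia.
    apply: (stp (tau i) i); first by rewrite rho_sym tau_rho // eq_sym.
      move=> j; rewrite /cost; have [->|] := eqVneq j (tau i).
        by rewrite eq_sym (negPf ti); lia.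
      by have [->|] := eqVneq j i; lia.
    split=> [j lfj|j nj]; first by rewrite (leq_trans (leq_subr _ _)) ?inv_leaf.
    have cost_i : cost (tau i) i i = k - 1 by rewrite /cost eqxx (negPf ti) muln1.
    have cost_t : cost (tau i) i (tau i) = 1.
      by rewrite /cost eqxx [tau i == i]eq_sym (negPf ti) muln0.
    have [->|ji] := eqVneq j i.
      rewrite cost_i cost_t mulnBr.
      have : r1 i - (k - 1) <= (k - 1) * (r1 i - (k - 1)) by rewrite leq_pmull //; lia.
      rewrite mulnBr; lia.
    have [->|jt] := eqVneq j (tau i).
      rewrite tauK cost_i cost_t mulnBr muln1.
      have := inv (tau i); rewrite fixtau tauK => /(_ ni).
      have : k - 1 <= (k - 1) * r1 (tau i) by rewrite leq_pmulr.
      lia.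
    have tji : tau j != i by apply: contra jt => /eqP <-; rewrite tauK.
    have tjt : tau j != tau i by apply: contra ji => /eqP ttji; rewrite -(tauK j) ttji tauK.
    by rewrite /cost !(negPf ji, negPf jt, negPf tji, negPf tjt) muln0 !subn0 inv.
  rewrite negb_exists => /forallP nopair.
  have [/existsP[i /andP[rii gti]]|] := boolP [exists i, [&& fixd i, rho i i & k <= r1 i]].
    case/andP: gti => rii' gti.
    apply: (stp i i) => //.
      move=> j; rewrite /cost; have [->|] := eqVneq j i; lia.
    split=> [j lfj|j nj]; first by rewrite (leq_trans (leq_subr _ _)) ?inv_leaf.
    have ji : j != i by apply: contraNneq nj => ->.
    have tji : tau j != i by apply: contraNneq nj => ttj; rewrite -fixtau ttj.
    by rewrite /cost !(negPf ji, negPf tji) muln0 !subn0 inv.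
  rewrite negb_exists => /forallP noloop.
  exists r1; first exact: reduces_refl.
  move=> i; have [fi|ni] := boolP (fixd i).
    have [rii|nrii] := boolP (rho i i).
      by have := noloop i; rewrite fi rii /=; lia.
    by apply: leq_trans (inv_leaf i _) _; [rewrite /leaf fi|lia].
  have := nopair i; have := nopair (tau i); rewrite fixtau tauK ni /=; lia.
move=> loops lel rl.
have inv0 : inv1 r.
  move=> i ni; have rle j : r j <= l by case/andP: (rl j).
  have : \sum_(j | leaf j && (sg j == i)) r j <= (k - 3) * l.
    case: loops => [loops|bk].
      by rewrite big_pred0 // => j; rewrite /leaf loops andbF.
    apply: leq_trans (_ : #|[set j | leaf j]| * l <= _).
      rewrite -sum_nat_const big_mkcond [leqRHS]big_mkcond; apply: leq_sum => j _.
      by rewrite inE; case: (leaf j); case: (sg j == i); rewrite /= ?rle.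
    rewrite leq_mul2r; apply/orP; right.
    apply: leq_trans (_ : #|~: [set i; tau i]| <= _).
      apply/subset_leq_card/subsetP => j; rewrite !inE => /andP[fj _].
      by apply/norP; split; apply: contraTneq fj => ->; rewrite ?fixtau.
    have := cardsC [set i; tau i]; rewrite cards2 eq_sym -/(fixd i) ni card_ord.
    lia.
  move/(leq_add (rle (tau i)))/leq_trans; apply.
  have /andP[rge _] := rl i.
  have := leq_mul (leqnn (k - 1)) rge; rewrite mulnBr.
  have -> : (k - 1) * l = (k - 3) * l + 2 * l by rewrite -mulnDl; congr (_ * _); lia.
  lia.
have [r1 red1 inv2r1] := phase1 _ _ (leqnn _) inv0.
have [r2 red2 small] := phase2 _ _ (leqnn _) inv2r1.
exists r2; first exact: reduces_trans red1 red2.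
rewrite -[b in leqRHS]card_ord -sum_nat_const; exact: leq_sum.
Qed.
End Tokens.

(** * Absorption *)

Section ShortPath.
Variables (V : finType) (e : rel V) (c : nat) (x y : V).
Hypothesis e_sym : symmetric e.
Hypothesis no_indep : forall s : seq V, uniq s -> c < size s ->
  (forall u, u \in s -> connect e x u) ->
  exists u v, [/\ u \in s, v \in s, u != v & e u v].

Lemma shortcut p a d : path e x p -> a < d.-1 -> d <= size p ->
    e (nth x (x :: p) a) (nth x (x :: p) d) ->
  exists p', [/\ path e x p', last x p' = last x p & size p' < size p].
Proof.
case: d => //= d ep ad dp ead.
exists (take a p ++ drop d p).
have lasta : last x (take a p) = nth x (x :: p) a.
  rewrite (last_nth x) size_takel; last by lia.
  by case: a {ad ead} => //= a; rewrite nth_take.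
have := ep; rewrite -{1}(cat_take_drop d p) cat_path (drop_nth x dp) /= => /and3P[_ _ pd].
split.
- by rewrite cat_path take_path //= lasta ead.
- by rewrite last_cat -[in RHS](cat_take_drop d p) last_cat (drop_nth x dp).
- by rewrite size_cat /= size_drop size_takel; lia.
Qed.

(** If a shortest path had more than [2 * c] edges, its [c + 1] vertices at positions
    [0, 2, ..., 2 * c] would contain an [e]-pair, and such a pair is a shortcut. *)
Lemma short_path : connect e x y ->
  exists p, [/\ path e x p, last x p = y, uniq (x :: p) & size p <= 2 * c].
Proof.
move=> /connectP[q eq lq].
pose P n := [exists t : n.-tuple V, path e x t && (last x t == y)].
have exP : exists n, P n.
  by exists (size q); apply/existsP; exists (in_tuple q); rewrite /= eq -lq eqxx.
case: (ex_minnP exP) => n /existsP[t /andP[et /eqP lt]] minn.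
have minp p : path e x p -> last x p = y -> n <= size p.
  by move=> ep lp; apply: minn; apply/existsP; exists (in_tuple p); rewrite /= ep lp eqxx.
case/shortenP: et lt => p ep up sub lp.
have sp : size p = n.
  apply/eqP; rewrite eqn_leq minp // andbT -(size_tuple t).
  by apply: uniq_leq_size sub; case/andP: up.
exists p; split=> //; rewrite leqNgt; apply/negP => ltp.
pose node i := nth x (x :: p) (2 * i).
have node_inj : {in [pred i | i <= c] &, injective node}.
  move=> i j; rewrite !inE => ic jc /eqP; rewrite nth_uniq //=; lia.
have [|||u [v [us vs uv euv]]] := no_indep (s := [seq node i | i <- iota 0 c.+1]).
- rewrite map_inj_in_uniq ?iota_uniq // => i j; rewrite !mem_iota /= => ic jc.
  by apply: node_inj; rewrite inE; lia.
- by rewrite size_map size_iota.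
- move=> u /mapP[i]; rewrite mem_iota /= => ic ->.
  have : node i \in x :: p by apply: mem_nth => /=; lia.
  by apply: (path_connect ep).
have [i [j [ij jc eij]]] : exists i j, [/\ i < j, j <= c & e (node i) (node j)].
  case/mapP: us uv euv => i; rewrite mem_iota /= => ic ->.
  case/mapP: vs => j; rewrite mem_iota /= => jc -> uv euv.
  case: (ltngtP i j) => [ij|ij|ij]; last by rewrite ij eqxx in uv.
    by exists i, j; split=> //; lia.
  by exists j, i; split; rewrite 1?e_sym //; lia.
have [||p' [ep' lp' ltp']] := shortcut ep _ _ eij; [lia|lia|].
by have := minp _ ep' (etrans lp' lp); rewrite -sp leqNgt ltp'.
Qed.
End ShortPath.

Section Parts.
Variables (V : finType) (H : rel V) (c w h : nat) (v0 : V).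
Hypothesis H_sym : symmetric H.
Hypothesis H_indep : forall I : {set V}, c < #|I| ->
  exists x y, [/\ x \in I, y \in I, x != y & H x y].
Hypothesis H_deg : forall x, h <= #|[set y | H x y]|.
Hypothesis w_small : 2 * c * w < h.

(* A split with the largest number of pieces has, within each piece, no further
   separation by few vertices, hence short [H]-paths avoiding any small set. *)
Let splits b (W : {set V}) (f : {ffun V -> 'I_b}) :=
  [&& #|W| <= b.-1 * w, [forall i, exists x, (x \notin W) && (f x == i)] &
   [forall x, forall y, [&& x \notin W, y \notin W & H x y] ==> (f x == f y)]].
Let splittable b := [exists W : {set V}, exists f : {ffun V -> 'I_b}, splits W f].

Let splittable_leq b : splittable b -> b <= c.
Proof.
move=> /existsP[W /existsP[f /and3P[_ /forallP surj /forallP closed]]].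
have [r rP] : {r : 'I_b -> V | forall i, (r i \notin W) && (f (r i) == i)}.
  exists (fun i => xchoose (existsP (surj i))) => i.
  exact: (xchooseP (existsP (surj i))).
have fr i : f (r i) = i by case/andP: (rP i) => _ /eqP.
have r_inj : injective r by exact: can_inj fr.
rewrite leqNgt; apply/negP => ltcb.
have [|x [y [/imsetP[i _ ->] /imsetP[j _ ->] ij Hij]]] := H_indep (I := [set r i | i in 'I_b]).
  by rewrite card_imset // card_ord.
have /forallP/(_ (r j)) := closed (r i).
case/andP: (rP i) => -> _; case/andP: (rP j) => -> _; rewrite Hij !fr /= => /eqP eij.
by rewrite eij eqxx in ij.
Qed.

Let splittable1 : splittable 1.
Proof.
apply/existsP; exists set0; apply/existsP; exists [ffun=> ord0].
rewrite /splits cards0 /=; apply/andP; split.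
  by apply/forallP => i; apply/existsP; exists v0; rewrite inE !ffunE (ord1 i).
by apply/forallP => x; apply/forallP => y; rewrite !ffunE eqxx implybT.
Qed.

(** By maximality of the split, each piece stays connected when up to [w] vertices are deleted, and
    a shortest path in it is short because [c + 1] vertices always contain an [H]-pair. Since the
    vertices of [W0] lie in no piece, every vertex is assigned to a piece with more than [w] of its
    neighbours; for the vertices of a piece this is the piece itself. *)
Lemma parts : exists (b : nat) (pt : V -> 'I_b),
  [/\ b <= c, forall j, w < #|[set v | pt v == j]|,
      forall j, h <= #|[set v | pt v == j]| + c * w &
      forall x y (W : {set V}), pt x = pt y -> x != y -> #|W| + 2 <= w ->
      exists p, [/\ path H x (rcons p y), uniq (x :: rcons p y),
                    forall u, u \in p -> u \notin W & size p <= 2 * c + 1]].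
Proof.
have exS : exists b, splittable b by exists 1.
case: (ex_maxnP exS splittable_leq) => b sb maxb.
have b1 : 0 < b by apply: maxb.
have bc := splittable_leq sb.
case/existsP: sb => W0 /existsP[f /and3P[cW0 /forallP surj /forallP closed]].
have fH x y : x \notin W0 -> y \notin W0 -> H x y -> f x = f y.
  move=> xW yW Hxy; have /forallP/(_ y) := closed x.
  by rewrite xW yW Hxy => /eqP.
pose C j := [set x | (x \notin W0) && (f x == j)].
pose N x := [set y | H x y].
have degN x : (c + 1) * w < #|N x :\: W0|.
  have : #|N x| <= #|N x :\: W0| + #|W0|.
    by rewrite -(cardsID W0 (N x)) addnC leq_add2l subset_leq_card // subsetIr.
  have : h <= #|N x| by exact: H_deg.
  have : b.-1 * w <= c.-1 * w by rewrite leq_mul2r; apply/orP; right; lia.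
  have c1 : 0 < c by lia.
  have : c.-1 * w + w = c * w by rewrite -mulSnr prednK.
  have : (c + 1) * w = c * w + w by rewrite mulnDl mul1n.
  have : 2 * c * w = c * w + c * w by rewrite -mulnA mul2n addnn.
  move: (2 * c * w) w_small ((c + 1) * w) (c * w) (c.-1 * w) (b.-1 * w) cW0.
  by move=> ? ? ? ? ? ?; lia.
have bigCh j : h <= #|C j| + c * w /\ w < #|C j|.
  have /existsP[x /andP[xW /eqP fx]] := surj j.
  have : #|N x :\: W0| <= #|C j|.
    apply/subset_leq_card/subsetP => y; rewrite !inE => /andP[yW Hxy].
    by rewrite yW -fx eq_sym (fH x y) ?eqxx.
  have lew : w <= (c + 1) * w by rewrite leq_pmull ?addn1.
  have := H_deg x; rewrite -/(N x) -(cardsID W0 (N x)) addnC => leh leC; split.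
    apply: (leq_trans leh); rewrite leq_add //; apply: leq_trans (_ : #|W0| <= _).
      by rewrite subset_leq_card // subsetIr.
    by apply: leq_trans cW0 _; rewrite leq_mul2r (leq_trans (leq_pred _) bc) orbT.
  by apply: leq_trans leC; apply: leq_ltn_trans (degN x).
have bigC j : w < #|C j| by case: (bigCh j).
have [pt ptP] : {pt : V -> 'I_b | forall x, w < #|N x :&: C (pt x)|}.
  have ex x : exists j, w < #|N x :&: C j|.
    apply/existsP; apply: contraT; rewrite negb_exists => /forallP small.
    have : #|N x :\: W0| <= b * w.
      rewrite -[b]card_ord -sum_nat_const.
      apply: (@leq_trans (\sum_(j < b) #|N x :&: C j|)); last first.
        by apply: leq_sum => j _; rewrite leqNgt small.
      apply: leq_trans (card_bigcup_leq _ _); apply/subset_leq_card/subsetP => y.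
      rewrite !inE => /andP[yW Hxy]; apply/bigcupP; exists (f y) => //.
      by rewrite !inE Hxy yW eqxx.
    have := degN x; have : b * w <= c * w by rewrite leq_mul2r bc orbT.
    lia.
  by exists (fun x => xchoose (ex x)) => x; exact: (xchooseP (ex x)).
have connected (W : {set V}) x y : #|W| <= w -> x \notin W0 :|: W -> y \notin W0 :|: W ->
    f x = f y ->
    connect (fun u v => [&& H u v, u \notin W0 :|: W & v \notin W0 :|: W]) x y.
  move=> cW xW yW fxy; set e := fun _ _ => _.
  apply: contraT => nxy.
  have e_sym : symmetric e by move=> u v; rewrite /e H_sym; congr (_ && _); rewrite andbC.
  have e_csym : connect_sym e by apply: sym_connect_sym.
  have cf u : connect e x u -> f x = f u.
    case/connectP=> p ep ->; elim: p x ep {xW fxy nxy} => //= z p IH x0.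
    rewrite /e !in_setU !negb_or => /andP[/and3P[Hxz /andP[xW0 _] /andP[zW0 _]] ep].
    by rewrite (fH _ _ xW0 zW0 Hxz); apply: IH.
  (* Otherwise the component of [x] becomes an additional piece at the price of at most [w] more
     deleted vertices; the other pieces survive because they have more than [w] vertices, and the
     piece of [x] because [y] remains. *)
  suff /maxb : splittable b.+1 by rewrite ltnn.
  apply/existsP; exists (W0 :|: W); apply/existsP.
  exists [ffun z => if connect e x z then ord_max else widen_ord (leqnSn b) (f z)].
  apply/and3P; split.
  - rewrite /= (leq_trans (leq_card_setU _ _)) //.
    by rewrite -(prednK b1) mulSnr leq_add.
  - apply/forallP => i; apply/existsP; case: (unliftP ord_max i) => [j ->|->]; last first.
      by exists x; rewrite xW !ffunE connect0 eqxx.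
    have lj : lift ord_max j = widen_ord (leqnSn b) j.
      by apply: val_inj; rewrite /= /bump leqNgt ltn_ord.
    have [fxj|fxj] := eqVneq (f x) j.
      by exists y; rewrite yW !ffunE (negPf nxy) -fxy fxj lj eqxx.
    have : 0 < #|C j :\: W|.
      have := cardsID W (C j); have := bigC j.
      have : #|C j :&: W| <= #|W| by rewrite subset_leq_card // subsetIr.
      lia.
    case/card_gt0P=> z; rewrite !inE => /and3P[zW zW0 /eqP fz].
    exists z; rewrite !inE negb_or zW zW0 !ffunE.
    case: ifP => [/cf|_]; first by rewrite fz => e'; rewrite e' eqxx in fxj.
    by rewrite fz lj eqxx.
  apply/forallP => u; apply/forallP => v; apply/implyP => /and3P[uW vW Huv].
  have euv : connect e u v by apply: connect1; rewrite /e Huv uW.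
  rewrite !ffunE (same_connect_r e_csym euv).
  move: uW vW; rewrite !inE !negb_or => /andP[uW _] /andP[vW _].
  by rewrite (fH u v).
have CV j : #|C j| <= #|[set v | pt v == j]|.
  apply/subset_leq_card/subsetP => v.
  rewrite !inE => /andP[vW /eqP fv]; apply: contraT => ptv.
  have : 0 < #|N v :&: C (pt v)| by apply: leq_trans (ptP v).
  case/card_gt0P=> u; rewrite !inE => /and3P[Hvu uW /eqP fu].
  by rewrite -fu -(fH v u) // fv eqxx in ptv.
exists b, pt; split=> // [j|j|x y W ptxy xy cW].
- exact: leq_trans (bigC j) (CV j).
- by case: (bigCh j) => le _; apply: leq_trans le _; rewrite leq_add2r CV.
pose W' := x |: (y |: W).
have cW' : #|W'| <= w.
  rewrite /W' !cardsU1; move: cW; case: (x \notin _); case: (y \notin _) => /=; lia.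
have pick z : pt z = pt x -> exists2 z', H z z' & (z' \notin W0 :|: W') && (f z' == pt x).
  move=> ptz; have : 0 < #|(N z :&: C (pt z)) :\: W'|.
    have := cardsID W' (N z :&: C (pt z)); have := ptP z.
    have : #|N z :&: C (pt z) :&: W'| <= #|W'| by rewrite subset_leq_card // subsetIr.
    lia.
  case/card_gt0P=> z'; rewrite !inE => /and4P[zW Hz zW0 fz]; exists z' => //.
  by rewrite -ptz !inE negb_or zW0 zW fz.
have [x' Hx /andP[xW /eqP fx]] := pick x erefl.
have [y' Hy /andP[yW /eqP fy]] := pick y (esym ptxy).
have := connected _ _ _ cW' xW yW (etrans fx (esym fy)).
set e := fun _ _ => _ => con.
have e_sym : symmetric e by move=> u v; rewrite /e H_sym; congr (_ && _); rewrite andbC.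
have conW u : connect e x' u -> u \notin W0 :|: W'.
  case/connectP=> p; elim/last_ind: p => [_ ->//|p z _].
  by rewrite rcons_path last_rcons => /andP[_ /and3P[_ _ zW]] ->.
have [s us cs sW|p [ep lp up sp]] := short_path e_sym (c := c) _ con.
  have [|u [v [us' vs uv Huv]]] := H_indep (I := [set u in s]).
    by rewrite cardsE (card_uniqP us).
  rewrite !inE in us' vs; exists u, v; split=> //.
  by rewrite /e Huv !conW ?sW.
have pW u : u \in x' :: p -> u \notin W'.
  by move=> /(path_connect ep)/conW; rewrite in_setU negb_or => /andP[].
exists (x' :: p); split.
- rewrite rcons_cons /= Hx rcons_path lp H_sym Hy andbT.
  by apply: sub_path ep => u v /and3P[].
- have xq : x \notin x' :: p by apply/negP => /pW; rewrite /W' !inE eqxx.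
  have yq : y \notin x' :: p by apply/negP => /pW; rewrite /W' !inE eqxx orbT.
  by rewrite cons_uniq mem_rcons rcons_uniq in_cons negb_or xy xq yq up.
- by move=> u /pW; rewrite !inE !negb_or => /and3P[].
- by rewrite /= addn1 ltnS.
Qed.
End Parts.

(** * Tileable sets and absorbing gadgets *)

Section Tileable.
Variables (V : finType) (tile : {set V} -> Prop).

Inductive tileable : {set V} -> Prop :=
| tileable0 : tileable set0
| tileableS (A B : {set V}) : tile B -> [disjoint B & A] -> tileable A -> tileable (B :|: A).

Lemma tileable1 A : tile A -> tileable A.
Proof.
move=> tA; rewrite -[A]setU0; apply: tileableS => //; last exact: tileable0.
by rewrite disjoint_sym disjoints_subset sub0set.
Qed.

Lemma disjointUl (A B C : {set V}) :
  [disjoint A :|: B & C] = [disjoint A & C] && [disjoint B & C].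
Proof. by rewrite !disjoints_subset subUset. Qed.

Lemma disjointUr (A B C : {set V}) :
  [disjoint C & A :|: B] = [disjoint C & A] && [disjoint C & B].
Proof. by rewrite disjoint_sym disjointUl !(disjoint_sym C). Qed.

Lemma tileableU (A B : {set V}) : [disjoint A & B] -> tileable A -> tileable B -> tileable (A :|: B).
Proof.
move=> dAB tA tB; elim: tA dAB => [|A' B' tB' dB'A' _ IH]; first by rewrite set0U.
rewrite disjointUl => /andP[dB'B dA'B]; rewrite -setUA; apply: tileableS => //.
  by rewrite disjointUr dB'A'.
exact: IH.
Qed.

Definition absorbs (S : {set V}) (Q : seq V) :=
  forall x, x \in Q -> x \notin S /\ tileable (x |: S).

Lemma absorbs_sub S Q Q' : {subset Q' <= Q} -> absorbs S Q -> absorbs S Q'.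
Proof. by move=> sub ab x /sub/ab. Qed.

Lemma absorbs_glue (S1 S2 : {set V}) z Q1 Q2 :
    absorbs S1 (z :: Q1) -> absorbs S2 (z :: Q2) -> [disjoint S1 & S2] ->
    (forall x, x \in Q1 -> x \notin S2) -> (forall x, x \in Q2 -> x \notin S1) ->
    z \notin Q1 -> z \notin Q2 ->
  absorbs (z |: (S1 :|: S2)) (Q1 ++ Q2).
Proof.
move=> ab1 ab2 d12 Q1S2 Q2S1 zQ1 zQ2 x; rewrite mem_cat.
have [z1 tz1] := ab1 z (mem_head _ _); have [z2 tz2] := ab2 z (mem_head _ _).
case/orP=> xQ.
  have [|x1 tx1] := ab1 x; first by rewrite inE xQ orbT.
  have xz : x != z by apply: contraNneq zQ1 => <-.
  split; first by rewrite !inE !negb_or xz x1 Q1S2.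
  have -> : x |: (z |: (S1 :|: S2)) = (x |: S1) :|: (z |: S2).
    by apply/setP=> y; rewrite !inE; do !case: (_ == _); rewrite ?orbT.
  apply: tileableU => //; rewrite disjointUl !disjointUr d12 !disjoints1 !inE.
  by rewrite (disjoint_sym S1) disjoints1 xz z1 Q1S2.
have [|x2 tx2] := ab2 x; first by rewrite inE xQ orbT.
have xz : x != z by apply: contraNneq zQ2 => <-.
split; first by rewrite !inE !negb_or xz x2 Q2S1.
have -> : x |: (z |: (S1 :|: S2)) = (z |: S1) :|: (x |: S2).
  apply/setP=> y; rewrite !inE; do !case: (_ == _); rewrite ?orbT //=.
apply: tileableU => //; rewrite disjointUl !disjointUr d12 !disjoints1 !inE.
by rewrite (disjoint_sym S1) disjoints1 eq_sym xz z2 Q2S1.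
Qed.

Definition gadget (W : {set V}) (Q : seq V) (s : nat) :=
  exists S : {set V}, [/\ #|S| <= s, [disjoint S & W] & absorbs S Q].

(** Gadgets are rebuilt after [W] is known, except for the vertices of [X], such as the switches of
    earlier gluings, which are committed in advance and which [W] must therefore spare. *)
Definition robust (X : {set V}) (w : nat) (Q : seq V) (s : nat) :=
  forall W : {set V}, #|W| <= w -> [disjoint X & W] -> gadget W Q s.

Lemma robust_sub X w Q Q' s : {subset Q' <= Q} -> robust X w Q s -> robust X w Q' s.
Proof.
move=> sub rob W cW dX; have [S [cS dS ab]] := rob W cW dX.
by exists S; split=> //; apply: absorbs_sub ab.
Qed.

Lemma robust_leq X w Q s w' s' : w' <= w -> s <= s' -> robust X w Q s -> robust X w' Q s'.
Proof.
move=> lew les rob W cW dX; have [S [cS dS ab]] := rob W (leq_trans cW lew) dX.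
by exists S; split=> //; apply: leq_trans les.
Qed.

Lemma card_set_seq (Q : seq V) : #|[set u in Q]| <= size Q.
Proof. by rewrite cardsE card_size. Qed.

Lemma card_setU3 (A B C : {set V}) : #|A :|: (B :|: C)| <= #|A| + (#|B| + #|C|).
Proof. by rewrite (leq_trans (leq_card_setU _ _)) // leq_add2l leq_card_setU. Qed.

Lemma card_glue z (A B : {set V}) s1 s2 :
  #|A| <= s1 -> #|B| <= s2 -> #|z |: (A :|: B)| <= s1 + s2 + 1.
Proof.
move=> A1 B2; rewrite cardsU1 addnC leq_add ?leq_b1 //.
by rewrite (leq_trans (leq_card_setU _ _)) // leq_add.
Qed.

(** The first gadget stays off [Q2] and [X2], the second off [Q1] and the first gadget; the drop
    from [w] to [w'] pays for this. *)
Lemma robust_glue (X1 X2 : {set V}) w w' s1 s2 z Q1 Q2 :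
    robust X1 w (z :: Q1) s1 -> robust X2 w (z :: Q2) s2 -> z \notin Q1 -> z \notin Q2 ->
    [disjoint X1 & X2] -> (forall x, x \in Q1 -> x \notin X2) ->
    (forall x, x \in Q2 -> x \notin X1) ->
    w' + (size Q1 + size Q2 + s1 + #|X2|) <= w ->
  robust (z |: (X1 :|: X2)) w' (Q1 ++ Q2) (s1 + s2 + 1).
Proof.
move=> rob1 rob2 zQ1 zQ2 dX Q1X Q2X lew W cW.
rewrite !disjointUl => /and3P[zW dX1 dX2].
have [||S1 [cS1 dS1 ab1]] := rob1 (W :|: ([set u in Q2] :|: X2)).
- apply: leq_trans (card_setU3 _ _ _) (leq_trans _ lew).
  by apply: leq_add => //; have := card_set_seq Q2; lia.
- rewrite !disjointUr dX1 dX andbT /= disjoint_sym disjoints_subset.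
  by apply/subsetP=> u; rewrite !inE => /Q2X.
move: dS1; rewrite !disjointUr => /and3P[dS1W dS1Q dS1X].
have [||S2 [cS2 dS2 ab2]] := rob2 (W :|: ([set u in Q1] :|: S1)).
- apply: leq_trans (card_setU3 _ _ _) (leq_trans _ lew).
  by apply: leq_add => //; have := card_set_seq Q1; lia.
- rewrite !disjointUr dX2 disjoint_sym (disjoint_sym X2) dS1X andbT /= disjoints_subset.
  by apply/subsetP=> u; rewrite !inE => /Q1X.
move: dS2; rewrite !disjointUr => /and3P[dS2W dS2Q dS2S1].
exists (z |: (S1 :|: S2)); split.
- exact: card_glue.
- by rewrite !disjointUl zW dS1W dS2W.
apply: absorbs_glue => //; first by rewrite disjoint_sym.
  move=> x xQ; apply: contraTN dS2Q => xS; apply/pred0Pn; exists x => /=.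
  by rewrite xS inE.
move=> x xQ; apply: contraTN dS1Q => xS; apply/pred0Pn; exists x => /=.
by rewrite xS inE.
Qed.
End Tileable.

Section Gadgets.
Variables (V : finType) (adj : rel V) (tile : {set V} -> Prop) (k a : nat).
Hypotheses (adj_sym : symmetric adj) (adj_irr : irreflexive adj).
Definition nbhd (x : V) : {set V} := [set y | adj x y].
Hypothesis pieces : forall U : {set V}, a < #|U| -> exists S : {set V},
  [/\ S \subset U, #|S| = k.-1 & forall x, S \subset nbhd x -> tile (x |: S)].

(** A single piece inside the common neighbourhood of [Q] is completed to a tile by each vertex of
    [Q]. *)
Lemma robust_hub w (Q : seq V) :
  w + a < #|[set u | all (adj^~ u) Q]| -> robust tile set0 w Q k.-1.
Proof.
move=> big W cW _; set U := [set u | _] in big.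
have [|S [SU cS tS]] := pieces (U := U :\: W).
  have := cardsID W U; have : #|U :&: W| <= #|W| by rewrite subset_leq_card // subsetIr.
  lia.
exists S; split; first by rewrite cS.
  by rewrite disjoints_subset (subset_trans SU) // setDE subsetIr.
have SN x : x \in Q -> S \subset nbhd x.
  move=> xQ; apply/subsetP => u uS; have := subsetP SU _ uS.
  by rewrite !inE => /andP[_ /allP]; apply.
move=> x xQ; split; last by apply/tileable1/tS/SN.
by apply/negP => /(subsetP (SN x xQ)); rewrite inE adj_irr.
Qed.

Section Paths.
Variables (H : rel V) (w0 L : nat).
Hypothesis H_hub : forall x y, H x y -> w0 + a < #|nbhd x :&: nbhd y|.

Lemma robust_edge x y : H x y -> robust tile set0 w0 [:: x; y] k.-1.
Proof.
move=> Hxy; apply: robust_hub; apply: leq_trans (H_hub Hxy) _.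
by apply/subset_leq_card/subsetP => u; rewrite !inE /= andbT.
Qed.

(** Each edge of the path contributes a piece of [k - 1] vertices, and these are glued with the
    inner vertices of the path as switches. *)
Lemma robust_path p x y w : 0 < k -> path H x (rcons p y) -> uniq (x :: rcons p y) ->
    size p <= L -> w + (k + 2 + L) * size p <= w0 ->
  robust tile [set u in p] w [:: x; y] (k * (size p + 1)).
Proof.
move=> k0; elim: p x w => [|z p IH] x w.
  rewrite /= andbT muln0 addn0 add0n muln1 => Hxy _ _ lew.
  have -> : [set u in [::]] = set0 :> {set V} by apply/setP=> u; rewrite !inE.
  by apply: robust_leq (robust_edge Hxy) => //; lia.
rewrite rcons_cons => pzH /andP[xp up] ltL lew.
have /andP[Hxz pz] : H x z && path H z (rcons p y) by [].
rewrite (_ : [set u in z :: p] = z |: (set0 :|: [set u in p])); last first.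
  by apply/setP=> u; rewrite !inE.
have zyp : z \notin p /\ z != y.
  by move: up => /= /andP[]; rewrite mem_rcons inE negb_or => /andP[].
move: xp; rewrite inE mem_rcons inE !negb_or => /and3P[xz xy xp].
have ypn : y \notin p.
  by move: (up : uniq (z :: rcons p y)); rewrite cons_uniq rcons_uniq => /and3P[].
have -> : k * (size (z :: p) + 1) = k.-1 + k * (size p + 1) + 1.
  by rewrite /= !addn1 mulnS -{1}(prednK k0) addSn.
rewrite -[[:: x; y]]/([:: x] ++ [:: y]).
apply: (@robust_glue _ _ _ _ (w + (k + 2 + L))).
- apply: (@robust_sub _ _ _ _ [:: x; z]).
    by move=> u; rewrite !inE orbC.
  by apply: robust_leq (robust_edge Hxz) => //; move: lew; rewrite /= mulnS; clear; lia.
- by apply: IH => //; [exact: ltnW|move: lew; rewrite /= mulnS; clear; lia].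
- by rewrite inE eq_sym.
- by rewrite inE; case: zyp.
- by rewrite disjoints_subset sub0set.
- by move=> u; rewrite !inE => /eqP->.
- by move=> u; rewrite !inE.
- by have := card_set_seq p; move: ltL => /=; clear; lia.
Qed.
End Paths.

Section Hubs.
Variables (c d : nat).
Hypotheses (V0 : 0 < #|V|) (deg : forall x, d <= #|nbhd x|) (deg_c : #|V| <= (c + 1) * d).

(** The degrees of [3 * (c + 1)] vertices sum to at least [3 * #|V|], so at least a proportion
    [1 / (3 * (c + 1))] of all vertices see three of them; averaging over at most
    [(3 * (c + 1)) ^ 3] triples costs the remaining factor. *)
Lemma hub_triple (A : {set V}) : 3 * (c + 1) <= #|A| ->
  exists h1 h2 h3, [/\ [/\ h1 \in A, h2 \in A & h3 \in A],
    [/\ h1 != h2, h2 != h3 & h3 != h1] &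
    #|V| <= (3 * (c + 1)) ^ 4 * #|[set u | all (adj^~ u) [:: h1; h2; h3]]|].
Proof.
move=> /subset_of_card[B BA]; set b := 3 * (c + 1) => cB.
have b0 : 0 < b by rewrite /b addn1.
pose com (h : V * V * V) := [set u | all (adj^~ u) [:: h.1.1; h.1.2; h.2]].
pose P := [set h : V * V * V | [&& h.1.1 \in B, h.1.2 \in B & h.2 \in B] &&
  [&& h.1.1 != h.1.2, h.1.2 != h.2 & h.2 != h.1.1]].
suff [h hP comh] : exists2 h, h \in P & #|V| <= b ^ 4 * #|com h|.
  move: hP; rewrite inE => /andP[/and3P[h1 h2 h3] /and3P[h12 h23 h31]].
  exists h.1.1, h.1.2, h.2; split=> //.
    by split; apply: (subsetP BA).
apply/exists_inP; apply: contraT; rewrite negb_exists_in => /forall_inP small.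
have sumdeg : b * d <= \sum_u #|nbhd u :&: B|.
  rewrite -cB -sum_nat_const; apply: leq_trans (_ : \sum_(h in B) #|nbhd h| <= _).
    exact: leq_sum.
  rewrite (eq_bigr (fun h => \sum_u (adj h u))) => [|h _]; last first.
    by rewrite -sum1_card big_mkcond; apply: eq_bigr => u _; rewrite inE; case: (adj h u).
  rewrite exchange_big; apply: leq_sum => u _ /=.
  rewrite -[leqRHS]sum1_card [leqRHS](eq_bigl (fun h => (h \in B) && adj h u)).
    by rewrite big_mkcondr; apply: leq_sum => h _; case: (adj h u).
  by move=> h; rewrite !inE andbC adj_sym.
pose T := [set u | 2 < #|nbhd u :&: B|].
have sumT : \sum_u #|nbhd u :&: B| <= 2 * #|V| + b * #|T|.
  rewrite mulnC -sum_nat_const (mulnC b) -[#|T| * b]sum_nat_const.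
  rewrite [X in _ <= _ + X]big_mkcond -big_split /=; apply: leq_sum => u _; rewrite inE.
  have : #|nbhd u :&: B| <= b by rewrite -cB subset_leq_card // subsetIr.
  by case: ltnP; lia.
have TP : #|T| <= \sum_(h in P) #|com h|.
  apply: leq_trans (card_bigcup_leq _ _); apply/subset_leq_card/subsetP => u.
  rewrite inE => /card_gt2P[h1 [h2 [h3 [[]]]]]; rewrite !inE.
  move=> /andP[u1 h1B] /andP[u2 h2B] /andP[u3 h3B] [h12 h23 h31].
  apply/bigcupP; exists (h1, h2, h3); rewrite inE /= ?h1B ?h2B ?h3B ?h12 ?h23 ?h31 //.
  by rewrite !(adj_sym _ u) u1 u2 u3.
have cP : #|P| <= b ^ 3.
  apply: leq_trans (_ : #|setX (setX B B) B| <= _).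
    by apply/subset_leq_card/subsetP => -[[h1 h2] h3]; rewrite !inE /= => /andP[/and3P[-> -> ->]].
  by rewrite !cardsX cB !expnS expn0 muln1 mulnA.
have smallP : \sum_(h in P) b ^ 4 * #|com h| <= b ^ 3 * #|V|.-1.
  apply: leq_trans (_ : \sum_(h in P) #|V|.-1 <= _); last first.
    by rewrite sum_nat_const leq_mul2r cP orbT.
  by apply: leq_sum => h /small; rewrite -ltnNge => lt; rewrite -ltnS prednK.
rewrite -big_distrr /= in smallP.
have le1 : #|V| <= b * #|T| by have := leq_mul (leqnn 3) deg_c; rewrite mulnA -/b; lia.
have : b ^ 3 * #|V| <= b ^ 3 * #|V|.-1.
  apply: leq_trans smallP; apply: leq_trans (_ : b ^ 4 * #|T| <= _).
    by rewrite (expnSr b 3) -mulnA leq_mul2l le1 orbT.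
  by rewrite leq_mul2l TP orbT.
by rewrite leq_pmul2l ?expn_gt0 ?b0 //; lia.
Qed.

Section Chain.
Variables (I : eqType) (pt : V -> I) (wL w3 sL : nat).
Hypothesis link : forall x y, pt x = pt y -> x != y -> robust tile set0 wL [:: x; y] sL.
Hypothesis pt_big : forall x, wL < #|[set v | pt v == pt x]|.
Hypothesis w3_small : w3 + 3 * (sL + c + 6) <= wL.
Hypothesis hub_big : (3 * (c + 1)) ^ 4 * (wL + a) < #|V|.

(** Three hubs share one piece, and each [x] is tied to its own hub by a link. Gadgets with two ends
    can only be prolonged; the third end makes branching possible, and with it lists of any
    length. *)
Lemma robust_three x1 x2 x3 : pt x2 = pt x1 -> pt x3 = pt x1 ->
  robust tile set0 w3 [:: x1; x2; x3] (3 * sL + k.-1 + 3).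
Proof.
move=> pt2 pt3 W cW _.
have [|h1 [h2 [h3 [[h1A h2A h3A] [h12 h23 h31] big]]]] :=
    hub_triple (A := [set v | pt v == pt x1] :\: (W :|: [set x in [:: x1; x2; x3]])).
  set X := [set x in _]; set A := [set v | _].
  have := cardsID (W :|: X) A; have := pt_big x1; rewrite -/A.
  have : #|A :&: (W :|: X)| <= #|W :|: X| by rewrite subset_leq_card // subsetIr.
  have := (leq_card_setU W X).1; have : #|X| <= 3 by apply: card_set_seq.
  lia.
have hubR : robust tile set0 wL [:: h1; h2; h3] k.-1.
  apply: robust_hub; rewrite ltnNge; apply/negP => le.
  have := leq_trans big (leq_mul (leqnn _) le); lia.
have hP h : h \in [set v | pt v == pt x1] :\: (W :|: [set x in [:: x1; x2; x3]]) ->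
    [/\ pt h = pt x1, h \notin W & [/\ h != x1, h != x2 & h != x3]].
  by rewrite !inE !negb_or => /andP[/and4P[hW ? ? ?] /eqP].
have [ph1 h1W [h11 h1x2 h1x3]] := hP _ h1A.
have [ph2 h2W [h2x1 h22 h2x3]] := hP _ h2A.
have [ph3 h3W [h3x1 h3x2 h33]] := hP _ h3A.
have d0 (X : {set V}) : [disjoint set0 & X] by rewrite disjoints_subset sub0set.
have lk h x : pt h = pt x -> h != x -> robust tile set0 wL ([:: h] ++ [:: x]) sL.
  exact: link.
have R1 : robust tile (h1 |: (set0 :|: set0)) (w3 + 2 * (sL + 5))
    ([:: x1] ++ [:: h2; h3]) (sL + k.-1 + 1).
  apply: (robust_glue (lk _ _ ph1 h11) hubR) => //.
  - by rewrite inE.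
  - by rewrite !inE negb_or h12 [h1 == h3]eq_sym.
  - by move=> x _; rewrite inE.
  - by move=> x _; rewrite inE.
  - by rewrite cards0 /=; move: w3_small; clear; lia.
have R2 : robust tile (h2 |: (set0 :|: (h1 |: (set0 :|: set0)))) (w3 + (sL + 5))
    ([:: x2] ++ [:: x1; h3]) (sL + (sL + k.-1 + 1) + 1).
  apply: (@robust_glue _ _ _ _ (w3 + 2 * (sL + 5))).
  - apply: (robust_leq (w := wL) (s := sL)) => //; first by move: w3_small; clear; lia.
    by apply: lk; rewrite ?ph2.
  - by apply: robust_sub R1 => x; rewrite !inE => /or3P[]->; rewrite ?orbT.
  - by rewrite inE.
  - by rewrite !inE negb_or h2x1.
  - exact: d0.
  - by move=> x; rewrite !inE !orbF => /eqP->; rewrite eq_sym.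
  - by move=> x _; rewrite inE.
  - by rewrite !setU0 cards1 /=; move: w3_small; clear; lia.
have R3 : robust tile (h3 |: (set0 :|: (h2 |: (set0 :|: (h1 |: (set0 :|: set0)))))) w3
    ([:: x3] ++ [:: x2; x1]) (sL + (sL + (sL + k.-1 + 1) + 1) + 1).
  apply: (@robust_glue _ _ _ _ (w3 + (sL + 5))).
  - apply: (robust_leq (w := wL) (s := sL)) => //; first by move: w3_small; clear; lia.
    by apply: lk; rewrite ?ph3.
  - by apply: robust_sub R2 => x; rewrite !inE => /or3P[]->; rewrite ?orbT.
  - by rewrite inE.
  - by rewrite !inE negb_or h3x1 h3x2.
  - exact: d0.
  - move=> x; rewrite !set0U !setU0 !inE => /eqP->.
    by rewrite negb_or ![x3 == _]eq_sym h2x3.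
  - by move=> x _; rewrite inE.
  - by rewrite !set0U setU0 cards2 [h2 == h1]eq_sym h12 /=; move: w3_small; clear; lia.
have [S [cS dS ab]] : gadget tile W ([:: x3] ++ [:: x2; x1]) (sL + (sL + (sL + k.-1 + 1) + 1) + 1).
  by apply: R3 => //; rewrite !set0U setU0 !disjointUl !disjoints1 h1W h2W h3W.
exists S; split=> //; first by apply: leq_trans cS _; clear; lia.
by apply: absorbs_sub ab => x; rewrite !inE orbCA orbC -orbA; case/or3P => ->; rewrite ?orbT.
Qed.

(** A gadget for [z], [x], [y] glued at a fresh switch [z] to a gadget for [z :: Q'] reduces the
    list by one vertex. *)
Lemma gadget_chain (Q : seq V) (W : {set V}) j : Q != [::] -> (forall x, x \in Q -> pt x = j) ->
    #|W :|: [set x in Q]| + (3 * sL + k + 4) * size Q <= w3 ->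
  gadget tile W Q ((3 * sL + k + 4) * size Q).
Proof.
have three x y z (U : {set V}) : pt x = j -> pt y = j -> pt z = j -> #|U| <= w3 ->
    gadget tile U [:: x; y; z] (3 * sL + k.-1 + 3).
  by move=> px py pz cU; apply: robust_three; rewrite ?px ?py ?pz // disjoints_subset sub0set.
move: {2}(size Q) (leqnn (size Q)) => n; elim: n Q W => [|n IH] [//|x Q] W //.
move=> szQ _ ptQ leW.
case: Q szQ ptQ leW => [|y [|y' Q]] szQ ptQ leW.
- have px := ptQ x (mem_head _ _).
  have cW : #|W| <= w3.
    by apply: leq_trans (leq_trans (leq_addr _ _) leW); rewrite subset_leq_card // subsetUl.
  (* The three vertices may coincide, so a short list is padded by repetition. *)
  have [S [cS dS ab]] := three x x x W px px px cW.
  exists S; split=> //=; first by apply: leq_trans cS _; clear; lia.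
  by apply: absorbs_sub ab => z; rewrite !inE => ->.
- have [px py] : pt x = j /\ pt y = j by split; apply: ptQ; rewrite !inE eqxx ?orbT.
  have cW : #|W| <= w3.
    by apply: leq_trans (leq_trans (leq_addr _ _) leW); rewrite subset_leq_card // subsetUl.
  have [S [cS dS ab]] := three x x y W px px py cW.
  exists S; split=> //=; first by apply: leq_trans cS _; clear; lia.
  by apply: absorbs_sub ab => z; rewrite !inE => /orP[]->; rewrite ?orbT.
have [px py] : pt x = j /\ pt y = j by split; apply: ptQ; rewrite !inE eqxx ?orbT.
set Q' := y' :: Q in szQ ptQ leW *.
set U := W :|: _ in leW.
have [z] : exists z, z \in [set v | pt v == j] :\: U.
  apply/card_gt0P; have := cardsID U [set v | pt v == j]; have := pt_big x; rewrite px.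
  have : #|[set v | pt v == j] :&: U| <= #|U| by rewrite subset_leq_card // subsetIr.
  lia.
rewrite inE [z \in [set _ | _]]inE => /andP[zU /eqP pz].
move: (zU); rewrite /U in_setU inE !in_cons !negb_or => /and4P[zW zx zy zQ].
have [|S1 [cS1 dS1 ab1]] := three z x y (W :|: [set x in Q']) pz px py.
  apply: leq_trans (leq_trans (leq_addr _ _) leW); apply/subset_leq_card/subsetP => v.
  by rewrite /U !inE => /orP[]->; rewrite ?orbT.
have [||||S2 [cS2 dS2 ab2]] := IH (z :: Q') (W :|: ([set u in [:: x; y]] :|: S1)).
- by move: szQ => /=; lia.
- by [].
- by move=> v; rewrite in_cons => /orP[/eqP->//|vQ]; apply: ptQ; rewrite 2!in_cons vQ !orbT.
- apply: leq_trans leW; set U2 := _ :|: [set _ in _].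
  have : #|U2| <= #|z |: (U :|: S1)|.
    apply/subset_leq_card/subsetP => v; rewrite /U2 /U !(in_setU, in_set1, in_set, in_cons, in_nil) orbF.
    move: (v \in W) (v == x) (v == y) (v \in S1) (v == z) (v == y') (v \in Q).
    by do 7!case.
  move/leq_trans/(_ (card_glue z (leqnn _) cS1)); rewrite /= !mulnS; clear; lia.
move: dS1 dS2; rewrite !disjointUr => /andP[dS1W dS1Q] /and3P[dS2W dS2xy dS2S1].
have notin (A : {set V}) (s : seq V) v : [disjoint A & [set x in s]] -> v \in s -> v \notin A.
  by move=> dA vs; apply: contraTN dA => vA; apply/pred0Pn; exists v; rewrite /= vA inE.
exists (z |: (S1 :|: S2)); split.
- by apply: leq_trans (card_glue z cS1 cS2) _; rewrite /= !mulnS; clear; lia.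
- by rewrite !disjointUl disjoints1 zW dS1W.
apply: (@absorbs_glue _ _ _ _ _ [:: x; y] Q') => //.
- by rewrite disjoint_sym.
- by move=> v; apply: notin.
- by move=> v; apply: notin.
- by rewrite !inE negb_or zx.
by rewrite /Q' inE negb_or.
Qed.
End Chain.
End Hubs.
End Gadgets.

(** * Exchangeable pairs and the partition they induce *)

Section Structure.
Variables (V : finType) (adj : rel V) (tile : {set V} -> Prop) (k a c q d : nat).
Hypotheses (adj_sym : symmetric adj) (adj_irr : irreflexive adj).
Local Notation N := (nbhd adj).
Hypothesis pieces : forall U : {set V}, a < #|U| -> exists S : {set V},
  [/\ S \subset U, #|S| = k.-1 & forall x, S \subset N x -> tile (x |: S)].
Hypotheses (k0 : 0 < k) (c0 : 0 < c) (q0 : 0 < q) (V0 : 0 < #|V|).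
Hypotheses (deg : forall x, d <= #|N x|) (deg_q : (q + 1) * #|V| <= (c + 1) * q * d).

(** The proportion [1 / B] must survive two averagings: over the pairs among [c + 1] vertices, where
    the excess in the degrees is [1 / q], and over all partners of one vertex in [common_deg], where
    the factor 2 is spent. *)
Let B := 2 * q * (c + 1) ^ 2.
Let H x y := (x != y) && (#|V| <= B * #|N x :&: N y|).

Lemma deg_c : #|V| <= (c + 1) * d.
Proof.
rewrite -(leq_pmul2l q0); apply: leq_trans (leq_trans _ deg_q) _; last by rewrite mulnAC mulnC.
by rewrite leq_mul2r leq_addr orbT.
Qed.

Let H_sym : symmetric H.
Proof. by move=> x y; rewrite /H eq_sym setIC. Qed.

(** The neighbourhoods of [c + 1] vertices have total size at least [(1 + 1 / q) * #|V|], so their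
    intersections over ordered pairs sum to at least [#|V| / q], and there are fewer than
    [(c + 1) ^ 2] such pairs. *)
Lemma common_indep (I : {set V}) : c < #|I| ->
  exists x y, [/\ x \in I, y \in I, x != y & H x y].
Proof.
rewrite -addn1 => /subset_of_card[J JI cJ].
have [/exists_inP[x xJ /exists_inP[y yJ /andP[xy Hxy]]]|] :=
    boolP [exists x in J, exists y in J, (x != y) && H x y].
  by exists x, y; rewrite !(subsetP JI).
rewrite negb_exists_in => /forall_inP noH; exfalso.
have small x y : x \in J -> y \in J -> y != x -> B * #|N x :&: N y| <= #|V|.-1.
  move=> xJ yJ yx; rewrite -ltnS prednK // ltnNge; apply: contraNN (noH x xJ) => le.
  by apply/exists_inP; exists y; rewrite // /H eq_sym yx.
pose S := \sum_(x in J) \sum_(y in J | y != x) #|N x :&: N y|.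
have sumN : (c + 1) * d <= #|V| + S.
  rewrite -cJ -sum_nat_const; apply: leq_trans (_ : \sum_(x in J) #|N x| <= _).
    exact: leq_sum.
  have E (A : {set V}) : #|A| = \sum_u (u \in A).
    by rewrite -sum1_card big_mkcond; apply: eq_bigr => u _; case: (u \in A).
  rewrite (eq_bigr _ (fun x _ => E (N x))) exchange_big /=.
  have -> : S = \sum_u \sum_(x in J) \sum_(y in J | y != x) (u \in N x :&: N y).
    rewrite exchange_big /=; apply: eq_bigr => x _; rewrite exchange_big /=.
    by apply: eq_bigr => y _; rewrite E.
  rewrite -[#|V|]sum1_card -big_split /=; apply: leq_sum => u _.
  have [x /andP[xJ ux]|none] := pickP [pred x | (x \in J) && (u \in N x)]; last first.
    by rewrite big1 // => x xJ; have := none x; rewrite /= xJ /= => ->.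
  rewrite (bigD1 x) //= ux leq_add2l [leqRHS](bigD1 x) //=.
  apply: leq_trans (leq_addr _ _); apply: leq_sum => y _.
  by rewrite in_setI ux.
have le1 : #|V| <= q * S.
  have := leq_mul (leqnn q) sumN; rewrite mulnA (mulnC q) mulnDr => /(leq_trans deg_q).
  by rewrite mulnDl mul1n leq_add2l.
have le2 : B * S <= (c + 1) ^ 2 * #|V|.-1.
  rewrite /S big_distrr /= expnS expn1 -mulnA -{1}cJ -sum_nat_const.
  apply: leq_sum => x xJ; rewrite big_distrr /= -cJ -sum_nat_const.
  rewrite big_mkcondr /=; apply: leq_sum => y yJ; case: ifP => // yx; exact: small.
have : B * #|V| <= q * ((c + 1) ^ 2 * #|V|.-1).
  apply: leq_trans (leq_mul (leqnn B) le1) _.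
  by rewrite mulnCA leq_mul2l le2 orbT.
have -> : B * #|V| = q * ((c + 1) ^ 2 * (2 * #|V|)) by rewrite /B; move: ((c + 1) ^ 2); lia.
rewrite leq_pmul2l // leq_pmul2l ?expn_gt0 ?addn1 //; lia.
Qed.

(** There are at least [d ^ 2] walks of length two from [x]; those ending at vertices not
    exchangeable with [x] number at most [#|V| ^ 2 / B], which is at most half of that. *)
Lemma common_deg x : #|V| <= 2 * (c + 1) ^ 2 * (#|[set y | H x y]| + 1).
Proof.
set h := #|_|; set n := #|V|.
have sumE : d * d <= \sum_y #|N x :&: N y|.
  have E y : #|N x :&: N y| = \sum_(u in N x) (adj y u).
    rewrite -sum1_card (eq_bigl (fun u => (u \in N x) && adj y u)) => [|u]; last by rewrite !inE.
    by rewrite big_mkcondr; apply: eq_bigr => u _; case: (adj y u).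
  rewrite (eq_bigr _ (fun y _ => E y)) exchange_big /=.
  apply: leq_trans (_ : #|N x| * d <= _); first by rewrite leq_mul2r deg orbT.
  rewrite -sum_nat_const; apply: leq_sum => u _; apply: leq_trans (deg u) _.
  rewrite -sum1_card big_mkcond; apply: leq_sum => y _; rewrite inE adj_sym.
  by case: (adj y u).
have sumB : B * \sum_y #|N x :&: N y| <= (h + 1) * (B * n) + n * n.
  have -> : h + 1 = #|x |: [set y | H x y]|.
    by rewrite cardsU1 inE /H eqxx addnC.
  have <- : \sum_y ((if y \in x |: [set y | H x y] then B * n else 0) + n) =
      #|x |: [set y | H x y]| * (B * n) + n * n.
    by rewrite big_split /= -big_mkcond !sum_nat_const.
  rewrite big_distrr /=.
  apply: leq_sum => y _; rewrite !inE; case: eqP => [->|/eqP yx] /=.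
    by apply: leq_trans (leq_addr _ _); rewrite leq_mul2l max_card orbT.
  rewrite /H eq_sym yx /=; case: ifP => [_|/negbT]; last by rewrite -ltnNge add0n => /ltnW.
  by apply: leq_trans (leq_addr _ _); rewrite leq_mul2l max_card orbT.
have le1 := leq_trans (leq_mul (leqnn B) sumE) sumB.
have le2 : n * n <= (c + 1) ^ 2 * (d * d).
  by rewrite expnS expn1 mulnACA leq_mul // deg_c.
have le3 : 2 * (c + 1) ^ 2 <= B by rewrite /B mulnAC leq_pmulr.
have B0 : 0 < B by apply: leq_trans le3; rewrite muln_gt0 expn_gt0 addn1.
have n0 : 0 < n by [].
have Bn0 : 0 < B * n by rewrite muln_gt0 B0.
rewrite -(leq_pmul2l Bn0).
clear Bn0 sumB sumE; clearbody n h; move: le1 le2 le3; clear B0.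
move: ((c + 1) ^ 2) (d * d) (B) => s e b le1 le2 le3.
have le4 : 2 * (b * (n * n)) <= 2 * (s * (b * e)).
  by rewrite leq_mul2l /= [leqRHS]mulnCA leq_mul2l le2 orbT.
have le5 : 2 * (s * (b * e)) <= 2 * (s * ((h + 1) * (b * n) + n * n)).
  by rewrite !leq_mul2l le1 !orbT.
have le6 : 2 * s * (n * n) <= b * (n * n) by rewrite leq_mul2r le3 orbT.
lia.
Qed.

(** The summands of [K] are the room needed by the three links of a triple gadget, each of size
    [k * (2 * c + 2)], by the gluings along a path with at most [2 * c + 1] inner vertices, and by
    the two ends of the path. *)
Lemma structure w (K := 3 * (k * (2 * c + 2) + c + 6) + (k + 3 + 2 * c) * (2 * c + 1) + 2) :
    ((3 * (c + 1)) ^ 4 + B) * (w + K + a) < #|V| ->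
    2 * (c + 1) ^ 2 * (2 * c * (w + K) + 2) <= #|V| ->
  exists b (pt : V -> 'I_b), [/\ b <= c, forall j, #|V| <= 8 * (c + 1) ^ 2 * #|[set v | pt v == j]| &
    forall (Q : seq V) (W : {set V}) j, Q != [::] -> (forall x, x \in Q -> pt x = j) ->
      #|W :|: [set x in Q]| + (3 * (k * (2 * c + 2)) + k + 4) * size Q <= w ->
      gadget tile W Q ((3 * (k * (2 * c + 2)) + k + 4) * size Q)].
Proof.
move=> big1 big2.
have [x0 _] : exists x, x \in [set: V] by apply/card_gt0P; rewrite cardsT.
set M1 := 2 * (c + 1) ^ 2 in big2.
have M10 : 0 < M1 by rewrite muln_gt0 expn_gt0 addn1.
pose h := #|V| %/ M1 - 1.
have lth : 2 * c * (w + K) < h.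
  have : 2 * c * (w + K) + 2 <= #|V| %/ M1 by rewrite leq_divRL // mulnC.
  by rewrite /h; move: (_ %/ _); clear; lia.
have hE : (h + 1) * M1 <= #|V| < (h + 2) * M1.
  have -> : h + 1 = #|V| %/ M1 by move: lth; rewrite /h; move: (_ %/ _); clear; lia.
  have -> : h + 2 = (#|V| %/ M1).+1 by move: lth; rewrite /h; move: (_ %/ _); clear; lia.
  by rewrite leq_trunc_div ltn_ceil.
case/andP: hE => hn nh.
have H_deg x : h <= #|[set y | H x y]|.
  rewrite -(leq_add2r 1) -(leq_pmul2l M10) mulnC.
  exact: leq_trans hn (common_deg x).
have [b [pt [bc ptbig pth ptlink]]] := parts x0 H_sym common_indep H_deg lth.
have H_hub x y : H x y -> w + K + a < #|N x :&: N y|.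
  case/andP=> _ le; rewrite ltnNge; apply/negP => le2.
  have := leq_trans le (leq_mul (leqnn B) le2); apply/negP; rewrite -ltnNge.
  by apply: leq_ltn_trans big1; rewrite leq_mul2r leq_addl orbT.
pose wL := w + 3 * (k * (2 * c + 2) + c + 6).
exists b, pt; split=> // [j|Q W j Q0 ptQ leW].
  have -> : 8 * (c + 1) ^ 2 = 4 * M1 by rewrite /M1 mulnA.
  apply: leq_trans (ltnW nh) _; rewrite mulnC [4 * _]mulnC -mulnA leq_mul2l; apply/orP; right.
  by move: (pth j) lth (ptbig j); rewrite -mulnA; move: (c * _); clear; lia.
apply: (@gadget_chain V adj tile k a adj_sym adj_irr pieces c d V0 deg deg_c _ pt wL w _
  _ _ _ _ Q W j) => //.
- move=> x y ptxy xy W' cW' _.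
  have [|p [Hp up pW sp]] := ptlink x y W' ptxy xy.
    by apply: leq_trans (leq_add cW' (leqnn 2)) _; rewrite /wL /K; clear; lia.
  have [||S [cS dS ab]] := robust_path adj_irr pieces H_hub (L := 2 * c + 1) (w := wL)
      k0 Hp up sp _ cW'.
  - apply: leq_trans (leq_add (leqnn _) (leq_mul (leqnn _) sp)) _.
    by rewrite /wL /K; clear; lia.
  - rewrite disjoints_subset; apply/subsetP=> u; rewrite !inE; exact: pW.
  exists S; split=> //; apply: leq_trans cS _; rewrite leq_mul2l; apply/orP; right.
  by move: sp; clear; lia.
- by move=> x; apply: leq_ltn_trans (ptbig _); rewrite /wL /K; clear; lia.
apply: leq_ltn_trans big1; rewrite leq_mul ?leq_addr // leq_add2r /wL /K; clear; lia.
Qed.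
End Structure.

(** * The flexible absorber *)

Section Absorber.
Variables (V : finType) (tile : {set V} -> Prop).

Lemma disjoint_notin (A B : {set V}) x : [disjoint A & B] -> x \in A -> x \notin B.
Proof. by move=> dAB xA; apply: contraTN dAB => xB; apply/pred0Pn; exists x; rewrite /= xA. Qed.

Lemma tileable_bigcup (I : finType) (P : pred I) (F : I -> {set V}) :
    (forall i, P i -> tileable tile (F i)) ->
    (forall i j, P i -> P j -> i != j -> [disjoint F i & F j]) ->
  tileable tile (\bigcup_(i | P i) F i).
Proof.
move=> tF dF; rewrite -big_filter; have : uniq [seq i <- index_enum I | P i].
  by rewrite filter_uniq // index_enum_uniq.
have : all P [seq i <- index_enum I | P i] by rewrite filter_all.
elim: [seq _ <- _ | _] => [|i r IH]; first by rewrite big_nil => _ _; exact: tileable0.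
rewrite /= big_cons => /andP[Pi Pr] /andP[ir ur].
apply: tileableU; [|exact: tF|exact: IH].
rewrite big_seq; elim/big_ind: _ => [|A B dA dB|j jr].
- by rewrite disjoint_sym disjoints_subset sub0set.
- by rewrite disjointUr dA.
apply: dF => //; first by move/allP: Pr; apply.
by apply: contraNneq ir => ->.
Qed.

(** Greedy choice: gadgets already built join the set to be avoided. *)
Lemma gadget_family (J : eqType) (r : seq J) (F : J -> seq V) (s : J -> nat) (w : nat)
    (W0 : {set V}) :
    (forall (i : J) (W : {set V}), W0 \subset W -> #|W| + s i <= w -> gadget tile W (F i) (s i)) ->
    uniq r -> #|W0| + \sum_(i <- r) s i <= w ->
  exists S : J -> {set V},
    [/\ forall i, i \in r -> absorbs tile (S i) (F i),
        forall i, i \in r -> [disjoint S i & W0],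
        forall i j, i \in r -> j \in r -> i != j -> [disjoint S i & S j] &
        #|\bigcup_(i <- r) S i| <= \sum_(i <- r) s i].
Proof.
move=> gad; elim: r => [_ _|i r IH].
  by exists (fun=> set0); split=> //; rewrite !big_nil cards0.
rewrite cons_uniq big_cons => /andP[ir ur] lew.
have [//||S [ab dW dS cS]] := IH; first by move: lew; clear; lia.
have [||T [cT dT abT]] := gad i (W0 :|: \bigcup_(j <- r) S j).
- exact: subsetUl.
- apply: leq_trans lew; rewrite [s i + _]addnC addnA leq_add2r.
  by apply: leq_trans (leq_card_setU _ _) _; rewrite leq_add2l.
move: dT; rewrite disjointUr => /andP[dTW dTS].
have dTj j : j \in r -> [disjoint T & S j].
  move=> jr; apply: disjointWr dTS; rewrite (big_rem j) //=; exact: subsetUl.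
have ri j : j \in r -> (j == i) = false.
  by move=> jr; apply/negbTE; apply: contraNneq ir => <-.
exists (fun j => if j == i then T else S j); split.
- move=> j; rewrite inE; case: eqP => [-> _ //|_ /= jr]; exact: ab.
- move=> j; rewrite inE; case: eqP => [-> _ //|_ /= jr]; exact: dW.
- move=> j l; rewrite !inE; case: eqP => [->|_] /=; case: eqP => [->|_] //=.
  + by rewrite eqxx.
  + by move=> _ lr _; apply: dTj.
  + by move=> jr _ _; rewrite disjoint_sym; apply: dTj.
  exact: dS.
rewrite !big_cons eqxx big_seq (eq_bigr S) => [|j jr]; last by rewrite ri.
by rewrite -big_seq; apply: leq_trans (leq_card_setU _ _) _; rewrite leq_add.
Qed.

Section Build.
Variables (b : nat) (pt : V -> 'I_b) (C w m l : nat) (Z : {set V}).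
Let part j := [set v | pt v == j].
Hypothesis gad : forall (Q : seq V) (W : {set V}) j, Q != [::] ->
  (forall x, x \in Q -> pt x = j) -> #|W :|: [set x in Q]| + C * size Q <= w ->
  gadget tile W Q (C * size Q).
Hypotheses (m0 : 0 < m) (lm : l <= m) (cZ : forall j, #|Z :&: part j| = m + l).
Hypothesis part_big : forall j, 4 * m + l <= #|part j|.
Hypothesis w_big : b * (4 * m + l) + C * (117 * m) * b <= w.

(** Every template index in every part receives a private gadget for its list. Once [R] is known,
    the template matches the gadgets bijectively with the vertices of the sets [Y j] and [R], and
    each gadget absorbs its match. *)
Lemma absorber : exists A : {set V}, [/\ Z \subset A, #|A| <= w &
  forall R : {set V}, R \subset Z -> (forall j, #|R :&: part j| = m) ->
    tileable tile ((A :\: Z) :|: R)].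
Proof.
have exY j : exists Y : {set V}, (Y \subset part j :\: Z) && (#|Y| == 3 * m).
  have [|Y YE /eqP cY] := @subset_of_card _ (part j :\: Z) (3 * m); last by exists Y; rewrite YE.
  by rewrite cardsD setIC cZ; move: (part_big j); clear; lia.
pose Y j := xchoose (exY j).
have YZ j : Y j \subset part j :\: Z by case/andP: (xchooseP (exY j)).
have cY j : #|Y j| = 3 * m by case/andP: (xchooseP (exY j)) => _ /eqP.
have Ypart j : Y j \subset part j by apply: subset_trans (YZ j) (subsetDl _ _).
have dYZ j : [disjoint Y j & Z].
  by rewrite disjoints_subset (subset_trans (YZ j)) // setDE subsetIr.
have dYZj j : [disjoint Y j & Z :&: part j] by apply: disjointWr (dYZ j); exact: subsetIl.
have exQ j := template m0 (dYZj j) (cY j) (cZ j) lm.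
have [Q QP] := boolp.choice exQ; clear exQ.
have Qsub j i : Q j i \subset Y j :|: Z :&: part j by case: (QP j).
have Qpart j i : Q j i \subset part j.
  by apply: subset_trans (Qsub j i) _; rewrite subUset Ypart subsetIr.
pose W0 := Z :|: \bigcup_j Y j.
have QW0 j i : Q j i \subset W0.
  apply: subset_trans (Qsub j i) _; rewrite subUset; apply/andP; split.
    by apply: subset_trans (subsetUr _ _); apply: (bigcup_max j).
  by apply: subset_trans (subsetUl _ _); apply: subsetIl.
have cW0 : #|W0| <= b * (4 * m + l).
  have ZE : Z = \bigcup_j (Z :&: part j).
    apply/setP=> x; apply/idP/bigcupP => [xZ|[j _]]; last by rewrite inE => /andP[].
    by exists (pt x); rewrite // !inE xZ eqxx.
  apply: leq_trans (leq_card_setU _ _) _; rewrite ZE.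
  apply: leq_trans (leq_add (card_bigcup_leq _ _) (card_bigcup_leq _ _)) _.
  rewrite -big_split /= (eq_bigr (fun=> 4 * m + l)) ?sum_nat_const ?card_ord // => j _.
  by rewrite cZ cY; clear; lia.
pose F (ji : 'I_b * 'I_(4 * m)) := enum (Q ji.1 ji.2).
pose s (ji : 'I_b * 'I_(4 * m)) := C * #|Q ji.1 ji.2|.
have sums : \sum_ji s ji <= C * (117 * m) * b.
  rewrite -(pair_bigA _ (fun j i => C * #|Q j i|)) /=.
  rewrite [leqRHS]mulnC -[b in leqRHS]card_ord -[leqRHS]sum_nat_const; apply: leq_sum => j _.
  by rewrite -big_distrr leq_mul2l; case: (QP j) => _ _ -> _; rewrite orbT.
have [|||S [ab dW dS cS]] := @gadget_family _ (index_enum _) F s w W0.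
- move=> [j i] W W0W; rewrite /s /F /= [#|Q j i|]cardE => leW.
  apply: (gad (j := j)).
  + by rewrite -size_eq0 -cardE cards_eq0; case: (QP j).
  + by move=> x; rewrite mem_enum => /(subsetP (Qpart j i)); rewrite inE => /eqP.
  + rewrite (setUidPl _) //; apply: subset_trans W0W; apply: subset_trans (QW0 j i).
    by apply/subsetP=> x; rewrite inE mem_enum.
- exact: index_enum_uniq.
- by apply: leq_trans w_big; apply: leq_add cW0 _.
exists (W0 :|: \bigcup_ji S ji); split.
- by rewrite -setUA subsetUl.
- apply: leq_trans w_big; apply: leq_trans (leq_card_setU _ _) _.
  by apply: leq_add cW0 _; apply: leq_trans cS sums.
move=> R RZ cR.
have exh j : exists h : 'I_(4 * m) -> V, [/\ injective h, forall i, h i \in Q j i &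
    [set h i | i in setT] = Y j :|: (R :&: part j)].
  by case: (QP j) => _ _ _; apply; rewrite ?setSI.
have [h hP] := boolp.choice exh; clear exh.
have hW0 j i : h j i \in W0 by apply: (subsetP (QW0 j i)); case: (hP j).
have hpt j i : pt (h j i) = j.
  by case: (hP j) => _ /(_ i)/(subsetP (Qpart j i)); rewrite inE => /eqP.
have mem (ji : 'I_b * 'I_(4 * m)) : ji \in index_enum _ by exact: mem_index_enum.
have hab ji : h ji.1 ji.2 \notin S ji /\ tileable tile (h ji.1 ji.2 |: S ji).
  by apply: (ab ji (mem ji) (h ji.1 ji.2)); rewrite mem_enum; case: (hP ji.1).
have SW0 ji x : x \in S ji -> x \notin W0 by move=> xS; apply: disjoint_notin xS; apply: dW.
have -> : (W0 :|: \bigcup_ji S ji) :\: Z :|: R =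
    \bigcup_(ji : 'I_b * 'I_(4 * m)) (h ji.1 ji.2 |: S ji).
  apply/setP=> x; apply/idP/bigcupP.
    have inh j : x \in Y j :|: (R :&: part j) ->
        exists2 ji, ji \in [set: 'I_b * 'I_(4 * m)] & x \in h ji.1 ji.2 |: S ji.
      case: (hP j) => _ _ <- /imsetP[i _ ->]; by exists (j, i); [rewrite in_setT|exact: setU11].
    rewrite !inE => /orP[/andP[xZ /orP[/orP[xZ'|/bigcupP[j _ xY]]|/bigcupP[ji _ xS]]]|xR].
    - by rewrite xZ' in xZ.
    - by have [|ji _ xji] := inh j; [rewrite inE xY|exists ji].
    - by exists ji; rewrite // inE xS orbT.
    by have [|ji _ xji] := inh (pt x); [rewrite !inE xR eqxx orbT|exists ji].
  case=> -[j i] _; rewrite in_setU1 => /orP[/eqP-> /=|xS].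
    have : h j i \in Y j :|: (R :&: part j) by case: (hP j) => _ _ <-; apply: imset_f.
    rewrite 2!inE => /orP[hY|/andP[hR _]]; last by rewrite inE hR orbT.
    rewrite !inE (disjoint_notin (dYZ j) hY) /= (_ : _ \in \bigcup_j Y j) ?orbT //.
    by apply/bigcupP; exists j.
  have /norP[xZ _] : ~~ ((x \in Z) || (x \in \bigcup_j Y j)).
    by have := SW0 _ _ xS; rewrite inE.
  rewrite !inE xZ /= (_ : x \in \bigcup_ji S ji) ?orbT //.
  by apply/bigcupP; exists (j, i).
apply: tileable_bigcup => [ji _|ji ji' _ _ neq]; first by case: (hab ji).
rewrite disjointUl !disjointUr !disjoints1 dS // andbT.
have -> : h ji.1 ji.2 \notin S ji'.
  by apply/negP => /SW0; rewrite hW0.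
rewrite andbT disjoint_sym disjoints1.
have -> : h ji'.1 ji'.2 \notin S ji by apply/negP => /SW0; rewrite hW0.
rewrite andbT inE; apply: contra neq => /eqP hh.
have e1 : ji.1 = ji'.1 by rewrite -(hpt ji.1 ji.2) hh hpt.
case: ji ji' e1 hh => [j i] [j' i'] /= <- hh.
by apply/eqP; congr (_, _); case: (hP j) => inj _ _; apply: inj.
Qed.
End Build.
End Absorber.

(** * Almost perfect tilings *)

Section NearTilings.
Variables (V : finType) (adj : rel V) (tile : {set V} -> Prop) (k a : nat).
Hypotheses (adj_sym : symmetric adj) (adj_irr : irreflexive adj) (k0 : 0 < k).
Local Notation N := (nbhd adj).
Hypothesis pieces : forall U : {set V}, a < #|U| -> exists S : {set V},
  [/\ S \subset U, #|S| = k.-1 & forall x, S \subset N x -> tile (x |: S)].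
Hypothesis tile_card : forall K, tile K -> #|K| = k.

Lemma greedy_tiling (U : {set V}) :
    (forall U' : {set V}, a < #|U'| -> exists2 K : {set V}, K \subset U' & tile K) ->
  exists P : {set V}, [/\ P \subset U, tileable tile P & #|U :\: P| <= a].
Proof.
move=> tiles; have [s] := ubnP #|U|; elim: s U => // s IH U leU.
have [Ua|/tiles[K KU tK]] := leqP #|U| a.
  by exists set0; rewrite sub0set setD0; split=> //; apply: tileable0.
have cK := tile_card tK.
have [|P [PU tP cP]] := IH (U :\: K).
  by have := subset_leq_card KU; rewrite cardsDS // cK; move: leU k0; clear; lia.
exists (K :|: P); split.
- by rewrite subUset KU (subset_trans PU) // subsetDl.
- apply: tileableS => //; rewrite disjoint_sym disjoints_subset.
  by apply: subset_trans PU _; rewrite setDE subsetIr.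
- by rewrite -setDDl.
Qed.

Lemma piece_disjoint x (S : {set V}) : S \subset N x -> x \notin S.
Proof. by move=> SN; apply/negP => /(subsetP SN); rewrite inE adj_irr. Qed.

Lemma cover_vertices (L Z : {set V}) :
    [disjoint L & Z] -> (forall v, v \in L -> a + k.-1 * #|L| < #|N v :&: Z|) ->
  exists U : {set V}, [/\ U \subset Z, #|U| <= k.-1 * #|L| & tileable tile (L :|: U)].
Proof.
have [s] := ubnP #|L|; elim: s L Z => // s IH L Z leL dLZ big.
have [->|[v vL]] := set_0Vmem L.
  by exists set0; rewrite sub0set cards0 setU0; split=> //; apply: tileable0.
have cL : #|L| = #|L :\ v|.+1 by rewrite (cardsD1 v) vL.
have [|S [SNZ cS tS]] := pieces (U := N v :&: Z).
  by apply: leq_ltn_trans (big v vL); rewrite leq_addr.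
have SZ : S \subset Z by apply: subset_trans SNZ (subsetIr _ _).
have SN : S \subset N v by apply: subset_trans SNZ (subsetIl _ _).
have [|||U [UZ cU tU]] := IH (L :\ v) (Z :\: S).
- by move: leL; rewrite cL.
- by apply: disjointWl (subsetDl _ _) (disjointWr (subsetDl _ _) dLZ).
- move=> u; rewrite inE => /andP[_ uL]; have := big u uL; rewrite cL mulnS.
  have := cardsID S (N u :&: Z).
  have : #|N u :&: Z :&: S| <= k.-1 by rewrite -cS subset_leq_card // subsetIr.
  by rewrite -setIDA; move: (k.-1 * _); clear; lia.
exists (S :|: U); split.
- by rewrite subUset SZ (subset_trans UZ) // subsetDl.
- by rewrite cL mulnS (leq_trans (leq_card_setU _ _)) // cS leq_add2l.
have -> : L :|: (S :|: U) = (v |: S) :|: ((L :\ v) :|: U).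
  by rewrite setUACA setD1K.
apply: tileableS => //; first exact: tS.
rewrite disjointUl !disjointUr !disjoints1 !inE eqxx /=.
have -> : v \notin U.
  apply: contraL dLZ => vU; apply/pred0Pn; exists v; rewrite /= vL.
  exact: (subsetP (subset_trans UZ (subsetDl _ _))).
have -> : [disjoint S & L :\ v].
  by rewrite disjoint_sym; apply: disjointWl (subsetDl _ _) (disjointWr SZ dLZ).
by rewrite disjoint_sym disjoints_subset (subset_trans UZ) // setDE subsetIr.
Qed.

Section Dense.
Variables (q d : nat) (U : {set V}).
Hypotheses (V0 : 0 < #|V|) (deg : forall x, d <= #|N x|).
Hypothesis deg_k : (q + 1) * #|V| <= k * q * d.
Hypothesis U_big : 2 * q * k * (#|~: U| + a) <= #|V|.

Let good (P : {set {set V}}) :=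
  [&& trivIset P, [forall K in P, boolp.asbool (tile K)] & cover P \subset U].

Let good_add P (K : {set V}) : good P -> tile K -> K \subset U -> [disjoint K & cover P] ->
  good (K |: P) /\ #|K |: P| = #|P|.+1.
Proof.
move=> /and3P[tr /forall_inP tl cU] tK KU dK.
have KP : K \notin P.
  apply/negP => KP; have : K \subset cover P by exact: (bigcup_max K).
  move=> sub; have /eqP : #|K| == 0.
    by rewrite cards_eq0 -subset0 -(disjoint_setI0 dK) subsetI subxx.
  by rewrite (tile_card tK); move: k0; case: (k).
split; last by rewrite cardsU1 KP.
apply/and3P; split.
- apply/trivIsetP => A B; rewrite !in_setU1 => /orP[/eqP->|AP] /orP[/eqP->|BP].
  + by rewrite eqxx.
  + by move=> _; apply: disjointWr dK; exact: (bigcup_max B).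
  + by move=> _; rewrite disjoint_sym; apply: disjointWr dK; exact: (bigcup_max A).
  by move/trivIsetP: tr; apply.
- by apply/forall_inP => A; rewrite in_setU1 => /orP[/eqP->|/tl//]; apply/boolp.asboolP.
- by rewrite /cover bigcup_setU big_set1 subUset KU.
Qed.

Let good_del P (K : {set V}) : good P -> K \in P ->
  [/\ good (P :\ K), #|P| = #|P :\ K|.+1 & [disjoint K & cover (P :\ K)]].
Proof.
move=> /and3P[tr /forall_inP tl cU] KP; split.
- apply/and3P; split.
  + by apply/trivIsetP => A B /setD1P[_ AP] /setD1P[_ BP]; move/trivIsetP: tr; apply.
  + by apply/forall_inP => A /setD1P[_ /tl].
  + apply: subset_trans cU; apply/bigcupsP => A /setD1P[_ AP]; exact: (bigcup_max A).
- by rewrite (cardsD1 K) KP.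
rewrite disjoint_sym disjoints_subset; apply/bigcupsP => A /setD1P[AK AP].
by rewrite -disjoints_subset; move/trivIsetP: tr; apply.
Qed.

(* In a largest tiling, a tile with two vertices of large degree into the
   leftover could be exchanged for two tiles. *)
Lemma dense_tiling :
  exists P : {set V}, [/\ P \subset U, tileable tile P & #|U :\: P| <= 2 * q * k * (a + k)].
Proof.
have good0 : good set0.
  apply/and3P; split; first by apply/trivIsetP => A B; rewrite inE.
    by apply/forall_inP => A; rewrite inE.
  by rewrite /cover big_set0 sub0set.
case: (arg_maxnP (fun P : {set {set V}} => #|P|) good0) => P gP maxP.
have /and3P[tr /forall_inP tl cU] := gP.
exists (cover P); split=> //.
  apply: tileable_bigcup; last exact/trivIsetP.
  by move=> K /tl/boolp.asboolP; apply: tileable1.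
set L := U :\: cover P; rewrite leqNgt; apply/negP => bigL.
have LU : L \subset U by apply: subsetDl.
have dLP : [disjoint L & cover P] by rewrite disjoints_subset /L setDE subsetIr.
(* A piece among the neighbours of [v] in the leftover would give a further tile. *)
have NL v : v \in L -> #|N v :&: L| <= a.
  move=> vL; rewrite leqNgt; apply/negP => /pieces[S [SNL _ tS]].
  have SL : S \subset L by apply: subset_trans SNL (subsetIr _ _).
  have [||g cg] := good_add gP (tS v (subset_trans SNL (subsetIl _ _))).
  - by rewrite subUset sub1set (subsetP LU) // (subset_trans SL).
  - by rewrite disjointUl disjoints1 (disjoint_notin dLP) // (disjointWl SL).
  by have := maxP _ g; rewrite /geq /= cg ltnn.
have tileL K : K \in P -> \sum_(u in K) #|N u :&: L| <= #|L| + k * (a + k).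
  move=> KP; have cK : #|K| = k by apply: tile_card; apply/boolp.asboolP/tl.
  have [gK cP dK] := good_del gP KP.
  have KU : K \subset U by apply: subset_trans cU; exact: (bigcup_max K).
  have dLK : [disjoint L & K] by apply: disjointWr dLP; exact: (bigcup_max K).
  have dLK' : [disjoint L & cover (P :\ K)].
    apply: disjointWr dLP; apply/bigcupsP => A /setD1P[_ AP]; exact: (bigcup_max A).
  (* Two vertices of [K] with more than [a + k] neighbours in the leftover would have disjoint
     pieces there, and two tiles would replace [K]; the term [k] makes room for the first piece. *)
  have [/exists_inP[u uK bigu]|] := boolP [exists u in K, a + k < #|N u :&: L|]; last first.
    rewrite negb_exists_in => /forall_inP small.
    apply: leq_trans (leq_addl _ _); rewrite -cK -sum_nat_const; apply: leq_sum => u uK.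
    by rewrite cK leqNgt small.
  rewrite (bigD1 u) //= leq_add ?subset_leq_card ?subsetIr //.
  apply: leq_trans (_ : \sum_(v in K) (a + k) <= _); last by rewrite sum_nat_const cK.
  rewrite [leqRHS](bigD1 u) //=; apply: leq_trans (leq_addl _ _).
  apply: leq_sum => u' /andP[u'K u'u]; rewrite leqNgt; apply/negP => bigu'.
  have [|S [SNL cS tS]] := pieces (U := N u :&: L); first by apply: leq_ltn_trans bigu; rewrite leq_addr.
  have SL : S \subset L by apply: subset_trans SNL (subsetIr _ _).
  have [|S' [SNL' cS' tS']] := pieces (U := (N u' :&: L) :\: S).
    have := cardsID S (N u' :&: L).
    have : #|N u' :&: L :&: S| <= k.-1 by rewrite -cS subset_leq_card // subsetIr.
    by move: bigu'; clear; lia.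
  have SL' : S' \subset L.
    by apply: subset_trans SNL' (subset_trans (subsetDl _ _) (subsetIr _ _)).
  have dSS' : [disjoint S' & S].
    by rewrite disjoints_subset (subset_trans SNL') // setDE subsetIr.
  have notS (X : {set V}) x : X \subset L -> x \in K -> x \notin X.
    by move=> XL xK; apply: contraTN dLK => xX; apply/pred0Pn; exists x; rewrite /= (subsetP XL).
  have [||g1 c1] := good_add gK (tS u (subset_trans SNL (subsetIl _ _))).
  - by rewrite subUset sub1set (subsetP KU) // (subset_trans SL).
  - by rewrite disjointUl disjoints1 (disjoint_notin dK) // (disjointWl SL).
  have tK' := tS' u' (subset_trans SNL' (subset_trans (subsetDl _ _) (subsetIl _ _))).
  have [||g2 c2] := good_add g1 tK'.
  - by rewrite subUset sub1set (subsetP KU) // (subset_trans SL').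
  - rewrite /cover bigcup_setU big_set1 disjointUr !disjointUl !disjointUr !disjoints1.
    rewrite !in_set1 u'u notS //= disjoint_sym disjoints1 notS //= dSS'.
    by rewrite (disjoint_notin dK) //= (disjointWl SL').
  by have := maxP _ g2; rewrite /geq /= c2 c1 -cP ltnn.
have cP : k * #|P| <= #|V|.
  apply: leq_trans (_ : #|cover P| <= _); last exact: max_card.
  rewrite -(eqP tr) mulnC -sum_nat_const; apply: leq_sum => K KP.
  by rewrite (tile_card (K := K)) //; apply/boolp.asboolP/tl.
set Lk := #|L| + k * (a + k) in tileL.
have degL : #|L| * d <= #|L| * (#|~: U| + a) + #|P| * Lk.
  apply: leq_trans (_ : \sum_(v in L) #|N v| <= _).
    by rewrite -sum_nat_const; apply: leq_sum.
  apply: leq_trans (_ : \sum_(v in L) (#|~: U| + a + #|N v :&: cover P|) <= _).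
    apply: leq_sum => v vL; apply: leq_trans (_ : #|~: U :|: (N v :&: L) :|: (N v :&: cover P)| <= _).
      apply/subset_leq_card/subsetP => u uN; rewrite !in_setU !in_setI uN /= /L !inE.
      by case: (u \in U); case: (u \in cover P).
    apply: leq_trans (leq_card_setU _ _) _; rewrite leq_add2r.
    by apply: leq_trans (leq_card_setU _ _) _; rewrite leq_add2l NL.
  rewrite big_split /= sum_nat_const leq_add2l.
  apply: leq_trans (_ : \sum_(K in P) \sum_(u in K) #|N u :&: L| <= _); last first.
    by rewrite -sum_nat_const; apply: leq_sum.
  have E (A B : {set V}) : #|A :&: B| = \sum_(u in B) (u \in A).
    rewrite -sum1_card (eq_bigl (fun u => (u \in B) && (u \in A))).
      by rewrite big_mkcondr; apply: eq_bigr => u _; case: (u \in A).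
    by move=> u; rewrite inE andbC.
  rewrite -(big_trivIset _ tr) /= (eq_bigr _ (fun v _ => E (N v) _)) exchange_big /=.
  apply: leq_sum => u _; rewrite E; apply: leq_sum => v _.
  by rewrite !inE adj_sym.
(* At most [#|V| / k] tiles receive little more than [#|L|] edges each, while every vertex of the
   leftover sends at least [(1 + 1 / q) * #|V| / k]; the excess [1 / q] will bound [#|L|]. *)
have le1 : #|L| * ((q + 1) * #|V|) <=
    q * k * (#|~: U| + a) * #|L| + q * (#|V| * Lk).
  apply: leq_trans (leq_mul (leqnn _) deg_k) _.
  have -> : #|L| * (k * q * d) = q * k * (#|L| * d) by move: (#|L|); clear; lia.
  apply: leq_trans (leq_mul (leqnn _) degL) _.
  rewrite mulnDr [X in _ <= X + _]mulnAC -[X in _ <= X + _]mulnA leq_add2l -mulnA leq_mul2l.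
  by rewrite [k * _]mulnA leq_mul2r cP !orbT.
have le2 : 2 * (q * k * (#|~: U| + a) * #|L|) <= #|V| * #|L|.
  by rewrite mulnA leq_mul2r mulnA mulnA U_big orbT.
have le3 : #|V| * (2 * q * k * (a + k) + 1) <= #|V| * #|L|.
  by rewrite leq_mul2l addn1 bigL orbT.
rewrite /Lk in le1; move: le1 le2 le3 V0.
move: (#|L|) (#|V|) (q * k * (#|~: U| + a)) (a + k) => x n y z; clear; nia.
Qed.
End Dense.
End NearTilings.

(** As [r] counts only the surplus over [m], each part keeps at least [m] vertices throughout the
    game, enough to find the tile for the next move. *)
Lemma realize (V : finType) (tile : {set V} -> Prop) (b k m : nat) (part : 'I_b -> {set V})
    (rho : rel 'I_b) (Z : {set V}) r r' :
    (forall (R : {set V}) i j, R \subset Z -> (forall l, m <= #|R :&: part l|) -> rho i j ->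
      exists T : {set V}, [/\ T \subset R, tile T & forall l, #|T :&: part l| = cost k i j l]) ->
    reduces k rho r r' ->
  forall R : {set V}, R \subset Z -> (forall l, #|R :&: part l| = m + r l) ->
  exists U : {set V}, [/\ U \subset R, tileable tile U &
    forall l, #|(R :\: U) :&: part l| = m + r' l].
Proof.
move=> move_tile; elim=> {r r'} [r|r i j r' rij le _ IH] R RZ cR.
  exists set0; rewrite sub0set setD0; split=> //; exact: tileable0.
have [|T [TR tT cT]] := move_tile R i j RZ _ rij; first by move=> l; rewrite cR leq_addr.
have [||U [UR tU cU]] := IH (R :\: T).
- exact: subset_trans (subsetDl _ _) RZ.
- move=> l; rewrite setIDAC cardsD -setIA [part l :&: T]setIC setIA (setIidPr TR) cT cR.
  by rewrite addnBA.
exists (T :|: U); split.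
- by rewrite subUset TR (subset_trans UR) // subsetDl.
- apply: tileableS => //; rewrite disjoint_sym disjoints_subset.
  by apply: subset_trans UR _; rewrite setDE subsetIr.
by move=> l; rewrite -cU setDDl.
Qed.

(** * Assembling the tiling *)

Section Main.
Variables (V : finType) (adj : rel V) (tile : {set V} -> Prop) (k a c q d l : nat).
Hypotheses (adj_sym : symmetric adj) (adj_irr : irreflexive adj).
Local Notation N := (nbhd adj).
Local Notation n := #|V|.
Hypothesis pieces : forall U : {set V}, a < #|U| -> exists S : {set V},
  [/\ S \subset U, #|S| = k.-1 & forall x, S \subset N x -> tile (x |: S)].
Hypothesis tile_card : forall K : {set V}, tile K -> #|K| = k.
Hypotheses (k3 : 3 <= k) (c0 : 0 < c) (q0 : 0 < q) (V0 : 0 < n) (l0 : 0 < l).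
Hypotheses (deg : forall x, d <= #|N x|) (deg_q : (q + 1) * n <= (c + 1) * q * d).
Hypothesis alt : (forall U : {set V}, a < #|U| -> exists2 K : {set V}, K \subset U & tile K)
  \/ c + 1 = k.

(** A part has at least [n / (8 * (c + 1) ^ 2)] vertices, each of degree at least [n / (c + 1)], so
    it sends at least [n ^ 2 / E] edges to one of the at most [c] parts. The factor 4 in [th] leaves
    room to pass from edge counts to dense sets. *)
Let E := 8 * (c + 1) ^ 3 * c.
Let th := 4 * E.
(** The sampler with [t = 2 * l] dictates this reservoir size per part. Every relevant set then
    meets a reservoir in [2 * l] vertices, of which at most [l] get lost while [m = z - l] remain,
    so more than [a] stay available; [m] is also what the absorber consumes. *)
Let z := 4 * th * (2 * l).
Let m := z - l.
Let w := c * (4 * m + l) + (3 * (k * (2 * c + 2)) + k + 4) * (117 * m) * c.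
Let K0 := 3 * (k * (2 * c + 2) + c + 6) + (k + 3 + 2 * c) * (2 * c + 1) + 2.
Hypotheses (n1 : ((3 * (c + 1)) ^ 4 + 2 * q * (c + 1) ^ 2) * (w + K0 + a) < n)
  (n2 : 2 * (c + 1) ^ 2 * (2 * c * (w + K0) + 2) <= n)
  (n3 : th * z <= n) (n4 : n + c < 2 ^ (2 * l)) (n5 : 8 * (c + 1) ^ 2 * (4 * m + l) <= n)
  (n6 : 2 * q * k * (w + a) <= n)
  (n7 : k.-1 * (k.-1 * (2 * q * k * (a + k))) <= l).

Let E0 : 0 < E.
Proof.
have : 0 < (c + 1) ^ 3 by rewrite expn_gt0 addn1.
by rewrite /E; move: (_ ^ _) => e e0; rewrite !muln_gt0 e0.
Qed.
Let th0 : 0 < th. Proof. by rewrite muln_gt0 E0. Qed.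
Let zl : 2 * l <= z.
Proof. by rewrite /z leq_pmull // muln_gt0. Qed.
Let ml : l <= m. Proof. by move: zl; rewrite /m; clear; lia. Qed.
Let mlz : m + l = z. Proof. by move: zl; rewrite /m; clear; lia. Qed.
Let al : a < l.
Proof.
apply: leq_trans n7; apply: leq_trans (_ : 1 * (1 * (1 * (a + k))) <= _).
  by rewrite !mul1n; move: k3; clear; lia.
have k10 : 0 < k.-1 by move: k3; clear; lia.
have k0 : 0 < k by move: k3; clear; lia.
by rewrite !leq_mul // !muln_gt0 q0 k0.
Qed.

Section Partition.
Variables (b : nat) (pt : V -> 'I_b).
Hypothesis bc : b <= c.
Let part j := [set v | pt v == j].
Hypothesis part_big : forall j, n <= 8 * (c + 1) ^ 2 * #|part j|.

Hypothesis gad : forall (Q : seq V) (W : {set V}) j, Q != [::] ->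
  (forall x, x \in Q -> pt x = j) ->
  #|W :|: [set x in Q]| + (3 * (k * (2 * c + 2)) + k + 4) * size Q <= w ->
  gadget tile W Q ((3 * (k * (2 * c + 2)) + k + 4) * size Q).

Let dense (U M : {set V}) := #|U| + th * z <= th * #|M :&: U|.
Let X j := [set x | dense (part j) (N x)].
Let edges i j := \sum_(x in part i) #|N x :&: part j|.
Let linked i j := n * n <= E * edges i j.

Let degc : n <= (c + 1) * d. Proof. exact: deg_c deg_q. Qed.

Let card_parts (A : {set V}) : \sum_j #|A :&: part j| = #|A|.
Proof.
rewrite -[RHS]sum1_card (partition_big pt predT) //=; apply: eq_bigr => j _.
by rewrite -sum1_card; apply: eq_bigl => v; rewrite !inE.
Qed.

Let linked_sym : symmetric linked.
Proof.
move=> i j; rewrite /linked; congr (_ <= _ * _).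
have F i' j' : edges i' j' = \sum_(x in part i') \sum_(y in part j') (adj x y).
  apply: eq_bigr => x _; rewrite -sum1_card (eq_bigl (fun y => (y \in part j') && adj x y)).
    by rewrite big_mkcondr; apply: eq_bigr => y _; case: (adj x y).
  by move=> y; rewrite !inE andbC.
by rewrite !F exchange_big; apply: eq_bigr => y _; apply: eq_bigr => x _; rewrite adj_sym.
Qed.

Let linked_nbr i : exists j, linked i j.
Proof.
apply/existsP; apply: contraT; rewrite negb_exists => /forallP none.
have b0 : 0 < b by apply: leq_ltn_trans (ltn_ord i).
have n0 : 0 < n * n by rewrite muln_gt0 V0.
have : \sum_j E * edges i j <= b * (n * n).-1.
  rewrite -[b in leqRHS]card_ord -[leqRHS]sum_nat_const; apply: leq_sum => j _.
  by rewrite -ltnS prednK // ltnNge; apply: none.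
rewrite -big_distrr /= exchange_big /= (eq_bigr _ (fun x _ => card_parts (N x))) => le1.
have le2 : E * (#|part i| * d) <= b * (n * n).-1.
  apply: leq_trans le1; rewrite leq_mul2l -sum_nat_const leq_sum ?orbT //.
have le3 : c * (n * n) <= E * (#|part i| * d).
  have -> : E * (#|part i| * d) = c * ((8 * (c + 1) ^ 2 * #|part i|) * ((c + 1) * d)).
    by rewrite /E expnSr; move: ((c + 1) ^ 2) (c + 1) (#|part i|); clear; lia.
  by rewrite leq_mul2l leq_mul ?orbT.
have := leq_trans le3 le2.
have : b * (n * n).-1 <= c * (n * n).-1 by rewrite leq_mul2r bc orbT.
move: n0 c0; case: (n * n) => // n' _ c1; rewrite /= mulnS; move: (b * _) c1; clear; lia.
Qed.

(** A vertex outside [X j] has fewer than [2 * n / th] neighbours in part [j]; these account for at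
    most half of the [n ^ 2 / E] edges, so many vertices of part [i] lie in [X j]. *)
Let dense_of_linked i j : linked i j -> dense (part i) (X j).
Proof.
rewrite /linked /dense => le.
have le1 : th * edges i j <= #|X j :&: part i| * (th * n) + n * (2 * n).
  have -> : #|X j :&: part i| * (th * n) = \sum_(x in part i) (if x \in X j then th * n else 0).
    rewrite -big_mkcondr /= -sum_nat_const; apply: eq_bigl => x; by rewrite in_setI andbC.
  rewrite /edges big_distrr /=; apply: (@leq_trans
      (\sum_(x in part i) (if x \in X j then th * n else 0) + \sum_(x in part i) 2 * n)).
    rewrite -big_split /=; apply: leq_sum => x _; rewrite inE /dense.
    case: ifP => [_|/negbT].
      by apply: leq_trans (leq_addr _ _); rewrite leq_mul2l max_card orbT.
    rewrite -ltnNge add0n => /ltnW/leq_trans; apply.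
    by rewrite mul2n -addnn leq_add // max_card.
  by rewrite leq_add2l sum_nat_const leq_mul2r max_card orbT.
have le2 := leq_mul (leqnn th) le; have le3 := leq_mul (leqnn E) le1.
have le4 : n <= 2 * E * #|X j :&: part i|.
  rewrite [leqRHS]mulnCA in le2; have := leq_trans le2 le3; rewrite /th.
  move: V0 E0; move: (#|X j :&: part i|) (#|V|) (E) => x y e y0 e0.
  have -> : 4 * e * (y * y) = (2 * e * y) * (2 * y) by clear; lia.
  have -> : e * (x * (4 * e * y) + y * (2 * y)) = (2 * e * y) * (2 * e * x + y) by clear; lia.
  by rewrite leq_pmul2l ?muln_gt0 ?y0 ?e0 //; clear; lia.
apply: leq_trans (leq_add (max_card _) n3) _.
apply: leq_trans (leq_add le4 le4) _; rewrite /th; move: (#|_|) (E) => x e; clear; lia.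
Qed.

Let dense_nbhd v : exists j, dense (part j) (N v).
Proof.
apply/existsP; apply: contraT; rewrite negb_exists => /forallP none.
have small j : c * (c + 1) * #|N v :&: part j| < n.
  have := none j; rewrite -ltnNge => lt1.
  have lt2 : th * #|N v :&: part j| < 2 * n.
    by apply: leq_trans lt1 _; rewrite mul2n -addnn leq_add // max_card.
  have le : 2 * (c * (c + 1)) <= th.
    have e0 : 0 < (c + 1) ^ 2 by rewrite expn_gt0 addn1.
    rewrite /th /E expnSr; move: ((c + 1) ^ 2) e0 => e e0.
    have : c * (c + 1) <= e * (c * (c + 1)) by rewrite leq_pmull.
    clear; lia.
  rewrite -(ltn_pmul2l (_ : 0 < 2)) // mulnA; apply: leq_ltn_trans lt2.
  by rewrite leq_mul2r le orbT.
have b0 : 0 < b by apply: leq_ltn_trans (ltn_ord (pt v)).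
have : \sum_j (c * (c + 1) * #|N v :&: part j|) <= b * n.-1.
  rewrite -[b in leqRHS]card_ord -[leqRHS]sum_nat_const; apply: leq_sum => j _.
  by rewrite -ltnS prednK.
rewrite -big_distrr /= card_parts => le1.
have le2 : c * n <= c * (c + 1) * #|N v|.
  rewrite -mulnA leq_mul2l; apply/orP; right; apply: leq_trans degc _.
  by rewrite leq_mul2l deg orbT.
have := leq_trans le2 le1; have : b * n.-1 <= c * n.-1 by rewrite leq_mul2r bc orbT.
move: V0 c0; case: (#|V|) => // n' _ c1; rewrite /= mulnS; move: (b * _) c1; clear; lia.
Qed.

Let part_size j : 4 * m + l <= #|part j|.
Proof.
rewrite -(leq_pmul2l (_ : 0 < 8 * (c + 1) ^ 2)); first exact: leq_trans n5 (part_big j).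
by rewrite muln_gt0 expn_gt0 addn1.
Qed.

(** The sampler is applied to at most [n + c] sets: neighbourhoods, in which pieces will be sought,
    and sets [X i], which will supply the single vertex of a tile used in a move. *)
Let reservoir j : exists Z : {set V},
  [/\ Z \subset part j, #|Z| = z,
      forall v, dense (part j) (N v) -> 2 * l <= #|N v :&: Z| &
      forall i, dense (part j) (X i) -> 2 * l <= #|X i :&: Z|].
Proof.
pose F := [set M in [set N v | v in [set: V]] :|: [set X i | i in [set: 'I_b]] |
  dense (part j) M].
have cF : #|F| < 2 ^ (2 * l).
  apply: leq_ltn_trans n4; apply: leq_trans (_ : #|[set N v | v in [set: V]] :|: [set X i | i in [set: 'I_b]]| <= _).
    by apply/subset_leq_card/subsetP => M; rewrite inE => /andP[].
  apply: leq_trans (leq_card_setU _ _) _; rewrite leq_add //.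
    by apply: leq_trans (leq_imset_card _ _) _; rewrite cardsT.
  by apply: leq_trans (leq_imset_card _ _) _; rewrite cardsT card_ord.
have t0 : 0 < 2 * l by rewrite muln_gt0.
have dF M : M \in F -> #|part j| + th * (4 * th * (2 * l)) <= th * #|M :&: part j|.
  by rewrite inE => /andP[].
have roomy : 4 * th * (2 * l) <= #|part j|.
  by apply: leq_trans (part_size j); rewrite -/z -mlz leq_add2r leq_pmull.
have [Z [ZU cZ ZF]] := sampler th0 t0 cF dF roomy.
exists Z; split=> // [v dv|i di]; apply: ZF; rewrite inE; apply/andP; split=> //.
  by rewrite in_setU (imset_f N) ?in_setT.
by rewrite in_setU (imset_f X) ?in_setT ?orbT.
Qed.

Lemma absorb_all : exists2 P : {set V}, tileable tile P & #|~: P| <= c * (k - 1).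
Proof.
have k0 : 0 < k by move: k3; clear; lia.
have [Zs ZsP] := boolp.choice reservoir.
pose Z := \bigcup_j Zs j.
have Zpart j : Z :&: part j = Zs j.
  apply/setP=> x; rewrite inE; apply/andP/idP => [[/bigcupP[i _ xi]]|xj].
    have [/subsetP/(_ x xi) + _ _ _] := ZsP i.
    by rewrite !inE => /eqP-> /eqP <-.
  split; first by apply/bigcupP; exists j.
  by have [/subsetP/(_ x xj)] := ZsP j.
have cZ j : #|Z :&: part j| = m + l by rewrite Zpart mlz; case: (ZsP j).
have m0 : 0 < m by apply: leq_trans ml.
have wb : b * (4 * m + l) + (3 * (k * (2 * c + 2)) + k + 4) * (117 * m) * b <= w.
  by rewrite /w leq_add // ?leq_mul2r ?leq_mul2l bc orbT.
have [A [ZA cA absA]] := absorber gad m0 ml cZ part_size wb.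
have [P0 [P0A tP0 cL0]] : exists P0 : {set V},
    [/\ P0 \subset ~: A, tileable tile P0 & #|~: A :\: P0| <= 2 * q * k * (a + k)].
  case: alt => [tiles|ck].
    have [P0 [P0A tP0 cP0]] := greedy_tiling k0 tile_card (~: A) tiles.
    exists P0; split=> //; apply: leq_trans cP0 _.
    by apply: leq_trans (leq_addr k _) _; rewrite leq_pmull // !muln_gt0 q0 k0.
  apply: (dense_tiling adj_sym k0 pieces tile_card V0 deg).
    by apply: leq_trans deg_q _; rewrite ck.
  rewrite setCK; apply: leq_trans n6; rewrite leq_mul2l leq_add2r.
  by rewrite cA orbT.
set L0 := ~: A :\: P0 in cL0.
have dL0Z : [disjoint L0 & Z].
  rewrite disjoints_subset; apply/subsetP=> x; rewrite !inE => /andP[_].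
  by apply: contra; apply/subsetP.
have e_small : k.-1 * (k.-1 * #|L0|) <= l by apply: leq_trans n7; rewrite !leq_mul2l cL0 !orbT.
have k10 : 0 < k.-1 by move: k3; clear; lia.
have e_small' : k.-1 * #|L0| <= l by apply: leq_trans e_small; rewrite leq_pmull.
(* Every vertex has [2 * l] neighbours in some reservoir. Covering the leftover consumes at most [l]
   reservoir vertices in total, so more than [a] of these neighbours are always left. *)
have [|U [UZ cU tU]] := cover_vertices pieces dL0Z.
  move=> v _; have [j dj] := dense_nbhd v.
  have [_ _ /(_ v dj) big _] := ZsP j.
  apply: (@leq_trans (2 * l)).
    by rewrite mul2n -addnn -addSn leq_add.
  by apply: leq_trans big _; rewrite subset_leq_card // setIS //; exact: (bigcup_max j).
pose R0 := Z :\: U.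
pose r j := #|R0 :&: part j| - m.
have cUj j : #|U :&: part j| <= k.-1 * #|L0|.
  by apply: leq_trans cU; rewrite subset_leq_card // subsetIl.
have cR0 j : #|R0 :&: part j| + #|U :&: part j| = m + l.
  rewrite -(cZ j) addnC -(cardsID U (Z :&: part j)) setIDAC; congr (#|pred_of_set _| + _).
  by apply/setP=> x; rewrite !inE; case xU: (x \in U); rewrite ?andbF // (subsetP UZ _ xU) andbT.
have rP j : #|R0 :&: part j| = m + r j /\ l - k.-1 * #|L0| <= r j <= l.
  by rewrite /r; move: (cR0 j) (cUj j) e_small'; clear; lia.
have final (rho : rel 'I_b) : symmetric rho -> (forall i, exists j, rho i j) ->
    (forall i, rho i i) \/ b <= k - 1 ->
    (forall (R : {set V}) i j, R \subset Z -> (forall t, m <= #|R :&: part t|) -> rho i j ->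
      exists T : {set V}, [/\ T \subset R, tile T & forall t, #|T :&: part t| = cost k i j t]) ->
    exists2 P : {set V}, tileable tile P & #|~: P| <= c * (k - 1).
  move=> rho_sym rho_nbr rho_alt moves.
  have [||r' red sumr'] := tokens k3 rho_sym rho_nbr (l := l) (e := k.-1 * #|L0|) (r := r) rho_alt.
  - by rewrite subn1.
  - by move=> j; case: (rP j).
  have [||U' [U'R tU' cU']] := realize moves red (R := R0).
  - exact: subsetDl.
  - by move=> j; case: (rP j).
  pose R1 := R0 :\: U'.
  (* The absorber takes exactly [m] vertices per part; the rest, counted by [r'], is all that stays
     uncovered. *)
  have exR2 j : exists R2 : {set V}, (R2 \subset R1 :&: part j) && (#|R2| == m).
    have [|R2 R2s /eqP cR2] := @subset_of_card _ (R1 :&: part j) m.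
      by rewrite cU' leq_addr.
    by exists R2; rewrite R2s.
  have [R2 R2P] := boolp.choice exR2.
  have R2s j : R2 j \subset R1 :&: part j by case/andP: (R2P j).
  pose R3 := \bigcup_j R2 j.
  have R3R1 : R3 \subset R1.
    by apply/bigcupsP => j _; apply: subset_trans (R2s j) (subsetIl _ _).
  have R3part j : R3 :&: part j = R2 j.
    apply/setP=> x; rewrite inE; apply/andP/idP => [[/bigcupP[i _ xi]]|xj].
      have := subsetP (R2s i) x xi.
      by rewrite !inE => /andP[_ /eqP->] /eqP <-.
    split; first by apply/bigcupP; exists j.
    by have := subsetP (R2s j) x xj; rewrite inE => /andP[].
  have R1R0 : R1 \subset R0 := subsetDl _ _.
  have R0Z : R0 \subset Z := subsetDl _ _.
  have tA : tileable tile ((A :\: Z) :|: R3).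
    apply: absA => [|j]; first by apply: subset_trans R3R1 (subset_trans R1R0 R0Z).
    by rewrite R3part; case/andP: (R2P j) => _ /eqP.
  exists ((P0 :|: (L0 :|: U)) :|: (U' :|: ((A :\: Z) :|: R3))).
    have U'Z : U' \subset Z := subset_trans U'R R0Z.
    have R3Z : R3 \subset Z := subset_trans R3R1 (subset_trans R1R0 R0Z).
    have inA (B : {set V}) : B \subset Z -> [disjoint B & ~: A].
      by move=> BZ; rewrite disjoints_subset setCK (subset_trans BZ).
    have dZ (B D : {set V}) : B \subset U -> D \subset R0 -> [disjoint B & D].
      move=> BU DR; rewrite disjoint_sym disjoints_subset (subset_trans DR) //.
      by rewrite /R0 setDE (subset_trans (subsetIr _ _)) // setCS.
    have dR1 : [disjoint U' & R3].
      rewrite disjoint_sym disjoints_subset (subset_trans R3R1) //.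
      by rewrite /R1 setDE subsetIr.
    have dAZ (B : {set V}) : B \subset Z -> [disjoint B & A :\: Z].
      by move=> BZ; rewrite disjoint_sym disjoints_subset setDE (subset_trans (subsetIr _ _)) ?setCS.
    have L0A : L0 \subset ~: A := subsetDl _ _.
    have AZA : [disjoint A :\: Z & ~: A].
      by rewrite disjoints_subset setCK subsetDl.
    have dPL : [disjoint P0 & L0] by rewrite disjoint_sym disjoints_subset /L0 setDE subsetIr.
    have outA (B D : {set V}) : D \subset ~: A -> [disjoint B & ~: A] -> [disjoint D & B].
      by move=> DA dBA; rewrite disjoint_sym; apply: disjointWr dBA.
    apply: tileableU.
    - have out (D : {set V}) : D \subset ~: A -> [disjoint D & U' :|: (A :\: Z :|: R3)].
        by move=> DA; rewrite disjointUr disjointUr outA ?inA // outA // outA ?inA.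
      rewrite disjointUl out // disjointUl out //= disjointUr disjointUr dAZ //.
      by rewrite dZ // dZ // (subset_trans R3R1 R1R0).
    - by apply: tileableU => //; rewrite disjointUr dPL outA // inA.
    by apply: tileableU => //; rewrite disjointUr dAZ // dR1.
  apply: leq_trans (_ : #|R1 :\: R3| <= _).
    apply/subset_leq_card/subsetP => x; rewrite !inE !negb_or.
    case xA: (x \in A) => /=; last first.
      by case: (x \in P0) => //=; rewrite andbF.
    have xP0 : x \notin P0 by apply/negP => /(subsetP P0A); rewrite inE xA.
    rewrite xP0 /=; case xZ: (x \in Z) => /=; last by rewrite !andbF.
    by case: (x \in U) => //=; case: (x \in U') => //=; case: (x \in R3).
  have -> : #|R1 :\: R3| = \sum_j r' j.
    rewrite -card_parts; apply: eq_bigr => j _.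
    rewrite setIDAC cardsD -setIA [part j :&: R3]setIC setIA (setIidPr R3R1) R3part cU'.
    by case/andP: (R2P j) => _ /eqP->; rewrite addKn.
  by apply: leq_trans sumr' _; rewrite leq_mul2r bc orbT.
have bigR (R : {set V}) j : (forall t, m <= #|R :&: part t|) -> a < #|R :&: part j|.
  by move=> mR; apply: leq_trans (leq_trans al ml) (mR j).
case: alt => [tiles|ck].
  (* A tile inside a single part is the move with [i = j]. *)
  apply: (final (fun i j => i == j)).
  - by move=> i j; rewrite eq_sym.
  - by move=> i; exists i.
  - by left=> i /=.
  move=> R i _ RZ mR /eqP <-; have [K KR tK] := tiles _ (bigR R i mR).
  exists K; split=> //; first exact: subset_trans KR (subsetIl _ _).
  move=> t; have Ki : K \subset part i by apply: subset_trans KR (subsetIr _ _).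
  rewrite /cost; have [->|ti] := eqVneq t i.
    by rewrite (setIidPl Ki) (tile_card tK) muln1; move: k3; clear; lia.
  rewrite muln0; apply/eqP; rewrite cards_eq0 setI_eq0 disjoints_subset.
  by apply: subset_trans Ki _; apply/subsetP=> x; rewrite !inE => /eqP->; rewrite eq_sym.
(* A part need not be linked to itself here, so the game relies on [b <= c = k - 1]. *)
apply: (final linked linked_sym linked_nbr); first by right; rewrite -ck addnK.
move=> R i j RZ mR lij.
have hit (Y : {set V}) t : 2 * l <= #|Y :&: Zs t| -> l <= #|Y :&: (R :&: part t)|.
  move=> big; have RZt : R :&: part t \subset Zs t by rewrite -Zpart setSI.
  have : #|Zs t :\: (R :&: part t)| <= l.
    by rewrite cardsDS // -Zpart cZ; move: (mR t); clear; lia.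
  have : #|Y :&: Zs t| <= #|Y :&: (R :&: part t)| + #|Zs t :\: (R :&: part t)|.
    rewrite -(cardsID (R :&: part t) (Y :&: Zs t)) leq_add // subset_leq_card //.
      by apply/subsetP => u; rewrite !inE => /andP[/andP[-> _] ->].
    by apply/subsetP => u; rewrite !inE => /andP[-> /andP[_ ->]].
  by move: big; clear; lia.
have [x] : exists x, x \in X j :&: (R :&: part i).
  apply/card_gt0P; apply: leq_trans l0 _; apply: hit.
  by have [_ _ _] := ZsP i; apply; apply: dense_of_linked.
rewrite in_setI => /andP[]; rewrite inE => xj; rewrite in_setI => /andP[xR xi].
have [|S [SN cS tS]] := pieces (U := N x :&: (R :&: part j)).
  apply: leq_trans al _; apply: hit.
  by have [_ _ + _] := ZsP j; apply.
have SNx : S \subset N x := subset_trans SN (subsetIl _ _).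
have SR : S \subset R := subset_trans SN (subset_trans (subsetIr _ _) (subsetIl _ _)).
have Sj : S \subset part j := subset_trans SN (subset_trans (subsetIr _ _) (subsetIr _ _)).
have xS := piece_disjoint adj_irr SNx.
exists (x |: S); split; [by rewrite subUset sub1set xR|exact: tS|].
move=> t; rewrite setIUl cardsU.
have -> : ([set x] :&: part t) :&: (S :&: part t) = set0.
  apply/eqP; rewrite -subset0; apply/subsetP => y; rewrite !inE.
  by case/andP=> /andP[/eqP-> _]; rewrite (negPf xS).
rewrite cards0 subn0 /cost; congr (_ + _).
  move: xi; rewrite inE => /eqP <-; rewrite -setIdE.
  have [->|tx] := eqVneq t (pt x).
    by apply/eqP/cards1P; exists x; apply/setP => y; rewrite !inE; case: eqP => // ->; rewrite eqxx.
  apply/eqP; rewrite cards_eq0 -subset0; apply/subsetP => y; rewrite !inE.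
  by case/andP => /eqP-> /eqP e; rewrite e eqxx in tx.
have [->|tj] := eqVneq t j; first by rewrite (setIidPl Sj) cS muln1 subn1.
rewrite muln0; apply/eqP; rewrite cards_eq0 setI_eq0 disjoints_subset.
by apply: subset_trans Sj _; apply/subsetP=> y; rewrite !inE => /eqP->; rewrite eq_sym.
Qed.
End Partition.

Lemma quasiperfect_tiling : exists2 P : {set V}, tileable tile P & #|~: P| <= c * (k - 1).
Proof.
have k0 : 0 < k by move: k3; clear; lia.
have [b [pt [bc ptbig gad]]] := structure adj_sym adj_irr pieces k0 c0 q0 V0 deg deg_q n1 n2.
exact: absorb_all bc ptbig gad.
Qed.
End Main.

(** With [k], [c], [q] fixed, all sizes are multiples of one scale [l], a small proportion of
    [#|V|]. [M] dominates the coefficients of [l] in the linear requirements; [L] is a lower bound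
    on [l] that takes care of the exponential requirement and of rounding. *)
Lemma tiling_of_pieces (k c q : nat) : 3 <= k -> 0 < c -> 0 < q ->
  exists A M : nat, forall (V : finType) (adj : rel V) (tile : {set V} -> Prop) (d : nat),
    symmetric adj -> irreflexive adj -> M <= #|V| ->
    (forall K : {set V}, tile K -> #|K| = k) ->
    (forall x, d <= #|nbhd adj x|) -> (q + 1) * #|V| <= (c + 1) * q * d ->
    (forall U : {set V}, #|V| <= A * #|U| -> exists S : {set V},
      [/\ S \subset U, #|S| = k.-1 & forall x, S \subset nbhd adj x -> tile (x |: S)]) ->
    (forall U : {set V}, #|V| <= A * #|U| -> exists2 K : {set V}, K \subset U & tile K)
      \/ c + 1 = k ->
  exists2 P : {set V}, tileable tile P & #|~: P| <= c * (k - 1).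
Proof.
move=> k3 c0 q0.
pose th := 4 * (8 * (c + 1) ^ 3 * c).
pose D := 3 * (k * (2 * c + 2)) + k + 4.
pose K0 := 3 * (k * (2 * c + 2) + c + 6) + (k + 3 + 2 * c) * (2 * c + 1) + 2.
pose C1 := (3 * (c + 1)) ^ 4 + 2 * q * (c + 1) ^ 2.
pose W := c * (4 * (8 * th) + 1) + D * (117 * (8 * th)) * c.
pose K1 := k.-1 * (k.-1 * (2 * q * k)).
pose x1 := C1 * (W + K0 + 1).
pose x2 := 2 * (c + 1) ^ 2 * (2 * c * (W + K0) + 2).
pose x3 := th * (8 * th).
pose x4 := 8 * (c + 1) ^ 2 * (4 * (8 * th) + 1).
pose x5 := 2 * q * k * (W + 1).
pose M := x1 + x2 + x3 + x4 + x5 + 1.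
have [M0 M1 [M2 M3] [M4 M5]] : [/\ 0 < M, x1 + 1 <= M, x2 <= M /\ x3 <= M & x4 <= M /\ x5 <= M].
  by rewrite /M; clear M; move: x1 x2 x3 x4 x5; clear; split; try split; lia.
pose L := M + c + K1 * k + 1.
have [L0 LM LK] : [/\ 0 < L, M + c < L & K1 * k <= L].
  by rewrite /L; move: (M + c) (K1 * k); clear; split; lia.
clearbody L M.
have K1E : k.-1 * (k.-1 * (2 * q * k)) = K1 by [].
have K10 : 0 < K1.
  have k1 : 0 < k.-1 by move: k3; clear; lia.
  have k0 : 0 < k by move: k3; clear; lia.
  by rewrite /K1 !muln_gt0 k1 q0 k0.
clearbody K1.
exists (2 * M * (K1 * (k + 1))), (M * L).
move=> V adj tile d adj_sym adj_irr bigV tile_card deg deg_q pieces alt.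
set n := #|V| in bigV deg_q pieces alt.
pose l := n %/ M; pose a := l %/ K1 - k.
have Ll : L <= l by rewrite /l leq_divRL // mulnC.
have l0 : 0 < l by apply: leq_trans Ll.
have Mln : M * l <= n by rewrite mulnC leq_trunc_div.
have nMl : n < M * l.+1 by rewrite mulnC ltn_ceil.
have ak : K1 * (a + k) <= l.
  rewrite /a subnK; first by rewrite mulnC leq_trunc_div.
  by rewrite leq_divRL //; apply: leq_trans Ll; rewrite mulnC.
have al : a <= l.
  by apply: leq_trans ak; apply: leq_trans (leq_addr k a) _; rewrite leq_pmull.
have big (U : {set V}) : a < #|U| -> n <= 2 * M * (K1 * (k + 1)) * #|U|.
  move=> aU; apply: leq_trans (ltnW nMl) _.
  apply: leq_trans (_ : M * (2 * l) <= _); first by rewrite leq_mul2l; move: l0; clear; lia.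
  have : l <= K1 * (a + k).+1.
    have e : (a + k).+1 = (l %/ K1).+1 \/ (l %/ K1) < k by rewrite /a; move: (_ %/ _); clear; lia.
    case: e => [->|lt]; first by rewrite mulnC ltnW // ltn_ceil.
    have := leq_trans LK Ll; by rewrite mulnC -leq_divRL // leqNgt lt.
  have : K1 * (a + k).+1 <= K1 * ((k + 1) * #|U|).
    rewrite leq_mul2l; apply/orP; right; apply: leq_trans (leq_mul (leqnn _) aU).
    by clear; nia.
  move=> h1 h2; have h3 := leq_trans h2 h1.
  by rewrite [2 * M]mulnC -!mulnA leq_mul2l leq_mul2l h3 !orbT.
pose z := 4 * th * (2 * l); pose m := z - l.
have mz : m <= 8 * th * l by apply: leq_trans (leq_subr _ _) _; rewrite /z; move: (th) (l) => u v; clear; lia.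
have ml4 : 4 * m + l <= (4 * (8 * th) + 1) * l.
  by rewrite mulnDl mul1n leq_add2r -mulnA leq_mul2l mz orbT.
have wW : c * (4 * m + l) + D * (117 * m) * c <= W * l.
  rewrite /W mulnDl leq_add //; first by rewrite -mulnA leq_mul2l ml4 orbT.
  move: (leq_mul (leqnn (D * 117 * c)) mz); move: (D) (m) (th) (l) => x y u v.
  by clear; lia.
set w := c * (4 * m + l) + _ in wW.
have wK : w + K0 <= (W + K0) * l by rewrite mulnDl leq_add // leq_pmulr.
have toM x y : x <= y * l -> y <= M -> x <= n.
  by move=> xy yM; apply: leq_trans xy (leq_trans _ Mln); rewrite leq_mul2r yM orbT.
apply: (@quasiperfect_tiling V adj tile k a c q d l) => //.
- by move=> U aU; apply/pieces/big.
- by rewrite -/n; apply: leq_trans Mln; rewrite muln_gt0 M0.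
- by case: alt => [tiles|]; [left=> U aU; apply/tiles/big|right].
- rewrite -/n -/th -/z -/m -/D -/w -/K0 -/C1.
  apply: leq_trans (_ : (C1 * (W + K0 + 1) + 1) * l <= _).
    rewrite mulnDl mul1n -addn1 leq_add // -mulnA leq_mul2l mulnDl mul1n leq_add ?orbT //.
  exact: toM (leqnn _) M1.
- rewrite -/n -/th -/z -/m -/D -/w -/K0.
  apply: (toM _ x2) => //.
  rewrite -[leqRHS]mulnA leq_mul2l mulnDl leq_add ?orbT // ?leq_pmulr //.
  by rewrite -[leqRHS]mulnA leq_mul2l wK orbT.
- rewrite -/n -/th; apply: (toM _ x3) => //.
  by rewrite /x3; move: (th) (l) => u v; clear; lia.
(* Here [n + c] is at most [(M + c + 1) * (l + 1)], hence at most [(l + 1) ^ 2], and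
   [l + 1 <= 2 ^ l]. *)
- rewrite -/n; have M_L : M + c < l.+1 by rewrite ltnS ltnW // (leq_trans LM).
  have l2 : l.+1 <= 2 ^ l by apply: ltn_expl.
  rewrite mul2n -addnn expnD; apply: leq_trans (leq_mul l2 l2).
  apply: leq_trans (_ : (M + c).+1 * l.+1 <= _); last by rewrite leq_mul2r M_L orbT.
  by move: nMl; rewrite mulSn mulnDl; move: (M * _); clear; nia.
- rewrite -/n -/th -/z -/m.
  apply: (toM _ x4) => //.
  by rewrite -[leqRHS]mulnA leq_mul2l ml4 orbT.
- rewrite -/n -/th -/z -/m -/D -/w.
  apply: (toM _ x5) => //.
  by rewrite -[leqRHS]mulnA leq_mul2l mulnDl mul1n leq_add ?orbT.
by apply: leq_trans ak; rewrite -K1E -!mulnA.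
Qed.

(** * Upper bounds on the threshold *)

Definition hom_on (F G : sgraph) (D : {set F}) (f : F -> G) :=
  {in D &, injective f} /\ {in D &, forall x y, adj x y -> adj (f x) (f y)}.

Section MinDegree.
Variable G : sgraph.
Local Notation N := (nbhd (@adj G)).

Definition independent (I : {set G}) := forall x y, x \in I -> y \in I -> ~~ adj x y.

(** A vertex with fewer than [k] neighbours in [U] joins the independent set and is removed with
    these neighbours, at a loss of at most [k] vertices. *)
Lemma core_or_independent (k : nat) (U : {set G}) : 0 < k ->
  (exists U0 : {set G}, [/\ U0 \subset U, U0 != set0 &
     forall x, x \in U0 -> k <= #|N x :&: U0|]) \/
  (exists I : {set G}, [/\ I \subset U, independent I & #|U| <= k * #|I|]).
Proof.
move=> k0; have [s] := ubnP #|U|; elim: s U => // s IH U leU.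
have [->|U0] := eqVneq U set0.
  by right; exists set0; split; rewrite ?cards0 // => x y; rewrite inE.
have [/exists_inP[v vU lt]|] := boolP [exists v in U, #|N v :&: U| < k]; last first.
  rewrite negb_exists_in => /forall_inP big; left; exists U; split=> // x xU.
  by rewrite leqNgt big.
pose W := v |: (N v :&: U); have WU : W \subset U by rewrite subUset sub1set vU subsetIr.
have cW : #|W| <= k by rewrite cardsU1; move: lt; case: (_ \notin _) => /=; clear; lia.
have W0 : 0 < #|W| by apply/card_gt0P; exists v; rewrite setU11.
have cUW : #|U :\: W| = #|U| - #|W| by rewrite cardsDS.
have cWU := subset_leq_card WU.
have [|[U1 [U1s U10 U1d]]|[I [IU indI cI]]] := IH (U :\: W).
- by rewrite cUW; move: leU W0 cWU; clear; lia.
- by left; exists U1; split=> //; apply: subset_trans U1s (subsetDl _ _).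
have vI x : x \in I -> ~~ adj v x.
  move=> /(subsetP IU); rewrite !inE => /andP[+ xU]; rewrite negb_or xU andbT.
  by case/andP.
right; exists (v |: I); split.
- by rewrite subUset sub1set vU (subset_trans IU) ?subsetDl.
- move=> x y; rewrite !in_setU1 => /orP[/eqP->|xI] /orP[/eqP->|yI].
  + by rewrite adj_irrefl.
  + exact: vI.
  + by rewrite adj_sym vI.
  exact: indI.
rewrite cardsU1 (_ : v \notin I); last first.
  by apply/negP => /(subsetP IU); rewrite !inE eqxx.
by rewrite mulnDr muln1; move: cI; rewrite cUW; move: (k * _) cW; clear; lia.
Qed.
End MinDegree.

(** * Degenerate graphs, forests and cycles *)

Section Degenerate.
Variable F : sgraph.

Fixpoint degenerate (s : seq F) :=
  if s is x :: s' then [&& x \notin s', count (adj x) s' <= 1 & degenerate s'] else true.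

Lemma degenerate_enum (D0 : {set F}) :
    (forall D : {set F}, D \subset D0 -> D != set0 ->
      exists2 x, x \in D & #|nbhd (@adj F) x :&: D| <= 1) ->
  exists2 s, degenerate s & D0 =i s.
Proof.
have [n] := ubnP #|D0|; elim: n D0 => // n IH D0 leD low.
have [->|D0n] := eqVneq D0 set0; first by exists [::] => // x; rewrite inE.
have [x xD lowx] := low D0 (subxx _) D0n.
have [||s ds sD] := IH (D0 :\ x).
- by move: leD; rewrite (cardsD1 x) xD; clear; lia.
- by move=> D DD; apply: low; apply: subset_trans DD (subsetDl _ _).
have xs : x \notin s by rewrite -sD !inE eqxx.
exists (x :: s); last first.
  by move=> y; rewrite inE -sD !inE; case: eqP => // ->.
rewrite /= xs ds andbT; apply: leq_trans lowx.
have us : uniq s by elim: s ds {sD xs} => //= y s IHs /and3P[-> _ /IHs].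
rewrite -size_filter -(card_uniqP _) ?filter_uniq //.
apply/subset_leq_card/subsetP => y; rewrite mem_filter !inE -sD !inE.
by case/andP=> -> /andP[].
Qed.

(** The list is embedded from its end: each vertex has at most one neighbour already placed, whose
    image still has an unoccupied neighbour in [U]. *)
Lemma degenerate_embedding (G : sgraph) (s : seq F) (U : {set G}) :
    degenerate s -> U != set0 ->
    (forall x, x \in U -> size s <= #|nbhd (@adj G) x :&: U|) ->
  exists2 f : F -> G, hom_on [set x in s] f & forall x, x \in s -> f x \in U.
Proof.
move=> + /set0Pn[u0 u0U]; elim: s => [_ _|x s IH /= /and3P[xs cx ds] degU].
  by exists (fun=> u0) => //; split=> x y; rewrite inE.
have [|f [injf homf] fU] := IH ds.
  by move=> u uU; apply: leq_trans (degU u uU).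
have avoid (B : {set G}) : size s < #|B| -> exists2 z, z \in B & forall y, y \in s -> f y != z.
  move=> big; have : 0 < #|B :\: [set z in map f s]|.
    have := cardsID [set z in map f s] B.
    have : #|B :&: [set z in map f s]| <= size s.
      apply: leq_trans (subset_leq_card (subsetIr _ _)) _.
      by rewrite cardsE (leq_trans (card_size _)) ?size_map.
    by move: big; clear; lia.
  case/card_gt0P=> z; rewrite !inE => /andP[zs zB]; exists z => // y ys.
  by apply: contraNneq zs => <-; apply: map_f.
have [z zU [zs zadj]] : exists2 z, z \in U &
    (forall y, y \in s -> f y != z) /\ forall y, y \in s -> adj x y -> adj z (f y).
  have [/hasP[y ys xy]|/hasPn none] := boolP (has (adj x) s).
    have [|z zB zs] := avoid (nbhd (@adj G) (f y) :&: U); first exact: degU (fU y ys).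
    move: zB; rewrite !inE => /andP[fz zU]; exists z => //; split=> // y' y's xy'.
    suff -> : y' = y by rewrite adj_sym.
    apply/eqP; apply: contraTT cx => yy'; rewrite -ltnNge -size_filter.
    apply: (@uniq_leq_size _ [:: y'; y]); first by rewrite /= inE yy'.
    by move=> v; rewrite !inE mem_filter => /orP[]/eqP->; rewrite ?xy ?xy' ?ys ?y's.
  have [|z zU zs] := avoid U; last by exists z => //; split=> // y /none/negPf->.
  by apply: leq_trans (degU u0 u0U) _; rewrite subset_leq_card // subsetIr.
pose g y := if y == x then z else f y.
have gs y : y \in s -> g y = f y.
  by move=> ys; rewrite /g; case: eqP => // yx; rewrite -yx ys in xs.
have gx : g x = z by rewrite /g eqxx.
exists g; last first.
  by move=> y; rewrite inE => /orP[/eqP->|ys]; [rewrite gx|rewrite gs // fU].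
split=> y y'; rewrite !inE => /orP[/eqP->|ys] /orP[/eqP->|y's]; rewrite ?gx ?gs //.
- by move=> e; move: (zs y' y's); rewrite -e eqxx.
- by move=> e; move: (zs y ys); rewrite e eqxx.
- by move=> e; apply: injf; rewrite ?inE.
- by rewrite adj_irrefl.
- exact: zadj.
- by rewrite adj_sym => /(zadj y ys); rewrite adj_sym.
- by move=> e; apply: homf; rewrite ?inE.
Qed.

(** All neighbours in [D] of the first vertex of a longest path in [D] lie on that path, and one of
    them other than the second vertex closes a cycle. *)
Lemma cycle_of_min_degree (D : {set F}) : D != set0 ->
    (forall x, x \in D -> 1 < #|nbhd (@adj F) x :&: D|) ->
  exists2 m, 3 <= m & has_copy (cycle_graph m) F.
Proof.
move=> /set0Pn[x0 x0D] deg2.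
pose P n := [exists t : n.-tuple F, [&& uniq t, sorted (@adj F) t & all (mem D) t]].
have exP : exists n, P n.
  by exists 1; apply/existsP; exists [tuple x0]; rewrite /= andbT.
have ubP n : P n -> n <= #|F|.
  case/existsP=> t /and3P[ut _ _]; rewrite -(size_tuple t) -(card_uniqP ut).
  exact: max_card.
case: (ex_maxnP exP ubP) => n /existsP[t /and3P[ut st Dt]] maxn.
have tn : size t = n := size_tuple t.
have n1 : 0 < n by apply: maxn; apply/existsP; exists [tuple x0]; rewrite /= andbT.
case: t tn ut st Dt => [[|x p] /= tn']; first by move=> e; rewrite -e in n1.
move=> tn /andP[xp up] st /andP[xD pD].
have nbr y : adj x y -> y \in D -> y \in p.
  move=> xy yD; apply: contraT => yp.
  have yx : y != x by apply: contraTneq xy => ->; rewrite adj_irrefl.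
  have : P n.+1.
    have szt : size (y :: x :: p) == n.+1 by rewrite /= tn.
    apply/existsP; exists (Tuple szt) => /=; rewrite xp up yD xD pD inE negb_or yx yp.
    by rewrite adj_sym xy st.
  by move/maxn; rewrite ltnn.
have [y [yp xy yn1]] : exists y, [/\ y \in p, adj x y & y != head x p].
  have : 0 < #|(nbhd (@adj F) x :&: D) :\ head x p|.
    have := deg2 x xD; rewrite (cardsD1 (head x p)).
    by case: (_ \in _) => /=; clear; lia.
  case/card_gt0P=> y; rewrite !inE => /and3P[yh xy yD].
  by exists y; split=> //; apply: nbr.
pose i := index y p; have ip : i < size p by rewrite index_mem.
have i1 : 0 < i.
  rewrite lt0n; apply: contra yn1 => /eqP i0.
  by rewrite -(nth_index x yp) -/i i0 nth0.
exists i.+2; first by [].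
pose f := [ffun j : 'I_i.+2 => nth x (x :: p) j].
have step j : j < i.+1 -> adj (nth x (x :: p) j) (nth x (x :: p) j.+1).
  by move=> ji; apply: (pathP x st); apply: leq_trans ip.
have close : adj (nth x (x :: p) i.+1) x by rewrite /= nth_index // adj_sym.
apply/existsP; exists f; apply/andP; split.
  apply/injectiveP => j1 j2; rewrite !ffunE => /eqP; rewrite nth_uniq /=.
  - by move/eqP/val_inj.
  - by apply: leq_trans (ltn_ord j1) _; rewrite ltnS.
  - by apply: leq_trans (ltn_ord j2) _; rewrite ltnS.
  by rewrite xp.
have succ j : adj (f j) (f (ordS j)).
  rewrite !ffunE /=; have := ltn_ord j; rewrite ltnS leq_eqVlt => /orP[/eqP->|lt].
    by rewrite modnn.
  by rewrite modn_small ?ltnS //; apply: step.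
apply/forallP => j1; apply/forallP => j2; apply/implyP => /andP[_ /orP[]/eqP->].
  exact: succ.
by rewrite adj_sym succ.
Qed.

Lemma acyclic_low_degree (D : {set F}) : acyclic F -> D != set0 ->
  exists2 x, x \in D & #|nbhd (@adj F) x :&: D| <= 1.
Proof.
move=> acyc D0.
have [/exists_inP[x xD lowx]|] := boolP [exists x in D, #|nbhd (@adj F) x :&: D| <= 1].
  by exists x.
rewrite negb_exists_in => /forall_inP high.
have [|m m3 copy] := cycle_of_min_degree D0; last by have := acyc m m3; rewrite copy.
by move=> x /high; rewrite ltnNge.
Qed.
End Degenerate.

(** Without the vertex 0 the cycle is an increasing path, in which the largest member of [D] can
    only have its predecessor as a neighbour. *)
Lemma cycle_low_degree k (v0 : 'I_k) (D : {set cycle_graph k}) :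
    val v0 = 0 -> D \subset ~: [set v0 : cycle_graph k] -> D != set0 ->
  exists2 x, x \in D & #|nbhd (@adj (cycle_graph k)) x :&: D| <= 1.
Proof.
move=> v00 Dv0 /set0Pn[x0 x0D].
case: (@arg_maxnP _ x0 (mem D) (@nat_of_ord k) x0D) => x xD maxx.
exists x => //; rewrite leqNgt; apply/negP => /card_gt1P[y [z [+ + yz]]].
have pred_x u : u \in nbhd (@adj (cycle_graph k)) x :&: D -> val x = (val u).+1.
  rewrite !inE => /andP[/andP[xu ux] uD].
  have u0 : 0 < val u.
    have := subsetP Dv0 u uD; rewrite !inE lt0n; apply: contra => /eqP e.
    by apply/eqP/val_inj; rewrite e v00.
  have ux_le : val u <= val x := maxx u uD.
  have ltux : val u < val x.
    by rewrite ltn_neqAle ux_le andbT; apply: contra xu => /eqP/val_inj->.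
  case/orP: ux => /eqP/(congr1 val) /=.
    have := ltn_ord x; rewrite leq_eqVlt => /orP[/eqP->|lt].
      by rewrite modnn => e; move: u0; rewrite (e : val u = 0).
    by rewrite modn_small // => e; move: ltux; rewrite (e : val u = x.+1) ltnNge leqnSn.
  by rewrite modn_small //; apply: leq_ltn_trans ltux (ltn_ord x).
move=> /pred_x e1 /pred_x e2; case/negP: yz; apply/eqP/val_inj.
by move: e1; rewrite e2 => -[].
Qed.

(** * Copies of [F] forced in large sets *)

Section Copies.
Variables F G : sgraph.

Definition copy_tile (K : {set G}) :=
  exists2 f : {ffun F -> G}, is_copy f & K = [set f x | x : F].

Lemma tileable_tiling (P : {set G}) : 0 < #|F| -> tileable copy_tile P ->
  exists2 T : {set {ffun F -> G}}, is_tiling T & covered T = P.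
Proof.
move=> F0; elim=> [|A B [f fc ->] dAB _ [T [Tc Td] TA]].
  by exists set0; [split=> f; rewrite inE|rewrite /covered big_set0].
exists (f |: T); last first.
  by rewrite /covered bigcup_setU big_set1 -/(covered T) TA.
have dT g : g \in T -> [disjoint [set f x | x : F] & [set g x | x : F]].
  by move=> gT; apply: disjointWr dAB; rewrite -TA; exact: (bigcup_max g).
split=> [g|g h]; first by rewrite in_setU1 => /orP[/eqP->|/Tc].
rewrite !in_setU1 => /orP[/eqP->|gT] /orP[/eqP->|hT].
- by rewrite eqxx.
- by move=> _; apply: dT.
- by move=> _; rewrite disjoint_sym; apply: dT.
exact: Td.
Qed.

Lemma copy_tile_card K : copy_tile K -> #|K| = #|F|.
Proof.
case=> f /andP[/injectiveP injf _] ->.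
by rewrite card_imset.
Qed.

Lemma copy_tile_hom (f : F -> G) : hom_on [set: F] f -> copy_tile [set f x | x : F].
Proof.
case=> injf homf; exists [ffun x => f x]; last by apply: eq_imset => x; rewrite ffunE.
apply/andP; split.
  by apply/injectiveP => x y; rewrite !ffunE; apply: injf.
by apply/forallP=> x; apply/forallP=> y; apply/implyP => xy; rewrite !ffunE; apply: homf.
Qed.

(** A vertex adjacent to an entire copy of [F] minus [v0] can play [v0], whatever the neighbours of
    [v0] are; this is what makes vertices exchangeable. *)
Lemma copy_tile_extend (v0 : F) (f : F -> G) x :
    hom_on (~: [set v0]) f -> [set f y | y in ~: [set v0]] \subset nbhd (@adj G) x ->
  copy_tile (x |: [set f y | y in ~: [set v0]]).
Proof.
move=> [injf homf] /subsetP sub; pose g y := if y == v0 then x else f y.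
have xf y : y != v0 -> adj x (f y).
  by move=> yv; have := sub (f y); rewrite inE; apply; apply: imset_f; rewrite !inE.
have -> : x |: [set f y | y in ~: [set v0]] = [set g y | y : F].
  apply/setP=> z; apply/setU1P/imsetP => [[->|/imsetP[y]]|[y _ ->]].
  - by exists v0; rewrite // /g eqxx.
  - by rewrite !inE => yv ->; exists y; rewrite // /g (negPf yv).
  rewrite /g; case: (eqVneq y v0) => yv; [by left|right].
  by apply: imset_f; rewrite !inE.
apply: copy_tile_hom; split=> y z _ _; rewrite /g.
  case: (eqVneq y v0) => [->|yv]; case: (eqVneq z v0) => [->|zv] //.
  - by move=> e; have := xf z zv; rewrite -e adj_irrefl.
  - by move=> e; have := xf y yv; rewrite e adj_irrefl.
  by apply: injf; rewrite !inE.
case: (eqVneq y v0) => [->|yv]; case: (eqVneq z v0) => [->|zv].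
- by rewrite adj_irrefl.
- by move=> _; apply: xf.
- by move=> _; rewrite adj_sym; apply: xf.
by apply: homf; rewrite !inE.
Qed.
End Copies.

(** The constant [C] is uniform in [G], so when [alphar r G] is a small enough proportion of [#|G|]
    every set of linear size contains the pattern. *)
Definition forces (r : nat) (F : sgraph) (D : {set F}) := exists C : nat,
  forall (G : sgraph) (U : {set G}), C * alphar r G < #|U| ->
  exists2 f : F -> G, hom_on D f & forall x, x \in D -> f x \in U.

Lemma clique_of_alphar (r : nat) (G : sgraph) (U : {set G}) : alphar r G < #|U| ->
  exists g : 'I_r -> G, [/\ injective g, forall i j, i != j -> adj (g i) (g j) &
    forall i, g i \in U].
Proof.
move=> ltU; have : has_copy (complete_graph r) (induced U).
  apply: contraLR ltU => nc; rewrite -leqNgt.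
  exact: (@leq_bigmax_cond _ (fun U => ~~ has_copy (complete_graph r) (induced U)) (fun U => #|U|)).
case/existsP=> f /andP[/injectiveP injf /forallP homf].
exists (fun i => val (f i)); split=> [i j /val_inj/injf //|i j ij|i]; last exact: valP.
by have /forallP/(_ j)/implyP := homf i; apply.
Qed.

Lemma forces_clique r (F : sgraph) (D : {set F}) : #|D| <= r -> forces r D.
Proof.
move=> Dr; exists 1 => G U; rewrite mul1n => ltU; have [g [injg homg gU]] := clique_of_alphar ltU.
have [u0 u0U] : exists u0, u0 \in U by apply/card_gt0P; apply: leq_ltn_trans ltU.
pose f y := if insub (index y (enum D)) is Some i then g i else u0.
have fD y : y \in D -> exists2 i : 'I_r, val i = index y (enum D) & f y = g i.
  move=> yD; have lt : index y (enum D) < r.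
    by apply: leq_trans Dr; rewrite cardE index_mem mem_enum.
  by exists (Ordinal lt); rewrite // /f insubT.
have index_inj y z : y \in D -> z \in D -> index y (enum D) = index z (enum D) -> y = z.
  move=> yD zD e; rewrite -(nth_index y (_ : y \in enum D)) ?mem_enum //.
  by rewrite e nth_index ?mem_enum.
exists f; last by move=> y /fD[i _ ->].
split=> y z yD zD.
  have [i ei ->] := fD y yD; have [j ej ->] := fD z zD => /injg eij.
  by apply: index_inj; rewrite // -ei -ej eij.
have [i ei ->] := fD y yD; have [j ej ->] := fD z zD => yz; apply: homg.
apply: contraTneq yz => eij; have -> : y = z by apply: index_inj; rewrite // -ei -ej eij.
by rewrite adj_irrefl.
Qed.

(** Independent sets have at most [alphar 2 G] vertices, so a set that is large compared with this
    has a subset of large minimum degree, where the greedy embedding works. *)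
Lemma forces_degenerate (F : sgraph) (D : {set F}) :
    (forall D' : {set F}, D' \subset D -> D' != set0 ->
      exists2 x, x \in D' & #|nbhd (@adj F) x :&: D'| <= 1) ->
  forces 2 D.
Proof.
move=> low; have [s ds Ds] := degenerate_enum low.
exists (size s).+1 => G U bigU.
have indep (I : {set G}) : independent I -> #|I| <= alphar 2 G.
  move=> indI; apply: (@leq_bigmax_cond _ (fun U => ~~ has_copy (complete_graph 2) (induced U))
    (fun U => #|U|)); apply/existsP => -[f /andP[_ /forallP homf]].
  have /forallP/(_ ord_max)/implyP/(_ isT) := homf ord0.
  by apply/negP; apply: indI; apply: valP.
case: (core_or_independent U (ltn0Sn (size s))) => [[U0 [U0U U00 degU0]]|[I [IU indI cI]]].
  have [|f homf fU] := degenerate_embedding ds U00.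
    by move=> x /degU0; apply: ltnW.
  exists f; last by move=> x; rewrite Ds => /fU/(subsetP U0U).
  have -> : D = [set x in s] by apply/setP=> x; rewrite inE Ds.
  exact: homf.
move: bigU; rewrite ltnNge (leq_trans cI) // leq_mul2l indep ?orbT //.
Qed.

Lemma bigmin_leq (I : eqType) (s : seq I) (P : pred I) (F : I -> nat) m x :
  x \in s -> P x -> \big[minn/m]_(y <- s | P y) F y <= F x.
Proof.
elim: s => //= y s IH; rewrite inE big_cons => /orP[/eqP<-|xs] Px.
  by rewrite Px geq_minl.
by case: ifP => _; rewrite ?geq_min ?IH ?orbT.
Qed.

Lemma min_degree_leq (G : sgraph) (x : G) : min_degree G <= #|nbhd (@adj G) x|.
Proof.
have /leq_trans : min_degree G <= degree x by apply: bigmin_leq; rewrite ?mem_index_enum.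
apply.
by apply/subset_leq_card/subsetP => y; rewrite !inE.
Qed.

Local Open Scope ring_scope.

(** * From tilings to bounds on the threshold *)

Section Upper.
Variables (R : realType) (r : nat) (F : sgraph) (v0 : F).
Hypotheses (F3 : (3 <= #|F|)%N) (forced : forces r (~: [set v0])).

Lemma tiling_of_degree (eta : R) (c : nat) :
    0 < eta -> Num.floor (1 / eta) = c%:Z -> (0 < c)%N ->
    forces r [set: F] \/ (c + 1)%N = #|F| ->
  exists2 alpha : R, 0 < alpha & exists N : nat, forall G : sgraph, (N <= #|G|)%N ->
    eta * #|G|%:R <= (min_degree G)%:R -> (alphar r G)%:R <= alpha * #|G|%:R ->
    has_quasiperfect_tiling eta F G.
Proof.
move=> eta0 floor_c c0 alt.
(* [eta] exceeds [1 / (c + 1)], and [q] records the excess in integers as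
   [(c + 1) * eta >= 1 + 1 / q]. *)
have [q q0 qP] : exists2 q : nat, (0 < q)%N & (q + 1)%N%:R <= ((c + 1) * q)%N%:R * eta.
  have c1 : 0 < (c + 1)%:R * eta - 1.
    have := floorD1_gt (1 / eta); rewrite floor_c intrD ltr_pdivrMr //.
    by rewrite subr_gt0 natrD.
  set x := _ - 1 in c1.
  have [q ltq] : exists q : nat, x^-1 < q%:R.
    by exists (Num.bound x^-1); apply: archi_boundP; rewrite invr_ge0 ltW.
  exists q; first by rewrite -(ltr0n R); apply: lt_trans ltq; rewrite invr_gt0.
  have : 1 <= x * q%:R by rewrite -ler_pdivrMl // mulr1 ltW.
  rewrite /x mulrBl mul1r natrD natrM; lra.
have [A [M tiling]] := tiling_of_pieces F3 c0 q0.
have [C1 forced1] := forced.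
have [C2 forced2] : exists C2, (c + 1)%N = #|F| \/ forall (G : sgraph) (U : {set G}),
    (C2 * alphar r G < #|U|)%N -> exists2 f : F -> G, hom_on [set: F] f & forall x, f x \in U.
  case: alt => [[C2 f2]|]; last by exists 0%N; left.
  by exists C2; right=> G U /f2[f hf fU]; exists f => // x; apply: fU; rewrite inE.
(* Pieces and tiles are sought in sets of at least [#|G| / A] vertices; with [alpha = 1 / C] these
   exceed both [C1] and [C2] times [alphar r G]. *)
pose C := (A * (C1 + C2) + 1)%N.
have C0 : 0 < C%:R :> R by rewrite ltr0n /C addn1.
exists C%:R^-1; first by rewrite invr_gt0.
exists (M + 1)%N => G GM degG alphaG.
have n0 : (0 < #|G|)%N by apply: leq_trans GM; rewrite addn1.
have alphaN : (C * alphar r G <= #|G|)%N.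
  by rewrite -(ler_nat R) natrM -ler_pdivlMl.
have large (U : {set G}) C' : (C' <= C1 + C2)%N -> (#|G| <= A * #|U|)%N ->
    (C' * alphar r G < #|U|)%N.
  move=> leC GU; rewrite ltnNge; apply/negP => leU.
  have := leq_trans GU (leq_mul (leqnn A) leU).
  have : (A * (C' * alphar r G) <= A * ((C1 + C2) * alphar r G))%N.
    by rewrite leq_mul2l leq_mul2r leC !orbT.
  move: alphaN n0; rewrite /C mulnDl mul1n -mulnA.
  have [-> |] := posnP (alphar r G); first by rewrite !muln0; clear; lia.
  move: (A * (C' * _))%N (A * ((C1 + C2) * _))%N; clear; lia.
have [||||||U GU||P tP cP] := tiling G (@adj G) (@copy_tile F G) (min_degree G).
- exact: adj_sym.
- exact: adj_irrefl.
- by apply: leq_trans GM; rewrite leq_addr.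
- exact: copy_tile_card.
- exact: min_degree_leq.
- have : (q + 1)%N%:R * #|G|%:R <= ((c + 1) * q)%N%:R * (min_degree G)%:R :> R.
    apply: le_trans (ler_wpM2r (ler0n _ _) qP) _.
    by rewrite -mulrA ler_wpM2l.
  by rewrite -!natrM ler_nat.
- have [f [injf homf] fU] := forced1 G U (large U C1 (leq_addr _ _) GU).
  exists [set f y | y in ~: [set v0]]; split.
  + by apply/subsetP=> _ /imsetP[y yv ->]; apply: fU.
  + by rewrite card_in_imset // cardsC1.
  + by move=> x; apply: copy_tile_extend.
- case: forced2 => [|forced2]; [by right|left=> U GU].
  have [f hf fU] := forced2 G U (large U C2 (leq_addl _ _) GU).
  exists [set f x | x : F]; last exact: copy_tile_hom.
  by apply/subsetP=> _ /imsetP[y _ ->].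
have [|T tT TP] := tileable_tiling _ tP; first exact: leq_trans F3.
exists T => //; rewrite /quasiperfect TP floor_c -PoszM lez_nat; exact: cP.
Qed.

(** The threshold is itself admissible, so a single smaller [eta] with guaranteed tilings
    contradicts it; as it is at most 1, only [e <= 1] has to be treated. *)
Lemma RTT_le (b : R) : 0 <= b ->
    (forall e : R, b < e -> e <= 1 -> exists eta : R, 0 < eta < e /\
      exists2 alpha : R, 0 < alpha & exists N : nat, forall G : sgraph, (N <= #|G|)%N ->
        eta * #|G|%:R <= (min_degree G)%:R -> (alphar r G)%:R <= alpha * #|G|%:R ->
        has_quasiperfect_tiling eta F G) ->
  RTT R r F <= b.
Proof.
move=> b0 H; rewrite leNgt; apply/negP => ltb.
have [adm _] := RTT_largest R r F.
have [eta [/andP[eta0 lte] [alpha alpha0 [N tilings]]]] := H _ ltb (RTT_admissible_le1 adm).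
have [N' admN] := (proj2 adm) eta alpha eta0 lte alpha0.
have [G [cG degG alphaG noT]] := admN _ (leq_maxl N' N).
by apply: noT; apply: tilings; rewrite ?cG ?leq_maxr.
Qed.

Lemma RTT_ge0 : 0 <= RTT R r F.
Proof. by have [[]] := RTT_largest R r F. Qed.

Lemma RTT_eq0 : forces r [set: F] -> RTT R r F = 0.
Proof.
move=> forcedT; apply/eqP; rewrite eq_le RTT_ge0 andbT.
apply: RTT_le => // e e0 e1; exists (e / 2).
have eta0 : 0 < e / 2 by rewrite divr_gt0.
split; first by rewrite eta0 ltr_pdivrMr //; lra.
have fl1 : (1 <= Num.floor (1 / (e / 2)))%Z.
  by rewrite Num.Theory.floor_ge_int ler_pdivlMr // mul1r; lra.
have [c floor_c] : exists c : nat, Num.floor (1 / (e / 2)) = c%:Z.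
  by exists `|Num.floor (1 / (e / 2))|%N; rewrite gez0_abs // (le_trans _ fl1).
apply: (tiling_of_degree eta0 floor_c); last by left.
by move: fl1; rewrite floor_c; lia.
Qed.

Lemma RTT_le_inv : RTT R r F <= 1 / #|F|%:R.
Proof.
have k0 : 0 < #|F|%:R :> R by rewrite ltr0n; apply: leq_trans F3.
apply: RTT_le => [|e lte e1]; first by rewrite divr_ge0 // ltW.
set k := #|F| in lte k0 *.
have k1 : 0 < (k - 1)%N%:R :> R by rewrite ltr0n subn_gt0; apply: leq_trans F3.
have kE : k%:R = (k - 1)%N%:R + 1 :> R.
  by rewrite -[1]/(1%:R) -natrD subnK //; apply: leq_trans F3.
(* Strictly between [1 / k] and [1 / (k - 1)] the integer part of [1 / eta] is [k - 1], which gives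
   [c + 1 = #|F|]. *)
have lt1 : 1 / k%:R < Num.min e (1 / (k - 1)%N%:R).
  rewrite lt_min lte ltr_pdivrMr // mulrAC ltr_pdivlMr //; lra.
have [lt2 lt3] := midf_lt lt1; set eta := (_ + _) / _ in lt2 lt3.
have eta0 : 0 < eta by apply: lt_trans lt2; rewrite divr_gt0.
exists eta; split; first by rewrite eta0 (lt_le_trans lt3) // ge_min lexx.
have floor_k : Num.floor (1 / eta) = (k - 1)%N%:Z.
  apply: floor_def; apply/andP; split.
    rewrite ler_pdivlMr // mulrC -ler_pdivlMr //.
    by apply: le_trans (ltW lt3) _; rewrite ge_min lexx orbT.
  rewrite intrD -kE.
  by rewrite ltr_pdivrMr // mulrC -ltr_pdivrMr.
apply: (tiling_of_degree eta0 floor_k); last right.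
  by rewrite subn_gt0; apply: leq_trans F3.
by rewrite subnK //; apply: leq_trans F3.
Qed.
End Upper.

(** * Lower bounds on the threshold *)

Local Open Scope nat_scope.

Section Ball.
Variables (V : finType) (E : rel V).

Fixpoint ball t (x : V) : {set V} :=
  if t is t'.+1 then ball t' x :|: [set y | [exists z in ball t' x, E z y]] else [set x].

Lemma ball_leq t t' x : t <= t' -> ball t x \subset ball t' x.
Proof.
elim: t' => [|t' IH]; first by rewrite leqn0 => /eqP->.
rewrite leq_eqVlt => /orP[/eqP-> //|/IH/subset_trans]; apply; exact: subsetUl.
Qed.

Lemma ball_refl t x : x \in ball t x.
Proof. by apply: (subsetP (ball_leq x (leq0n t))); rewrite inE. Qed.

Lemma ball_step t x y z : y \in ball t x -> E y z -> z \in ball t.+1 x.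
Proof. by move=> yB yz; rewrite !inE; apply/orP; right; apply/exists_inP; exists y. Qed.

Lemma card_ball D t x : (forall z, #|[set y | E z y]| <= D) -> #|ball t x| <= D.+1 ^ t.
Proof.
move=> deg; elim: t => [|t IH]; first by rewrite cards1.
have sub : ball t.+1 x \subset \bigcup_(z in ball t x) (z |: [set y | E z y]).
  apply/subsetP => y; rewrite /= inE => /orP[yB|].
    by apply/bigcupP; exists y; rewrite // setU11.
  by rewrite inE => /exists_inP[z zB zy]; apply/bigcupP; exists z; rewrite // !inE zy orbT.
apply: leq_trans (subset_leq_card sub) (leq_trans (card_bigcup_leq _ _) _).
rewrite expnS mulnC; apply: leq_trans (leq_mul IH (leqnn _)).
rewrite -sum_nat_const; apply: leq_sum => z _.
by apply: leq_trans (leq_card_setU _ _) _; rewrite cards1 add1n ltnS.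
Qed.
End Ball.

(** * Greedy construction of a sparse graph *)

Section Greedy.
Variables (V : finType) (r g s : nat) (Inv : rel V -> Prop).
Local Notation n := #|V|.
Local Notation tup := {ffun 'I_r -> V}.

Definition add_clique (E : rel V) (f : tup) : rel V :=
  fun x y => E x y || [&& x != y, x \in codom f & y \in codom f].

Definition far (E : rel V) (f : tup) := [forall i, forall j, (i != j) ==> (f j \notin ball E g (f i))].

Hypothesis Inv0 : Inv (fun _ _ => false).
Hypothesis Inv_add : forall E f, symmetric E -> irreflexive E -> Inv E -> far E f ->
  Inv (add_clique E f).
Hypotheses (r2 : 2 <= r) (s0 : 0 < s).

(** A set of at least [n / s] vertices contains at least a proportion [2 / y] of all [r]-tuples.
    [De] caps the degrees: within [y * (n + 1)] steps at most [n / (2 * y * r)] vertices exceed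
    [De - r], and all others can take one more clique. *)
Let y := 2 * s ^ r.
Let De := 4 * y ^ 2 * r ^ 3 + r.
Hypothesis n_big : 2 * y * r ^ 2 * De.+1 ^ g <= n.

Let y0 : 0 < y. Proof. by rewrite muln_gt0 expn_gt0 s0. Qed.
Let r0 : 0 < r. Proof. exact: leq_trans r2. Qed.
Let n0 : 0 < n.
Proof.
apply: leq_trans n_big.
have d0 : 0 < De.+1 ^ g by rewrite expn_gt0.
have rr : 0 < r ^ 2 by rewrite expn_gt0 r0.
by move: (De.+1 ^ g) (r ^ 2) (y) d0 rr y0 => u v z u0 v0 z0; rewrite !muln_gt0 z0 v0 u0.
Qed.

Definition clique_in (E : rel V) (I : {set V}) :=
  [exists f : tup, [forall i, f i \in I] && [forall i, forall j, (i != j) ==> E (f i) (f j)]].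

Let alive (E : rel V) := [set I : {set V} | (n <= s * #|I|) && ~~ clique_in E I].

Let deg (E : rel V) x := #|[set z | E x z]|.

Let stage (E : rel V) t :=
  [/\ symmetric E, irreflexive E, Inv E, (forall x, deg E x <= De) &
      \sum_x deg E x <= t * r ^ 2 /\ y ^ t * #|alive E| <= y.-1 ^ t * 2 ^ n].

Let tuples_in (F : 'I_r -> {set V}) : {set tup} :=
  [set f | f \in family (fun i => mem (F i))].

Let mem_tuples F (f : tup) : (f \in tuples_in F) = [forall i, f i \in F i].
Proof. by rewrite inE; apply/familyP/forallP. Qed.

Let card_tuples (F : 'I_r -> {set V}) : #|tuples_in F| = \prod_i #|F i|.
Proof. by rewrite cardsE card_family foldrE big_map big_enum. Qed.

Let card_tuples_const (I : {set V}) : #|tuples_in (fun=> I)| = #|I| ^ r.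
Proof. by rewrite card_tuples prod_nat_const card_ord. Qed.

Let card_tuples1 (i : 'I_r) (S : {set V}) :
  n * #|tuples_in (fun l => if l == i then S else setT)| = #|S| * n ^ r.
Proof.
rewrite card_tuples (bigD1 i) //= eqxx mulnCA; congr (_ * _).
rewrite (eq_bigr (fun=> n)) => [|l /negPf->]; last by rewrite cardsT.
rewrite prod_nat_const -expnS; congr (n ^ _).
have := cardC1 i; rewrite card_ord => e; rewrite -[RHS](prednK r0) -e.
by congr _.+1; apply: eq_card.
Qed.

Let card_tuples2 (i j : 'I_r) (B : V -> {set V}) (m : nat) : i != j ->
    (forall x, #|B x| <= m) ->
  n * #|[set f : tup | f j \in B (f i)]| <= m * n ^ r.
Proof.
move=> ij Bm; pose F x l := if l == i then [set x] else if l == j then B x else setT.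
have sub : [set f : tup | f j \in B (f i)] \subset \bigcup_x tuples_in (F x).
  apply/subsetP => f; rewrite inE => fB; apply/bigcupP; exists (f i) => //.
  rewrite mem_tuples; apply/forallP => l; rewrite /F.
  by case: eqP => [->|_]; [rewrite inE|case: eqP => [->|]; rewrite ?inE].
have cF x : n * (n * #|tuples_in (F x)|) <= m * n ^ r.
  rewrite card_tuples (bigD1 i) //= (bigD1 j) ?(eq_sym j) //= /F eqxx eq_sym (negPf ij) eqxx.
  rewrite cards1 mul1n (eq_bigr (fun=> n)) => [|l /andP[/negPf-> /negPf->]]; last by rewrite cardsT.
  rewrite prod_nat_const; set cc := (X in _ * n ^ X).
  have ccr : cc.+2 <= r.
    have := cardC [pred l | (l == i) || (l == j)]; rewrite card_ord.
    rewrite (eq_card (B := pred2 i j)) // card2 ij => <-; rewrite !add2n !ltnS.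
    by apply: subset_leq_card; apply/subsetP => l; rewrite !inE negb_or.
  have -> : n * (n * (#|B x| * n ^ cc)) = #|B x| * n ^ cc.+2.
    by rewrite !expnS [RHS]mulnCA; congr (_ * _); rewrite mulnCA.
  by apply: leq_mul (Bm x) _; rewrite leq_pexp2l.
rewrite -(leq_pmul2l n0); apply: leq_trans (_ : \sum_x n * (n * #|tuples_in (F x)|) <= _).
  rewrite -!big_distrr /= !leq_mul2l (leq_trans (subset_leq_card sub)) ?orbT //.
  exact: card_bigcup_leq.
by rewrite -[leqRHS]sum_nat_const; apply: leq_sum => x _; exact: cF.
Qed.

(* Most tuples have distant entries of small degree, so averaging over them
   yields one lying inside a proportion [1 / y] of the sets still alive. *)
Let step E t : t < y * n.+1 -> stage E t -> exists E', stage E' t.+1.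
Proof.
move=> lt [Esym Eirr EInv Edeg [Esum Ealive]].
have [dead|alive0] := posnP #|alive E|.
  exists E; split=> //; split; first by apply: leq_trans Esum _; rewrite leq_mul2r leqnSn orbT.
  by rewrite dead muln0.
pose Sat := [set x | De - r < deg E x].
have satP : 2 * y * r * #|Sat| <= n.
  have le1 : #|Sat| * (De - r) <= \sum_x deg E x.
    rewrite -sum_nat_const big_mkcond; apply: leq_sum => x _; rewrite inE.
    by case: ifP => // /ltnW.
  have le2 : #|Sat| * (4 * y ^ 2 * r ^ 3) <= 2 * y * n * r ^ 2.
    have -> : 4 * y ^ 2 * r ^ 3 = De - r by rewrite /De addnK.
    apply: leq_trans le1 (leq_trans Esum _); rewrite leq_mul2r; apply/orP; right.
    apply: leq_trans (ltnW lt) _; rewrite -mulnA mulnCA leq_mul2l; apply/orP; right.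
    by move: n0; clear; lia.
  have p0 : 0 < 2 * y * r ^ 2.
    have rr : 0 < r ^ 2 by rewrite expn_gt0 r0.
    by move: (r ^ 2) (y) rr y0 => v z v0 z0; rewrite !muln_gt0 z0 v0.
  rewrite -(leq_pmul2l p0) mulnC.
  have -> : 2 * y * r * #|Sat| * (2 * y * r ^ 2) = #|Sat| * (4 * y ^ 2 * r ^ 3).
    by move: (y) (#|Sat|); clear => z x; rewrite !expnS !expn0; lia.
  by apply: leq_trans le2 _; rewrite mulnAC.
(* Tuples with a saturated entry and tuples with two close entries each amount to at most
   [1 / (2 * y)] of all tuples, so every set still alive keeps a proportion [1 / y] of good ones. *)
pose bad := (\bigcup_i tuples_in (fun l => if l == i then Sat else setT)) :|:
  \bigcup_(ij : 'I_r * 'I_r | ij.1 != ij.2) [set f : tup | f ij.2 \in ball E g (f ij.1)].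
have badP : y * #|bad| <= n ^ r.
  rewrite -(leq_pmul2l n0) -(leq_pmul2l (isT : 0 < 2)).
  have le1 : 2 * y * (n * #|\bigcup_i tuples_in (fun l => if l == i then Sat else setT)|) <= n * n ^ r.
    apply: leq_trans (_ : 2 * y * (\sum_(i < r) #|Sat| * n ^ r) <= _).
      rewrite leq_mul2l; apply/orP; right.
      apply: leq_trans (leq_mul (leqnn n) (card_bigcup_leq _ _)) _.
      by rewrite big_distrr /=; apply: leq_sum => i _; rewrite card_tuples1.
    by rewrite sum_nat_const card_ord (mulnA (2 * y)) (mulnA (2 * y * r)) leq_mul2r satP orbT.
  have le2 : 2 * y * (n * #|\bigcup_(ij : 'I_r * 'I_r | ij.1 != ij.2)
      [set f : tup | f ij.2 \in ball E g (f ij.1)]|) <= n * n ^ r.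
    apply: leq_trans (_ : 2 * y * (\sum_(ij : 'I_r * 'I_r) De.+1 ^ g * n ^ r) <= _).
      rewrite leq_mul2l; apply/orP; right.
      apply: leq_trans (leq_mul (leqnn n) (card_bigcup_leq _ _)) _.
      rewrite big_distrr /= big_mkcond; apply: leq_sum => ij _.
      case: ifP => // neq; apply: (card_tuples2 (B := fun x => ball E g x)) => // x.
      exact: card_ball.
    rewrite sum_nat_const card_prod card_ord mulnn (mulnA (2 * y)) (mulnA (2 * y * r ^ 2)).
    by rewrite leq_mul2r n_big orbT.
  have le3 : #|bad| <= #|\bigcup_i tuples_in (fun l => if l == i then Sat else setT)| +
      #|\bigcup_(ij : 'I_r * 'I_r | ij.1 != ij.2) [set f : tup | f ij.2 \in ball E g (f ij.1)]|.
    exact: leq_card_setU.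
  move: le1 le2 le3; move: #|bad| #|_| #|_| (y) => x x1 x2 z le1 le2 le3.
  have := leq_mul (leqnn (2 * z * n)) le3; move: le1 le2; clear; lia.
have goodin I : I \in alive E -> n ^ r <= y * #|tuples_in (fun=> I) :\: bad|.
  rewrite inE => /andP[bigI _].
  have le1 : 2 * n ^ r <= y * #|tuples_in (fun=> I)|.
    by rewrite card_tuples_const /y -mulnA leq_mul2l -expnMn leq_exp2r.
  have le2 : #|tuples_in (fun=> I)| <= #|tuples_in (fun=> I) :\: bad| + #|bad|.
    by rewrite -(cardsID bad) addnC leq_add2l subset_leq_card // subsetIr.
  have := leq_mul (leqnn y) le2; rewrite mulnDr; move: le1 badP.
  move: (n ^ r) (y * _) (y * _) (y * _); clear; lia.
pose hit (f : tup) := [set I in alive E | [forall i, f i \in I]].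
have [f fgood fhit] : exists2 f, f \notin bad & #|alive E| <= y * #|hit f|.
  apply/exists_inP; apply: contraT; rewrite negb_exists_in => /forall_inP none.
  have le1 : \sum_(f : tup | f \notin bad) y * #|hit f| <= n ^ r * #|alive E|.-1.
    apply: leq_trans (_ : \sum_(f : tup) #|alive E|.-1 <= _).
      rewrite big_mkcond; apply: leq_sum => f _; case: ifP => // fb.
      by rewrite -ltnS prednK // ltnNge; apply: none.
    by rewrite sum_nat_const card_ffun card_ord.
  have le2 : n ^ r * #|alive E| <= \sum_(f : tup | f \notin bad) y * #|hit f|.
    rewrite -big_distrr /= mulnC -sum_nat_const.
    apply: leq_trans (_ : \sum_(I in alive E) y * #|tuples_in (fun=> I) :\: bad| <= _).
      by apply: leq_sum => I /goodin.
    rewrite -big_distrr /= leq_mul2l; apply/orP; right.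
    have -> : \sum_(I in alive E) #|tuples_in (fun=> I) :\: bad| =
        \sum_(I in alive E) \sum_(f : tup | f \notin bad) nat_of_bool [forall i, f i \in I].
      apply: eq_bigr => I _; rewrite -sum1_card big_mkcond [RHS]big_mkcond; apply: eq_bigr => f _.
      by rewrite in_setD mem_tuples; case: (f \in bad); case: [forall i, f i \in I].
    rewrite exchange_big /=; apply: leq_sum => f _; rewrite -sum1_card big_mkcond [leqRHS]big_mkcond.
    apply: leq_sum => I _; rewrite !inE; case: (_ && _) => //=.
  have := leq_trans le2 le1; rewrite leq_pmul2l ?expn_gt0 ?n0 //.
  by move: alive0; clear; lia.
have [fsat ffar] : (forall i, deg E (f i) <= De - r) /\ far E f.
  move: fgood; rewrite in_setU negb_or => /andP[b1 b2]; split.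
    move=> i; rewrite leqNgt; apply: contra b1 => lti; apply/bigcupP; exists i => //.
    by rewrite mem_tuples; apply/forallP => l; case: eqP => [->|_]; rewrite inE.
  apply/forallP => i; apply/forallP => j; apply/implyP => ij; apply: contra b2 => fb.
  by apply/bigcupP; exists (i, j); rewrite // inE.
pose E' := add_clique E f.
have newdeg x : deg E' x <= deg E x + (if x \in codom f then r else 0).
  rewrite /deg; case: ifP => xf.
    apply: leq_trans (_ : #|[set z | E x z] :|: [set z in codom f]| <= _).
      by apply/subset_leq_card/subsetP => z; rewrite !inE => /orP[->|/and3P[_ _ ->]]; rewrite ?orbT.
    apply: leq_trans (leq_card_setU _ _) _; rewrite leq_add2l cardsE.
    by rewrite (leq_trans (card_size _)) // size_codom card_ord.
  rewrite addn0; apply/subset_leq_card/subsetP => z; rewrite !inE => /orP[//|/and3P[_]].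
  by rewrite xf.
exists E'; split.
- move=> u v; rewrite /E' /add_clique Esym eq_sym; congr (_ || (_ && _)); exact: andbC.
- by move=> u; rewrite /E' /add_clique Eirr eqxx.
- exact: Inv_add.
- move=> x; apply: leq_trans (newdeg x) _; case: ifP => [/codomP[i ->]|_]; last by rewrite addn0.
  by apply: leq_trans (leq_add (fsat i) (leqnn r)) _; rewrite subnK // leq_addl.
split.
  apply: leq_trans (leq_sum _ (fun x _ => newdeg x)) _; rewrite big_split /= mulSn addnC leq_add //.
  rewrite -big_mkcond sum_nat_const -mulnn leq_mul2r; apply/orP; right.
  by rewrite (leq_trans (card_size _)) // size_codom card_ord.
have alive' : #|alive E'| <= #|alive E| - #|hit f|.
  have hitsub : hit f \subset alive E by apply/subsetP => I; rewrite inE => /andP[].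
  rewrite -cardsDS //; apply/subset_leq_card/subsetP => I; rewrite !inE => /andP[-> nc] /=.
  apply/andP; split.
    apply: contra nc => /andP[_ fI]; apply/existsP; exists f; rewrite fI /=.
    apply/forallP => i; apply/forallP => j; apply/implyP => ij.
    rewrite /E' /add_clique !codom_f !andbT; apply/orP; right.
    have /forallP/(_ i)/forallP/(_ j)/implyP/(_ ij) := ffar.
    by apply: contraNneq => ->; exact: ball_refl.
  apply: contra nc => /existsP[h /andP[hI /forallP hE]]; apply/existsP; exists h; rewrite hI /=.
  apply/forallP => i; apply/forallP => j; apply/implyP => ij.
  by rewrite /E' /add_clique; have /forallP/(_ j)/implyP/(_ ij)-> := hE i.
have le1 : y * #|alive E'| <= y.-1 * #|alive E|.
  apply: leq_trans (leq_mul (leqnn y) alive') _; rewrite mulnBr.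
  have : y * #|alive E| = y.-1 * #|alive E| + #|alive E| by rewrite -mulSnr prednK.
  by move: fhit => h e; rewrite leq_subLR e addnC leq_add2r.
rewrite expnSr -mulnA.
apply: leq_trans (leq_mul (leqnn _) le1) _.
by rewrite mulnCA expnS -mulnA leq_mul2l Ealive orbT.
Qed.

(** Each step multiplies the bound on the number of surviving sets by [1 - 1 / y], so [y * (n + 1)]
    steps bring it from [2 ^ n] below 1. *)
Lemma sparse_graph : exists E : rel V, [/\ symmetric E, irreflexive E, Inv E &
  forall I : {set V}, n <= s * #|I| -> clique_in E I].
Proof.
have iter_step t : t <= y * n.+1 -> exists E, stage E t.
  elim: t => [_|t IH lt]; last by have [E /(step lt)] := IH (ltnW lt).
  exists (fun _ _ => false); split=> //; first by move=> x; rewrite /deg eq_card0 // => z; rewrite inE.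
  split; last first.
    rewrite !expn0 !mul1n -cardsT -card_powerset subset_leq_card //.
    by apply/subsetP => I _; rewrite powersetE subsetT.
  by rewrite big1 // => x _; rewrite /deg eq_card0 // => z; rewrite inE.
have [E [Esym Eirr EInv _ [_ Ealive]]] := iter_step _ (leqnn _).
exists E; split=> // I bigI; apply: contraLR Ealive => nc.
have a0 : 0 < #|alive E| by apply/card_gt0P; exists I; rewrite inE bigI.
rewrite -ltnNge (expnM y y) (expnM y.-1 y).
have p0 : 0 < y ^ y by rewrite expn_gt0 y0.
apply: (@leq_trans ((y ^ y) ^ n.+1)); last by rewrite leq_pmulr.
have le1 : 2 ^ n.+1 * (y.-1 ^ y) ^ n.+1 <= (y ^ y) ^ n.+1.
  by rewrite -expnMn leq_exp2r // double_pred_expnn.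
have [z0|z0] := posnP ((y.-1 ^ y) ^ n.+1).
  by rewrite z0 mul0n expn_gt0 p0.
apply: leq_trans le1; rewrite mulnC ltn_pmul2r // ltn_exp2l //.
Qed.
End Greedy.

(** * Distant cliques create no larger clique and no short cycle *)

Section Sparse.
Variable V : finType.

Definition no_clique m (E : rel V) :=
  forall h : 'I_m -> V, ~ (forall i j, i != j -> E (h i) (h j)).

Definition no_cycle g (E : rel V) := forall m (h : 'I_m -> V),
  2 < m <= g -> injective h -> ~ (forall i, E (h i) (h (ordS i))).

Lemma farP r g (E : rel V) (f : {ffun 'I_r -> V}) x z t : far g E f -> t <= g ->
  x \in codom f -> z \in codom f -> z \in ball E t x -> x = z.
Proof.
move=> /forallP ff tg /codomP[i ->] /codomP[j ->] fB.
have [-> //|ij] := eqVneq i j.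
have /forallP/(_ j)/implyP/(_ ij)/negP[] := ff i.
exact: subsetP (ball_leq _ _ tg) _ fB.
Qed.

(** A vertex outside the added clique would be adjacent in [E] to both ends of a new pair, which are
    at distance more than [g >= 2]. So a clique using a new pair lies inside the added one, which
    has at most [r] vertices. *)
Lemma no_clique_add r g E (f : {ffun 'I_r -> V}) : 2 <= g ->
    symmetric E -> irreflexive E -> no_clique r.+1 E -> far g E f ->
  no_clique r.+1 (add_clique E f).
Proof.
move=> g2 Esym Eirr EK ff h hE.
have hinj i j : i != j -> h i != h j.
  by move=> /hE; apply: contraTneq => ->; rewrite /add_clique Eirr eqxx.
have [/forallP old|] := boolP [forall i, forall j, (i != j) ==> E (h i) (h j)].
  by apply: (EK h) => i j ij; have /forallP/(_ j)/implyP/(_ ij) := old i.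
rewrite negb_forall => /existsP[i]; rewrite negb_forall => /existsP[j].
rewrite negb_imply => /andP[ij nE]; have := hE _ _ ij.
rewrite /add_clique (negPf nE) => /and3P[nij fi fj].
have all_f l : h l \in codom f.
  apply: contraT => fl.
  have nli : l != i by apply: contraNneq fl => ->.
  have nlj : l != j by apply: contraNneq fl => ->.
  have := hE _ _ nli; have := hE _ _ nlj; rewrite /add_clique !(negPf fl) !andbF !orbF => Elj Eli.
  move/eqP: nij; case; apply: (farP ff g2 fi fj).
  by apply: ball_step Elj; apply: (ball_step (y := h i)); rewrite ?ball_refl // Esym.
have : #|codom h| <= #|codom f|.
  by apply/subset_leq_card/subsetP => v /codomP[l ->].
rewrite card_codom; last by move=> i' j'; apply: contra_eq; apply: hinj.
by rewrite card_ord leqNgt (leq_ltn_trans (card_size _)) // size_codom card_ord.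
Qed.

Lemma iter_ordS m t (i : 'I_m) : val (iter t (@ordS m) i) = (i + t) %% m.
Proof.
elim: t => [|t IH]; first by rewrite addn0 /= modn_small.
by rewrite iterS [LHS]/= IH -(addn1 (_ %% _)) modnDml addn1 addnS.
Qed.

Lemma iter_ordS_neq m t (i : 'I_m) : 0 < t < m -> iter t (@ordS m) i != i.
Proof.
move=> /andP[t0 tm]; rewrite -val_eqE /= iter_ordS -{2}(modn_small (ltn_ord i)) -{2}(addn0 i).
by rewrite eqn_modDl mod0n modn_small // -lt0n.
Qed.

(** The added clique is one edge. The rest of a cycle through it is a walk of [m - 1] old edges
    between its ends, and [m - 1 <= g] contradicts their distance. *)
Lemma no_cycle_add g E (f : {ffun 'I_2 -> V}) :
    symmetric E -> irreflexive E -> no_cycle g E -> far g E f ->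
  no_cycle g (add_clique E f).
Proof.
move=> Esym Eirr EC ff m h /andP[m3 mg] hinj hE.
have [/forallP|] := boolP [forall i, E (h i) (h (ordS i))]; first by apply: EC; rewrite ?m3.
rewrite negb_forall => /existsP[i nE]; have := hE i.
rewrite /add_clique (negPf nE) => /and3P[nij fi fj].
have fsub v : v \in codom f -> (v == h i) || (v == h (ordS i)).
  move=> fv; apply: contraT; rewrite negb_or => /andP[v1 v2].
  have : uniq [:: v; h i; h (ordS i)] by rewrite /= !inE negb_or v1 v2 nij.
  move=> /card_uniqP /= c3; have : 3 <= #|codom f|.
    by rewrite -c3; apply/subset_leq_card/subsetP => w; rewrite !inE => /or3P[]/eqP->.
  by rewrite leqNgt ltnS (leq_trans (card_size _)) // size_codom card_ord.
have old j : j != i -> E (h j) (h (ordS j)).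
  move=> ji; have := hE j; rewrite /add_clique => /orP[//|/and3P[njj fj1 fj2]].
  have := fsub _ fj1; rewrite !(inj_eq hinj) (negPf ji) /= => /eqP jS.
  have := fsub _ fj2; rewrite jS !(inj_eq hinj).
  have := @iter_ordS_neq m 2 i m3; rewrite /= => /negPf->.
  by move=> /eqP e; move: njj; rewrite jS e eqxx.
have walk t : t < m -> h (iter t (@ordS m) (ordS i)) \in ball E t (h (ordS i)).
  elim: t => [|t IH] lt; first exact: ball_refl.
  apply: ball_step (IH (ltnW lt)) _; rewrite iterS; apply: old.
  by rewrite -iterSr iter_ordS_neq.
have m0 : 0 < m by exact: leq_trans m3.
have := walk m.-1; rewrite prednK // => /(_ (leqnn _)).
have -> : iter m.-1 (@ordS m) (ordS i) = i.
  apply/val_inj; rewrite -iterSr prednK // iter_ordS modnDr modn_small //.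
move=> /(farP ff _ fj fi) e; move/eqP: nij; case; by rewrite e // (leq_trans (leq_pred m) mg).
Qed.
End Sparse.

Lemma sparse_no_clique r s : 2 <= r -> 0 < s -> exists N, forall V : finType, N <= #|V| ->
  exists E : rel V, [/\ symmetric E, irreflexive E, no_clique r.+1 E &
    forall I : {set V}, #|V| <= s * #|I| -> clique_in r E I].
Proof.
move=> r2 s0; pose y := 2 * s ^ r.
exists (2 * y * r ^ 2 * (4 * y ^ 2 * r ^ 3 + r).+1 ^ 2) => V nbig.
apply: (@sparse_graph V r 2 s (no_clique r.+1)) nbig => //.
  by move=> h /(_ ord0 ord_max) Hh; have /Hh : ord0 != ord_max :> 'I_r.+1 by case: (r) r2.
by move=> E f; exact: no_clique_add.
Qed.

Lemma sparse_no_cycle g s : 0 < s -> exists N, forall V : finType, N <= #|V| ->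
  exists E : rel V, [/\ symmetric E, irreflexive E, no_cycle g E &
    forall I : {set V}, #|V| <= s * #|I| -> clique_in 2 E I].
Proof.
move=> s0; pose y := 2 * s ^ 2.
exists (2 * y * 2 ^ 2 * (4 * y ^ 2 * 2 ^ 3 + 2).+1 ^ g) => V nbig.
apply: (@sparse_graph V 2 g s (no_cycle g)) nbig => //.
  by move=> m h /andP[m3 _] _ /(_ (Ordinal (ltnW (ltnW m3)))).
by move=> E f; exact: no_cycle_add.
Qed.

Lemma has_copy_induced (F G : sgraph) (U : {set G}) (f : F -> G) : injective f ->
  (forall x, f x \in U) -> (forall x y, adj x y -> adj (f x) (f y)) -> has_copy F (induced U).
Proof.
move=> finj fU fE; apply/existsP; exists [ffun x => exist _ (f x) (fU x) : induced U].
apply/andP; split; first by apply/injectiveP => x y; rewrite !ffunE => -[/finj].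
by apply/forallP => x; apply/forallP => y; apply/implyP => /fE; rewrite !ffunE.
Qed.

Lemma leq_min_degree (G : sgraph) d : d <= #|G| -> (forall x : G, d <= degree x) -> d <= min_degree G.
Proof.
by move=> dG dx; rewrite /min_degree; elim/big_rec: _ => // x m _ dm; rewrite leq_min dx.
Qed.

(** * A clique joined to a sparse graph *)

Section Joined.
Variables (a : nat) (V : finType) (E : rel V).
Hypotheses (Esym : symmetric E) (Eirr : irreflexive E).

Definition joined_adj : rel ('I_a + V) := fun u v =>
  match u, v with inr x, inr y => E x y | _, _ => u != v end.

Lemma joined_adj_sym : symmetric joined_adj.
Proof. by case=> [x|x] [y|y]; rewrite /joined_adj 1?Esym // eq_sym. Qed.

Lemma joined_adj_irrefl : irreflexive joined_adj.
Proof. by move=> [x|x]; rewrite /= ?eqxx ?Eirr. Qed.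

Definition joined := SGraph joined_adj_sym joined_adj_irrefl.

Lemma card_joined : #|joined| = a + #|V|.
Proof. by rewrite card_sum card_ord. Qed.

Lemma min_degree_joined : 0 < #|V| -> a <= min_degree joined.
Proof.
move=> V0; apply: leq_min_degree; first by rewrite card_joined leq_addr.
case=> x.
  have -> : degree (inl x : joined) = #|predC1 (inl x : joined)|.
    by apply: eq_card => -[y|y]; rewrite !inE eq_sym.
  rewrite cardC1 card_joined; move: V0; clear; lia.
have inl_inj : injective (fun i => inl i : joined) by move=> i j [].
have cl : #|[set (inl i : joined) | i in [set: 'I_a]]| = a.
  by rewrite (card_imset _ inl_inj) cardsT card_ord.
rewrite -[leqLHS]cl; apply/subset_leq_card/subsetP => _ /imsetP[i _ ->].
by rewrite inE.
Qed.

Lemma alphar_joined r m : (forall I : {set V}, ~~ clique_in r E I -> #|I| <= m) ->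
  alphar r joined <= r + m.
Proof.
move=> noI; apply/bigmax_leqP => U nc.
pose J := [set i | inl i \in U]; pose I := [set x | inr x \in U].
have cU : #|U| <= #|J| + #|I|.
  have : U \subset [set (inl i : joined) | i in J] :|: [set (inr x : joined) | x in I].
    apply/subsetP => -[i|x] uU; rewrite inE; apply/orP; [left|right]; apply/imsetP.
      by exists i; rewrite ?inE.
    by exists x; rewrite ?inE.
  move=> /subset_leq_card/leq_trans; apply; apply: leq_trans (leq_card_setU _ _) _.
  by rewrite leq_add ?leq_imset_card.
apply: leq_trans cU (leq_add _ (noI _ _)).
  rewrite leqNgt; apply: contra nc => /ltnW le.
  pose g (i : complete_graph r) : joined := inl (enum_val (widen_ord le i)).
  have ginj : injective g by move=> i j [] /enum_val_inj/(congr1 val)/= /val_inj.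
  apply: (has_copy_induced (f := g)) => // [i|i j ij].
    by have := enum_valP (widen_ord le i); rewrite inE.
  by rewrite /adj /= (inj_eq ginj).
apply: contra nc => /existsP[f /andP[/forallP fI /forallP fE]].
have ff i j : i != j -> E (f i) (f j) by have /forallP/(_ j)/implyP := fE i.
apply: (has_copy_induced (F := complete_graph r) (f := fun i => inr (f i) : joined)).
- move=> i j [] e; apply: contra_eq (Eirr (f i)) => /ff; by rewrite -e => ->.
- by move=> i; have := fI i; rewrite inE.
- by move=> i j /ff.
Qed.

(** The part [D] of [F] that a copy sends to [V] misses at least [c] vertices of [F], so each of the
    disjoint tiles occupies at least [c] of the [a] clique vertices. *)
Lemma joined_tiling (F : sgraph) c (T : {set {ffun F -> joined}}) : 0 < #|V| ->
    (forall (D : {set F}) (f : F -> V), {in D &, injective f} ->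
      {in D &, forall x y, adj x y -> E (f x) (f y)} -> c <= #|~: D|) ->
  is_tiling T -> c * #|T| <= a.
Proof.
move=> /card_gt0P[v0 _] free [cT dT].
pose S (f : {ffun F -> joined}) := [set i : 'I_a | inl i \in [set f x | x : F]].
have cS f : f \in T -> c <= #|S f|.
  move=> /cT /andP[/injectiveP finj /forallP fE].
  pose D := [set x | if f x is inr _ then true else false].
  pose g x := if f x is inr v then v else v0.
  have gD x : x \in D -> f x = inr (g x) by rewrite inE /g; case: (f x).
  apply: leq_trans (free D g _ _) _ => [x y xD yD e|x y xD yD xy|].
  - by apply: finj; rewrite (gD _ xD) (gD _ yD) e.
  - by have /forallP/(_ y)/implyP/(_ xy) := fE x; rewrite (gD _ xD) (gD _ yD).
  rewrite -(card_imset _ finj); apply: leq_trans (leq_imset_card (fun i => inl i : joined) _).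
  apply/subset_leq_card/subsetP => _ /imsetP[x + ->]; rewrite !inE.
  case fx: (f x) => [i|v] // _; apply: imset_f.
  by rewrite inE -fx; apply: imset_f.
have sum_le : \sum_(f in T) #|S f| <= \sum_(i < a) 1.
  rewrite (eq_bigr (fun f => \sum_(i < a) nat_of_bool (i \in S f))); last first.
    by move=> f _; rewrite -sum1_card big_mkcond; apply: eq_bigr => i _; case: (i \in S f).
  rewrite exchange_big /=; apply: leq_sum => i _.
  rewrite -big_mkcondr sum1_card; apply/card_le1_eqP => f h /andP[fT fi] /andP[hT hi].
  apply/eqP; apply: contraT => fh; have := dT _ _ hT fT fh; rewrite -setI_eq0.
  by move=> /eqP/setP/(_ (inl i)); rewrite !inE in fi hi *; rewrite fi hi.
apply: leq_trans (_ : \sum_(f in T) #|S f| <= _); last by rewrite (leq_trans sum_le) // sum1_card card_ord.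
by rewrite mulnC -sum_nat_const leq_sum.
Qed.
End Joined.

Lemma card_covered (F G : sgraph) (T : {set {ffun F -> G}}) : #|covered T| <= #|F| * #|T|.
Proof.
apply: leq_trans (card_bigcup_leq _ _) _; rewrite mulnC -sum_nat_const.
by apply: leq_sum => f _; rewrite (leq_trans (leq_imset_card _ _)).
Qed.

Local Open Scope ring_scope.

(** With [a] just above [e * n], a tiling covers at most about [(k * e / c) * n] vertices; this is a
    proportion below 1, whereas only a bounded number may stay uncovered. *)
Lemma RTT_ge (R : realType) (r c : nat) (F : sgraph) :
    (0 < c <= #|F|)%N ->
    (forall s, (0 < s)%N -> exists N, forall V : finType, (N <= #|V|)%N ->
      exists E : rel V, [/\ symmetric E, irreflexive E,
        forall I : {set V}, (#|V| <= s * #|I|)%N -> clique_in r E I &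
        forall (D : {set F}) (f : F -> V), {in D &, injective f} ->
          {in D &, forall x y, adj x y -> E (f x) (f y)} -> (c <= #|~: D|)%N]) ->
  c%:R / #|F|%:R <= RTT R r F.
Proof.
move=> /andP[c0 cF] sparse; have [_] := RTT_largest R r F; apply.
set k := #|F| in cF *.
have k0 : 0 < k%:R :> R by rewrite ltr0n (leq_trans c0).
split=> [|e al e0 lte al0]; first by rewrite divr_ge0.
have e1 : e < 1 by apply: lt_le_trans lte _; rewrite ler_pdivrMr // mul1r ler_nat.
have gap : 0 < c%:R - k%:R * e by rewrite subr_gt0 mulrC -ltr_pdivlMr.
have d1 : 0 < 1 - e by rewrite subr_gt0.
pose fl := `|Num.floor (1 / e)|%N.
pose s := (Num.truncn (2 / al)).+1.
have sal : 2 <= s%:R * al by rewrite -ler_pdivrMr // ltW // Num.Theory.truncnS_gt.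
have [N sparseN] := sparse s isT.
pose N1 := (Num.truncn ((N%:R + 2) / (1 - e))).+1.
pose N2 := (Num.truncn ((k + c * (fl * (k - 1)))%N%:R / (c%:R - k%:R * e))).+1.
(* [N1] leaves enough vertices for the sparse graph, [N2] defeats the bounded allowance, and the
   last term absorbs the additive [r] in the bound on [alphar]. *)
exists (N1 + N2 + s * (r + 1))%N => n nbig.
pose a := (Num.truncn (e * n%:R)).+1.
have n0 : 0 <= e * n%:R by rewrite mulr_ge0 // ltW.
have ea : e * n%:R <= a%:R by apply/ltW/Num.Theory.truncnS_gt.
have ae : a%:R <= e * n%:R + 1 by rewrite -natr1 lerD2r Num.Theory.truncn_le.
have n1 : N%:R + 2 <= (1 - e) * n%:R.
  rewrite mulrC -ler_pdivrMr // ltW // (lt_le_trans (Num.Theory.truncnS_gt _)) // ler_nat.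
  by move: nbig; rewrite -/N1; clear; lia.
have n2 : (k + c * (fl * (k - 1)))%N%:R < n%:R * (c%:R - k%:R * e).
  rewrite -ltr_pdivrMr // (lt_le_trans (Num.Theory.truncnS_gt _)) // ler_nat.
  by move: nbig; rewrite -/N2; clear; lia.
have aN : (N + a + 1 <= n)%N.
  by rewrite -(ler_nat R) !natrD; move: n1 ae; rewrite mulrBl mul1r; lra.
pose V := 'I_(n - a).
have cV : #|V| = (n - a)%N by rewrite card_ord.
have [|E [Esym Eirr Ebig Efree]] := sparseN V; first by rewrite cV; move: aN; clear; lia.
have V0 : (0 < #|V|)%N by rewrite cV; move: aN; clear; lia.
exists (joined a Esym Eirr); split.
- by rewrite card_joined cV; move: aN; clear; lia.
- by apply: le_trans ea _; rewrite ler_nat min_degree_joined.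
- have le1 : (s * alphar r (joined a Esym Eirr) <= 2 * n)%N.
    have noI (I : {set V}) : ~~ clique_in r E I -> (#|I| <= n %/ s)%N.
      move=> nI; rewrite leq_divRL //; apply: contraR nI; rewrite -ltnNge => lt.
      by apply: Ebig; rewrite cV mulnC; move: lt; clear; lia.
    apply: leq_trans (leq_mul (leqnn s) (alphar_joined a Esym Eirr noI)) _.
    rewrite mulnDr mul2n -addnn leq_add //; last by rewrite mulnC leq_trunc_div.
    by move: nbig; rewrite mulnDr; move: (s * r)%N; clear; lia.
  rewrite -(ler_pM2l (_ : 0 < s%:R :> R)) ?ltr0n // mulrA -natrM.
  apply: le_trans (_ : (2 * n)%N%:R <= _); first by rewrite ler_nat.
  by rewrite natrM ler_wpM2r.
case=> T tilT; rewrite /quasiperfect -/k => qp.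
have cT := joined_tiling V0 Efree tilT.
have unc : (#|~: covered T| <= fl * (k - 1))%N.
  rewrite -lez_nat PoszM gez0_abs //.
  by rewrite Num.Theory.floor_ge0 divr_ge0 // ltW.
have tot : (n <= fl * (k - 1) + k * #|T|)%N.
  have := cardsC (covered T); rewrite card_joined cV.
  have := card_covered T; rewrite -/k; move: unc aN; clear; lia.
have : (c * n <= c * (fl * (k - 1)) + k * a)%N.
  apply: leq_trans (leq_mul (leqnn c) tot) _; rewrite mulnDr leq_add2l mulnCA.
  by rewrite leq_mul2l cT orbT.
rewrite -(ler_nat R) natrM natrD [(k * a)%N%:R]natrM.
move: n2; rewrite natrD.
have : k%:R * a%:R <= k%:R * (e * n%:R + 1) by rewrite ler_wpM2l // ltW.
move: (k%:R : R) ((c * _)%N%:R : R) (c%:R : R) (n%:R : R) (a%:R : R) => x1 x2 x3 x4 x5.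
by nra.
Qed.

(** A cycle of [F] inside [D] would be mapped to a cycle of at most [#|F|] edges, so [D] induces a
    forest and [~: D] competes in the minimum defining [gamma F]. *)
Lemma gamma_leq_uncovered (F : sgraph) (V : finType) (E : rel V) (D : {set F}) (f : F -> V) :
    no_cycle #|F| E -> {in D &, injective f} ->
    {in D &, forall x y, adj x y -> E (f x) (f y)} -> (gamma F <= #|~: D|)%N.
Proof.
move=> EC finj fE; apply: bigmin_leq; first by rewrite mem_index_enum.
apply/asboolP => m m3; rewrite finset.setCK.
apply/negP => /existsP[h /andP[/injectiveP hinj /forallP hE]].
apply: (EC m (fun i => f (val (h i)))).
- rewrite m3 -[m in (m <= _)%N]card_ord -(card_imset _ (inj_comp val_inj hinj)).
  exact: max_card.
- by move=> i j /finj e; apply/hinj/val_inj/e; exact: valP.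
move=> i; apply: fE; rewrite ?(valP (h _)) //.
have /forallP/(_ (ordS i))/implyP := hE i; apply.
rewrite /adj /= /cycle_adj eqxx andbT eq_sym.
by rewrite (@iter_ordS_neq m 1) // (leq_trans _ m3).
Qed.

Lemma complete_uncovered k (V : finType) (E : rel V) (D : {set complete_graph k})
    (f : complete_graph k -> V) :
    no_clique k E -> {in D &, forall x y, adj x y -> E (f x) (f y)} -> (0 < #|~: D|)%N.
Proof.
move=> EK fE; rewrite lt0n cards_eq0; apply/eqP => D0.
have allD x : x \in D by rewrite -[D]finset.setCK D0 !inE.
by apply: (EK f) => i j ij; apply: fE; rewrite ?allD.
Qed.

Theorem theorem1 (R : realType) (k : nat) (hk : (3 <= k)%N) :
  (forall F : sgraph, #|F| = k -> RTT R k F = 0) /\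
  (1 / k%:R <= RTT R (k - 1) (complete_graph k)) /\
  (forall F : sgraph, #|F| = k -> RTT R (k - 1) F <= 1 / k%:R) /\
  (forall T : sgraph, #|T| = k -> is_tree T -> RTT R 2 T = 0) /\
  (forall F : sgraph, #|F| = k -> (gamma F)%:R / k%:R <= RTT R 2 F) /\
  (RTT R 2 (cycle_graph k) <= 1 / k%:R).
Proof.
have k0 : (0 < k)%N by exact: leq_trans hk.
have v0P (F : sgraph) : #|F| = k -> exists v0 : F, True.
  move=> cF; have /card_gt0P[v0 _] : (0 < #|F|)%N by rewrite cF.
  by exists v0.
split=> [F cF|].
  have [v0 _] := v0P F cF.
  apply: (@RTT_eq0 R k F v0); first by rewrite cF.
    by apply: forces_clique; rewrite -cF max_card.
  by apply: forces_clique; rewrite -cF max_card.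
split.
  have ck : #|complete_graph k| = k by exact: card_ord.
  rewrite -{1}ck; apply: (@RTT_ge R (k - 1) 1); first by rewrite ck k0.
  move=> s s0; have [|N NE] := @sparse_no_clique (k - 1) s _ s0.
    by rewrite leq_subRL // addn1.
  exists N => V /NE[E [Esym Eirr EK Ebig]]; exists E; split=> // D f _.
  by apply: complete_uncovered; rewrite -[k]prednK // -subn1.
split=> [F cF|].
  have [v0 _] := v0P F cF.
  rewrite -{2}cF; apply: (@RTT_le_inv R (k - 1) F v0); first by rewrite cF.
  by apply: forces_clique; have := cardsC1 v0; rewrite cF subn1 => ->.
split=> [T cT [_ _ acT]|].
  have [v0 _] := v0P T cT.
  apply: (@RTT_eq0 R 2 T v0); first by rewrite cT.
    by apply: forces_degenerate => D _; exact: acyclic_low_degree.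
  by apply: forces_degenerate => D _; exact: acyclic_low_degree.
split=> [F cF|].
  have [v0 _] := v0P F cF.
  (* [RTT_ge] requires a positive count; when [gamma F] is 0 the bound is just nonnegativity. *)
  have [->|g0] := posnP (gamma F); first by rewrite mul0r RTT_ge0.
  rewrite -{1}cF; apply: RTT_ge.
    rewrite g0 /= /gamma; elim/big_rec: _ => // S m _ mF.
    by rewrite geq_min mF orbT.
  move=> s s0; have [N NE] := @sparse_no_cycle #|F| s s0.
  exists N => V /NE[E [Esym Eirr EC Ebig]]; exists E; split=> // D f.
  exact: gamma_leq_uncovered.
have ck : #|cycle_graph k| = k by exact: card_ord.
rewrite -{2}ck; apply: (@RTT_le_inv R 2 (cycle_graph k) (Ordinal k0 : 'I_k)); first by rewrite ck.
by apply: forces_degenerate => D sub Dn; apply: (@cycle_low_degree k (Ordinal k0)).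
Qed.
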